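(* Let $M$ be a complete hyperbolic complex manifold, of complex dimension $q$, and let $H$ be a holomorphic vector field on $M$. Suppose there exist $\lambda>0$ and a family of holomorphic mappings $(f_t\colon M\to M)_{t\in[0,\lambda)}$ with $f_0=\mathrm{id}_M$, converging uniformly on compacta to $f_0$ as $t\to0^+$, and such that for every $w\in M$ one has, in a local holomorphic coordinate chart $W\to\mathbb{C}^q$ with $w\in W$, $$\lim_{t\to0^+}\frac{f_t(z)-z}{t}=H(z)$$ uniformly for $z$ in a neighborhood of $w$. Then $H$ is an infinitesimal generator, and the semigroup $(\varphi_t)_{t\ge0}$ associated to $H$ satisfies, for every $t\ge0$, the product formula $$\varphi_t=\lim_{m\to\infty}(f_{t/m})^{\circ m},$$ where the limit is uniform on compacta of $M$.
   Context: Complex manifolds are connected. $M$ is complete hyperbolic if its Kobayashi pseudodistance $k_M$ is a distance and $(M,k_M)$ is a complete metric space. A holomorphic vector field $H$ on $M$ is an infinitesimal generator if for every $z_0\in M$ the Cauchy problem $\dot z(t)=H(z(t))$, $z(0)=z_0$, has a solution $z\colon[0,+\infty)\to M$. In that case the associated semigroup $(\varphi_t)_{t\ge0}$ consists of the holomorphic self-maps $\varphi_t\colon M\to M$ sending $z_0$ to $z(t)$, the value at time $t$ of this solution. $g^{\circ m}$ denotes the $m$-fold composition of $g$ with itself. The map $f_{t/m}$ is defined for all $m$ large enough that $t/m<\lambda$. *)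

(* Defs.v *)
From HB Require Import structures.
From mathcomp Require Export all_boot all_order all_algebra complex.
From mathcomp Require Export all_classical all_reals all_analysis.

Set Implicit Arguments.
Unset Strict Implicit.
Unset Printing Implicit Defensive.

Export Order.TTheory GRing.Theory Num.Theory numFieldNormedType.Exports.

#[global] Open Scope classical_set_scope.
#[global] Open Scope complex_scope.
#[global] Open Scope ring_scope.

(* C^q is 'rV[R[i]^o]_q with the sup norm (R[i]^o is R[i] with its norm
   topology).  Holomorphy on an open set is complex (Frechet) differentiability
   at each of its points: [differentiable] is taken over the field R[i]. *)

Section Charts.
Context {R : realType} {q : nat} {T : topologicalType}.

(* A homeomorphism from the open set [dom] onto an open subset of C^q.  The
   values of [chart_map] outside [dom], and of [chart_inv] outside the image of
   [dom], are irrelevant. *)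
Record chart := Chart {
  dom : set T;
  chart_map :> T -> 'rV[R[i]^o]_q;
  chart_inv : 'rV[R[i]^o]_q -> T;
  open_dom : open dom;
  open_codom : open (chart_map @` dom);
  chart_mapK : forall p, dom p -> chart_inv (chart_map p) = p;
  chart_map_continuous : {in dom, continuous chart_map};
  chart_inv_continuous : {in chart_map @` dom, continuous chart_inv} }.

Definition transition (c c' : chart) : 'rV[R[i]^o]_q -> 'rV[R[i]^o]_q :=
  c' \o chart_inv c.

Definition compatible (c c' : chart) :=
  forall p, dom c p -> dom c' p ->
    differentiable (transition c c') (c p) /\
    differentiable (transition c' c) (c' p).

End Charts.
Arguments chart : clear implicits.

Record complex_manifold (R : realType) (q : nat) := ComplexManifold {
  carrier :> topologicalType;
  manifold_hausdorff : hausdorff_space carrier;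
  manifold_second_countable : @second_countable carrier;
  manifold_connected : connected [set: carrier];
  atlas : set (chart R q carrier);
  atlas_cover : forall p, exists2 c, atlas c & dom c p;
  atlas_compatible : forall c c', atlas c -> atlas c' -> compatible c c';
  atlas_maximal :
    forall c, (forall c', atlas c' -> compatible c c') -> atlas c }.

Arguments atlas {R q} M : rename.

Section Holomorphy.
Context {R : realType} {q : nat} (M : complex_manifold R q).

Definition holomorphic_map (f : M -> M) :=
  continuous f /\
  forall c c' p, atlas M c -> atlas M c' -> dom c p -> dom c' (f p) ->
    differentiable (c' \o f \o chart_inv c) (c p).

(* Only the values of h on the open unit disc matter. *)
Definition holomorphic_disc (h : R[i]^o -> M) :=
  forall z : R[i]^o, `|z| < 1 ->
    {for z, continuous h} /\
    forall c, atlas M c -> dom c (h z) -> differentiable (c \o h) z.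

(* A section of the holomorphic tangent bundle, given by its components
   [vf_coord c p] in C^q at p with respect to the charts c around p. *)
Record holomorphic_vector_field := HolomorphicVectorField {
  vf_coord :> chart R q M -> M -> 'rV[R[i]^o]_q;
  vf_change : forall c c' p, atlas M c -> atlas M c' -> dom c p -> dom c' p ->
    vf_coord c' p = 'd (transition c c') (c p) (vf_coord c p);
  vf_holomorphic : forall c p, atlas M c -> dom c p ->
    differentiable (vf_coord c \o chart_inv c) (c p) }.

End Holomorphy.

Section Kobayashi.
Context {R : realType} {q : nat} (M : complex_manifold R q).

Definition poincare_distance (a b : R[i]) : R :=
  let r := Normc.normc ((a - b) / (1 - a^* * b)) in
  2^-1 * ln ((1 + r) / (1 - r)).

(* [disc_chain x y l]: some finite chain of holomorphic discs from x to y has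
   total Poincare length l. *)
Inductive disc_chain : M -> M -> R -> Prop :=
| disc_chain_nil x : disc_chain x x 0
| disc_chain_cons (h : R[i]^o -> M) (a b : R[i]) y l :
    holomorphic_disc h -> `|a| < 1 -> `|b| < 1 ->
    disc_chain (h b) y l ->
    disc_chain (h a) y (poincare_distance a b + l).

(* The set is nonempty because M is connected, so that [inf] is the infimum. *)
Definition kobayashi (x y : M) : R := inf [set l | disc_chain x y l].

Definition is_distance (d : M -> M -> R) :=
  [/\ forall x y, 0 <= d x y,
      forall x y, d x y = 0 <-> x = y,
      forall x y, d x y = d y x &
      forall x y z, d x z <= d x y + d y z].

Definition complete_distance (d : M -> M -> R) :=
  forall u : nat -> M,
    (forall e, 0 < e -> exists N, forall m n,
       (N <= m)%N -> (N <= n)%N -> d (u m) (u n) < e) ->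
    exists x, d (u n) x @[n --> \oo] --> (0 : R).

Definition complete_hyperbolic :=
  is_distance kobayashi /\ complete_distance kobayashi.

End Kobayashi.

Section Semigroups.
Context {R : realType} {q : nat} {M : complex_manifold R q}.
Variable H : holomorphic_vector_field M.

(* z' = H(z) on [0, +oo[ (with a one-sided derivative at 0) and z(0) = z0. *)
Definition cauchy_solution (z0 : M) (z : R -> M) :=
  [/\ z 0 = z0,
      {within [set t | 0 <= t], continuous z} &
      forall (t : R) c, 0 <= t -> atlas M c -> dom c (z t) ->
        ((s - t)^-1)%:C *: (c (z s) - c (z t))
          @[s --> within [set s | 0 <= s] t^'] --> H c (z t)].

Definition infinitesimal_generator := forall z0, exists z, cauchy_solution z0 z.

Definition associated_semigroup (phi : R -> M -> M) :=
  (forall t : R, 0 <= t -> holomorphic_map (phi t)) /\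
  (forall z0, cauchy_solution z0 (phi^~ z0)).

(* In some holomorphic chart around w, (f_t(z) - z)/t converges to H(z) as
   t -> 0+, uniformly for z in some neighborhood V of w.  The difference
   quotient only makes sense if f_t(z) lies in the domain of the chart. *)
Definition tangent_near (f : R -> M -> M) (w : M) :=
  exists2 c, atlas M c /\ dom c w &
  exists2 V, nbhs w V /\ V `<=` dom c &
  forall e : R, 0 < e -> \forall t \near 0^'+, forall z, V z ->
    dom c (f t z) /\ `|(t^-1)%:C *: (c (f t z) - c z) - H c z| < e%:C.

End Semigroups.

(* As M carries no preferred uniform structure, uniform convergence on compacta
   of maps M -> M is convergence for the compact-open topology, i.e. the
   library's [{compact-open, F --> f}]; for continuous f this is uniform
   convergence on compacta with respect to any distance inducing the topology
   of M. *)

(* Main.v *)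
(* Write d for the Kobayashi distance.  Holomorphic self-maps do not increase d,
   and d induces the topology of M: a chain of discs leaving a coordinate ball
   crosses its compact boundary, on which the distance to the centre is bounded
   below.  In a chart, f_h^j (y) = y + jh H(y) + o(jh) uniformly, so that f_h^j
   and f_h'^j' differ by o(jh) in the distance d when jh is close to j'h'; since
   no f_h increases d, these errors only add up, and f_h^k (z) is a d-Cauchy net as
   h -> 0 and kh -> t, first for small t.  The bound
   d(f_h^k (z), f_h^j (z)) <= K |k - j| h and completeness then carry the
   convergence over to all t >= 0.  The limits X_t form a semigroup of nonexpansive
   maps, they solve z' = H(z) by the same estimate, and any solution z coincides
   with t |-> X_t (z(0)) because t |-> d(z(t), X_t (z(0))) has nonpositive upper
   right derivative.  Finally X_t is holomorphic by Weierstrass's theorem.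

   Holomorphy means complex differentiability at each point, so Weierstrass's
   theorem and the local Lipschitz continuity of H need Cauchy's theory.  It is
   derived from the mean value property on circles, which is Goursat's bisection
   argument in polar coordinates. *)

From HB Require Import structures.
Require Import Defs.
From mathcomp Require Import lra ring.

Set Implicit Arguments.
Unset Strict Implicit.
Unset Printing Implicit Defensive.

(** * Green's theorem for differentiable pairs *)

(** No existence theorem for differential equations is invoked: the family [f] itself builds the
    flow, and errors are controlled because no map in sight increases the distance. Limits are taken
    over all pairs of a step [h] and a count [k] with [k h] near [t], not only along [h = t / m]:
    comparing the times [t], [u] and [t + u] needs one common step, which need not divide any of
    them. Short times come first because the consistency estimate is local in M; completeness
    supplies the limit point from which to restart.

    Complex differentiability comes without continuity of the derivative, so Green's formula is
    proved by subdivision. No contour integral is formed: primitives in one variable and the mean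
    value theorem show that [Im phi] takes a common value on any two small concentric circles. This
    weak fact suffices, since a unimodular factor makes [phi 0] purely imaginary, and it tolerates a
    puncture at the centre. It therefore applies to difference quotients, which yields Cauchy's
    estimate and then second-order Taylor bounds without differentiating a derivative. *)

Lemma green_goursat_local (R : realType) (U V W Z : R -> R -> R)
    (x1 x2 y1 y2 u0 v0 x0 y0 A B C e : R) :
  x1 < x2 -> y1 < y2 -> 
  x1 <= x0 <= x2 -> y1 <= y0 <= y2 -> 0 <= e ->
  (forall x y, x1 <= x <= x2 -> y1 <= y <= y2 ->
    is_derive x (1:R) (W^~ y) (U x y)) ->
  (forall x y, x1 <= x <= x2 -> y1 <= y <= y2 ->
    is_derive y (1:R) (Z x) (V x y)) ->
  (forall x y, x1 <= x <= x2 -> y1 <= y <= y2 ->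
    `|U x y - u0 - (A * (x - x0) + B * (y - y0))| <= e * (`|x - x0| + `|y - y0|) /\
    `|V x y - v0 - (C * (y - y0) - B * (x - x0))| <= e * (`|x - x0| + `|y - y0|)) ->
  `|(W x2 y2 + Z x2 y2) - (W x2 y1 + Z x2 y1)
    - (W x1 y2 + Z x1 y2) + (W x1 y1 + Z x1 y1)| <=
    2 * e * ((x2 - x1) + (y2 - y1)) ^+ 2.
Proof.
move=> x12 y12 hx0 hy0 e0 hW hZ hUV.
have osc x y : x1 <= x <= x2 -> y1 <= y <= y2 ->
    `|x - x0| + `|y - y0| <= (x2 - x1) + (y2 - y1).
  move=> hx hy; apply: lerD; rewrite ler_norml; lra.
(* The mean value theorem is applied to a difference in the other variable, so both values of [U]
   have the same abscissa and the [A] terms cancel; likewise the [C] terms for [V]. *)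
have [xi xiI Wxi] : exists2 xi, xi \in `]x1, x2[ &
    (W x2 y2 - W x2 y1) - (W x1 y2 - W x1 y1) = (U xi y2 - U xi y1) * (x2 - x1).
  have der x : x1 <= x <= x2 ->
      is_derive x (1:R) (fun x => W x y2 - W x y1) (U x y2 - U x y1).
    move=> hx; apply: is_deriveB; apply: hW; rewrite // lexx ltW//.
  apply: (@MVT R (fun x => W x y2 - W x y1) (fun x => U x y2 - U x y1)) => //.
    by move=> x; rewrite in_itv/= => /andP[h1 h2]; apply: der; rewrite !ltW.
  apply: derivable_within_continuous => x; rewrite in_itv/= => hx.
  by case: (der x hx).
have [ze zeI Zze] : exists2 ze, ze \in `]y1, y2[ &
    (Z x2 y2 - Z x1 y2) - (Z x2 y1 - Z x1 y1) = (V x2 ze - V x1 ze) * (y2 - y1).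
  have der y : y1 <= y <= y2 ->
      is_derive y (1:R) (fun y => Z x2 y - Z x1 y) (V x2 y - V x1 y).
    move=> hy; apply: is_deriveB; apply: hZ; rewrite // lexx ltW//.
  apply: (@MVT R (fun y => Z x2 y - Z x1 y) (fun y => V x2 y - V x1 y)) => //.
    by move=> x; rewrite in_itv/= => /andP[h1 h2]; apply: der; rewrite !ltW.
  apply: derivable_within_continuous => x; rewrite in_itv/= => hx.
  by case: (der x hx).
have le2 : 0 <= 2 * e * (x2 - x1 + (y2 - y1)) by rewrite !mulr_ge0//; lra.
have bnd (r s t : R) x y : x1 <= x <= x2 -> y1 <= y <= y2 ->
   `|r| <= e * (`|x - x0| + `|y - y0|) -> `|r| <= e * (x2 - x1 + (y2 - y1)).
  by move=> hx hy h; apply: (le_trans h); rewrite ler_wpM2l// osc.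
set S := x2 - x1 + (y2 - y1) in le2 bnd *.
have UB : `|(U xi y2 - U xi y1) - B * (y2 - y1)| <= 2 * e * S.
  have hxi : x1 <= xi <= x2 by move: xiI; rewrite in_itv/= => /andP[? ?]; rewrite !ltW.
  have hy2 : y1 <= y2 <= y2 by rewrite lexx ltW.
  have hy1 : y1 <= y1 <= y2 by rewrite lexx ltW.
  have [/(bnd _ 0 0 _ _ hxi hy2) h2 _] := hUV _ _ hxi hy2.
  have [/(bnd _ 0 0 _ _ hxi hy1) h1 _] := hUV _ _ hxi hy1.
  move: h1 h2; rewrite !ler_norml; lra.
have VB : `|(V x2 ze - V x1 ze) + B * (x2 - x1)| <= 2 * e * S.
  have hze : y1 <= ze <= y2 by move: zeI; rewrite in_itv/= => /andP[? ?]; rewrite !ltW.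
  have hx2 : x1 <= x2 <= x2 by rewrite lexx ltW.
  have hx1 : x1 <= x1 <= x2 by rewrite lexx ltW.
  have [_ /(bnd _ 0 0 _ _ hx2 hze) h2] := hUV _ _ hx2 hze.
  have [_ /(bnd _ 0 0 _ _ hx1 hze) h1] := hUV _ _ hx1 hze.
  move: h1 h2; rewrite !ler_norml; lra.
(* The opposite signs of [B] express that the form is closed: the two main terms cancel and only the
   errors remain. *)
have -> : (W x2 y2 + Z x2 y2) - (W x2 y1 + Z x2 y1)
    - (W x1 y2 + Z x1 y2) + (W x1 y1 + Z x1 y1) =
  ((U xi y2 - U xi y1) - B * (y2 - y1)) * (x2 - x1) +
  ((V x2 ze - V x1 ze) + B * (x2 - x1)) * (y2 - y1).
  transitivity ((W x2 y2 - W x2 y1 - (W x1 y2 - W x1 y1)) +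
                (Z x2 y2 - Z x1 y2 - (Z x2 y1 - Z x1 y1))); first by ring.
  rewrite Wxi Zze; ring.
apply: (le_trans (ler_normD _ _)); rewrite !normrM.
have h1 : 0 <= x2 - x1 by lra.
have h2 : 0 <= y2 - y1 by lra.
rewrite (ger0_norm h1) (ger0_norm h2).
have -> : 2 * e * S ^+ 2 = 2 * e * S * (x2 - x1) + 2 * e * S * (y2 - y1).
  rewrite /S; ring.
by apply: lerD; rewrite ler_wpM2r.
Qed.

Section goursat.
Context (R : realType) (F : R -> R -> R) (a c l1 l2 : R).

Let D n x y := F (x + l1 / 2 ^+ n) (y + l2 / 2 ^+ n) - F (x + l1 / 2 ^+ n) y
  - F x (y + l2 / 2 ^+ n) + F x y.

(** Goursat's choice of a quarter: the mixed difference is additive over the four quarters, so if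
    each of the first three carries less than a fourth of it, the last one carries at least a
    fourth. *)
Let step n (p : R * R) : R * R :=
  let x' := p.1 + l1 / 2 ^+ n.+1 in let y' := p.2 + l2 / 2 ^+ n.+1 in
  if `|D n p.1 p.2| <= 4 * `|D n.+1 p.1 p.2| then p else
  if `|D n p.1 p.2| <= 4 * `|D n.+1 x' p.2| then (x', p.2) else
  if `|D n p.1 p.2| <= 4 * `|D n.+1 p.1 y'| then (p.1, y') else (x', y').

Let half (l : R) n : l / 2 ^+ n = l / 2 ^+ n.+1 + l / 2 ^+ n.+1.
Proof.
rewrite -mulrDl exprS invfM mulrA; congr (_ / _).
by rewrite -[in RHS](mulr1n l) -mulrnDr mulr2n mulrDl -splitr.
Qed.

Let stepP n p : `|D n p.1 p.2| <= 4 * `|D n.+1 (step n p).1 (step n p).2|.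
Proof.
rewrite /step; case: ifPn => // h1; case: ifPn => //= h2; case: ifPn => //= h3.
move: h1 h2 h3; rewrite -!ltNge => h1 h2 h3.
set x' := p.1 + _; set y' := p.2 + _.
have E : D n p.1 p.2 = D n.+1 p.1 p.2 + D n.+1 x' p.2 + D n.+1 p.1 y' + D n.+1 x' y'.
  rewrite /D (half l1) (half l2) !addrA -/x' -/y'; ring.
have : `|D n p.1 p.2| <= `|D n.+1 p.1 p.2| + `|D n.+1 x' p.2| + `|D n.+1 p.1 y'| + `|D n.+1 x' y'|.
  by rewrite E !(le_trans (ler_normD _ _)) // !lerD// !(le_trans (ler_normD _ _)) // !lerD// ler_normD.
rewrite -/x' -/y' in h2 h3; lra.
Qed.

Fixpoint bisect n : R * R := if n is m.+1 then step m (bisect m) else (a, c).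

Hypotheses (l1_gt0 : 0 < l1) (l2_gt0 : 0 < l2).

Lemma bisect_grow n : `|D 0 a c| <= 4 ^+ n * `|D n (bisect n).1 (bisect n).2|.
Proof.
elim: n => [|n IH]; first by rewrite expr0 mul1r.
apply: (le_trans IH); rewrite exprSr -mulrA ler_wpM2l ?exprn_ge0//; exact: stepP.
Qed.

Let q1 n : 0 < l1 / 2 ^+ n. Proof. by rewrite divr_gt0// exprn_gt0. Qed.
Let q2 n : 0 < l2 / 2 ^+ n. Proof. by rewrite divr_gt0// exprn_gt0. Qed.

Lemma bisect_nested n : [/\ (bisect n).1 <= (bisect n.+1).1,
  (bisect n.+1).1 + l1 / 2 ^+ n.+1 <= (bisect n).1 + l1 / 2 ^+ n,
  (bisect n).2 <= (bisect n.+1).2 &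
  (bisect n.+1).2 + l2 / 2 ^+ n.+1 <= (bisect n).2 + l2 / 2 ^+ n].
Proof.
have := q1 n.+1; have := q2 n.+1; rewrite (half l1 n) (half l2 n) /= /step.
by case: ifP => _ /=; [split; lra|]; case: ifP => _ /=; [split; lra|];
  case: ifP => _ /=; split; lra.
Qed.
End goursat.

Lemma nested_point (R : realType) (x q : nat -> R) :
  (forall n, x n <= x n.+1) -> (forall n, x n.+1 + q n.+1 <= x n + q n) ->
  (forall n, 0 <= q n) ->
  exists x0, forall n, x n <= x0 <= x n + q n.
Proof.
move=> h1 h2 h3.
have mon n m : x n <= x (n + m)%N.
  by elim: m => [|m IH]; rewrite ?addn0// addnS (le_trans IH).
have mon2 n m : x (n + m)%N + q (n + m)%N <= x n + q n.
  by elim: m => [|m IH]; rewrite ?addn0// addnS (le_trans (h2 _)).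
have ub n m : x m <= x n + q n.
  have [/subnK<-|/ltnW/subnK<-] := leqP n m.
    by rewrite addnC; apply: le_trans (mon2 n (m - n)%N); rewrite lerDl.
  by rewrite [(_ + m)%N]addnC; apply: (le_trans (mon m (n - m)%N)); rewrite lerDl.
exists (sup (range x)) => n; apply/andP; split.
  apply: ub_le_sup; last by exists n.
  by exists (x 0%N + q 0%N) => _ [m _ <-].
by apply: ge_sup; [exists (x 0%N); exists 0%N | move=> _ [m _ <-]].
Qed.

(* [W] and [Z] are primitives of [U] and [V] in one variable each, so that the
   mixed second difference below is, up to sign, the integral of [U dx - V dy]
   along the boundary of the rectangle. *)
Lemma green_goursat (R : realType) (U V W Z : R -> R -> R) (a b c d : R) :
  a < b -> c < d ->
  (forall x y, a <= x <= b -> c <= y <= d ->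
    is_derive x (1:R) (W^~ y) (U x y)) ->
  (forall x y, a <= x <= b -> c <= y <= d ->
    is_derive y (1:R) (Z x) (V x y)) ->
  (forall x0 y0, a <= x0 <= b -> c <= y0 <= d -> exists A B C : R,
    forall e : R, 0 < e -> exists2 s : R, 0 < s &
    forall x y, a <= x <= b -> c <= y <= d -> `|x - x0| < s -> `|y - y0| < s ->
    `|U x y - U x0 y0 - (A * (x - x0) + B * (y - y0))| <= e * (`|x - x0| + `|y - y0|) /\
    `|V x y - V x0 y0 - (C * (y - y0) - B * (x - x0))| <= e * (`|x - x0| + `|y - y0|)) ->
  (W b d + Z b d) - (W b c + Z b c) - (W a d + Z a d) + (W a c + Z a c) = 0.
Proof.
move=> ab cd hW hZ hUV.
pose F x y := W x y + Z x y.
have l1 : 0 < b - a by lra.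
have l2 : 0 < d - c by lra.
pose p n := bisect F a c (b - a) (d - c) n.
pose q1 n := (b - a) / 2 ^+ n.
pose q2 n := (d - c) / 2 ^+ n.
have q1p n : 0 < q1 n by rewrite divr_gt0// exprn_gt0.
have q2p n : 0 < q2 n by rewrite divr_gt0// exprn_gt0.
have nest := bisect_nested F a c l1 l2.
have [x0 hx0] : exists x0, forall n, (p n).1 <= x0 <= (p n).1 + q1 n.
  by apply: nested_point => n; [case: (nest n)|case: (nest n)|rewrite ltW].
have [y0 hy0] : exists y0, forall n, (p n).2 <= y0 <= (p n).2 + q2 n.
  by apply: nested_point => n; [case: (nest n)|case: (nest n)|rewrite ltW].
have in1 n : a <= (p n).1 /\ (p n).1 + q1 n <= b.
  elim: n => [|n [h1 h2]]; first by rewrite /p /q1 /= expr0 divr1; lra.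
  by case: (nest n) => ? ? _ _; split; [exact: le_trans h1 _|exact: le_trans h2].
have in2 n : c <= (p n).2 /\ (p n).2 + q2 n <= d.
  elim: n => [|n [h1 h2]]; first by rewrite /p /q2 /= expr0 divr1; lra.
  by case: (nest n) => _ _ ? ?; split; [exact: le_trans h1 _|exact: le_trans h2].
set D0 := (X in X = 0).
have D0E n : `|D0| <= 4 ^+ n * `|F ((p n).1 + q1 n) ((p n).2 + q2 n) -
    F ((p n).1 + q1 n) (p n).2 - F (p n).1 ((p n).2 + q2 n) + F (p n).1 (p n).2|.
  have := bisect_grow F a c (b - a) (d - c) n.
  by rewrite expr0 !divr1 !(addrC a) !(addrC c) !subrK.
have x0I : a <= x0 <= b by have := hx0 0%N; have := in1 0%N; lra.
have y0I : c <= y0 <= d by have := hy0 0%N; have := in2 0%N; lra.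
have [A [B [C hl]]] := hUV _ _ x0I y0I.
have key e : 0 < e -> `|D0| <= e * (2 * ((b - a) + (d - c)) ^+ 2).
  move=> e0; have [s s0 hs] := hl e e0.
  have [n nP] : exists n, (q1 n < s) /\ (q2 n < s).
    have : (b - a + (d - c)) / 2 ^+ n @[n --> \oo] --> (0:R).
      have := @cvg_geometric R (b - a + (d - c)) 2^-1.
      rewrite ger0_norm ?invr_ge0// invf_lt1// ltr1n => /(_ isT).
      by under [X in X @ _ --> _]funext => n do rewrite /geometric/= exprVn.
    move/cvgrPdist_lt => /(_ s s0)[n _ /(_ n (leqnn n))] /=.
    rewrite sub0r normrN ger0_norm; last by rewrite divr_ge0// ?exprn_ge0//; lra.
    rewrite mulrDl -/(q1 n) -/(q2 n) => h.
    by exists n; have := q1p n; have := q2p n; lra.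
  (* The factor [4 ^+ n] lost in the subdivision is regained exactly from the square of the side
     lengths. *)
  apply: (le_trans (D0E n)).
  have [i1 i2] := in1 n; have [i3 i4] := in2 n; have Hx := hx0 n; have Hy := hy0 n.
  have Q1 := q1p n; have Q2 := q2p n; case: nP => nP1 nP2.
  have : `|F ((p n).1 + q1 n) ((p n).2 + q2 n) - F ((p n).1 + q1 n) (p n).2 -
      F (p n).1 ((p n).2 + q2 n) + F (p n).1 (p n).2| <=
      2 * e * ((p n).1 + q1 n - (p n).1 + ((p n).2 + q2 n - (p n).2)) ^+ 2.
    apply: (@green_goursat_local R U V W Z _ _ _ _ (U x0 y0) (V x0 y0) x0 y0 A B C);
      rewrite ?ltrDl//.
    - exact: ltW.
    - by move=> x y hx hy; apply: hW; clear -hx hy i1 i2 i3 i4; lra.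
    - by move=> x y hx hy; apply: hZ; clear -hx hy i1 i2 i3 i4; lra.
    - move=> x y hx hy; apply: hs; rewrite ?ltr_norml;
        clear -hx hy i1 i2 i3 i4 Q1 Q2 Hx Hy nP1 nP2; lra.
  have -> : 2 * e * ((p n).1 + q1 n - (p n).1 + ((p n).2 + q2 n - (p n).2)) ^+ 2 =
     (4 ^+ n)^-1 * (e * (2 * (b - a + (d - c)) ^+ 2)).
    have -> : (p n).1 + q1 n - (p n).1 + ((p n).2 + q2 n - (p n).2) =
      (b - a + (d - c)) / 2 ^+ n by rewrite /q1 /q2; ring.
    have -> : (4 : R) ^+ n = 2 ^+ n ^+ 2.
      by rewrite -exprM mulnC exprM; congr (_ ^+ _); ring.
    by rewrite exprMn exprVn; ring.
  by rewrite ler_pdivlMl ?exprn_gt0.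
apply/eqP; rewrite -normr_le0; apply/ler_addgt0Pl => e e0; rewrite addr0.
set K := 2 * _ in key.
have K0 : 0 <= K by rewrite mulr_ge0// sqr_ge0.
have := key (e / (K + 1)); rewrite divr_gt0//; last lra.
move/(_ isT)/le_trans; apply.
rewrite mulrAC ler_pdivrMr; last lra.
by rewrite ler_wpM2l ?ltW//; lra.
Qed.

(** * Total differentiability in the real plane, and primitives *)

Section real_calculus.
Context {R : realType}.
Implicit Types (f g : R -> R -> R) (x y e s : R).

Lemma is_derive_eps (f : R -> R) x a : is_derive x (1:R) f a ->
  forall e, 0 < e -> exists2 s : R, 0 < s &
    forall y, `|y - x| < s -> `|f y - f x - a * (y - x)| <= e * `|y - x|.
Proof.
move=> [/derivable_nbhs df <-] e e0.
have /eqaddoP /(_ e e0) /nbhs_ballP [s s0 hs] := df.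
exists s => // y yx; have := hs (y - x).
rewrite /ball/= sub0r normrN => /(_ yx).
rewrite /cst !fctE /= scaler1 subrK opprD addrA /GRing.scale/= mulrC.
by rewrite [_ * (y - x)]mulrC.
Qed.

(** Total differentiability with partial derivatives [A] and [B]: the subdivision argument needs
    this and not merely the existence of the partials. *)
Definition fd2 f x0 y0 A B := forall e, 0 < e -> exists2 s : R, 0 < s &
  forall x y, `|x - x0| < s -> `|y - y0| < s ->
  `|f x y - f x0 y0 - (A * (x - x0) + B * (y - y0))| <= e * (`|x - x0| + `|y - y0|).

Lemma fd2_fst (f : R -> R) x0 y0 a :
  is_derive x0 (1:R) f a -> fd2 (fun x _ => f x) x0 y0 a 0.
Proof.
move=> /is_derive_eps h e e0; have [s s0 hs] := h e e0; exists s => // x y hx hy.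
rewrite mul0r addr0 (le_trans (hs _ hx))// ler_pM2l// lerDl//.
Qed.

Lemma fd2_snd (f : R -> R) x0 y0 a :
  is_derive y0 (1:R) f a -> fd2 (fun _ y => f y) x0 y0 0 a.
Proof.
move=> /is_derive_eps h e e0; have [s s0 hs] := h e e0; exists s => // x y hx hy.
rewrite mul0r add0r (le_trans (hs _ hy))// ler_pM2l// lerDr//.
Qed.

Lemma fd2_lip f x0 y0 A B : fd2 f x0 y0 A B ->
  exists2 s : R, 0 < s & forall x y, `|x - x0| < s -> `|y - y0| < s ->
  `|f x y - f x0 y0| <= (1 + `|A| + `|B|) * (`|x - x0| + `|y - y0|).
Proof.
move=> /(_ 1 ltr01)[s s0 hs]; exists s => // x y hx hy.
have := hs x y hx hy; set E := `|_| => hE.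
have : `|A * (x - x0) + B * (y - y0)| <= (`|A| + `|B|) * (`|x - x0| + `|y - y0|).
  apply: (le_trans (ler_normD _ _)); rewrite !normrM.
  by rewrite mulrDl lerD// ler_wpM2l// ?lerDl ?lerDr.
have := ler_normD (f x y - f x0 y0 - (A * (x - x0) + B * (y - y0)))
  (A * (x - x0) + B * (y - y0)).
rewrite subrK -/E; lra.
Qed.

Lemma fd2_mul f g x0 y0 A B A' B' : fd2 f x0 y0 A B -> fd2 g x0 y0 A' B' ->
  fd2 (fun x y => f x y * g x y) x0 y0
    (A * g x0 y0 + f x0 y0 * A') (B * g x0 y0 + f x0 y0 * B').
Proof.
move=> hf hg e e0.
have [s1 s10 h1] := fd2_lip hf; have [s2 s20 h2] := fd2_lip hg.
set K1 := 1 + _ + _ in h1; set K2 := 1 + _ + _ in h2.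
have K10 : 0 < K1 by rewrite /K1 -addrA ltr_wpDr// addr_ge0.
have K20 : 0 < K2 by rewrite /K2 -addrA ltr_wpDr// addr_ge0.
set F := f x0 y0 in h1 *; set G := g x0 y0 in h2 *.
have F0 : 0 < 1 + `|F| by rewrite ltr_wpDr.
have G0 : 0 < 1 + `|G| by rewrite ltr_wpDr.
have [|s3 s30 h3] := hf (e / 4 / (1 + `|G|)); first by rewrite !divr_gt0.
have [|s4 s40 h4] := hg (e / 4 / (1 + `|F|)); first by rewrite !divr_gt0.
(* At this scale the product of the two increments, at most [K1 * K2 * D ^+ 2], stays below
   [e / 2 * D]; the two linear errors take [e / 4] each. *)
pose s5 := e / 4 / (K1 * K2).
have s50 : 0 < s5 by rewrite !divr_gt0// mulr_gt0.
exists (Num.min (Num.min s1 s2) (Num.min (Num.min s3 s4) s5)).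
  by rewrite !lt_min s10 s20 s30 s40 s50.
move=> x y; rewrite !lt_min => /andP[/andP[a1 a2]/andP[/andP[a3 a4] a5]].
move=> /andP[/andP[b1 b2]/andP[/andP[b3 b4] b5]].
have {}h1 := h1 _ _ a1 b1; have {}h2 := h2 _ _ a2 b2.
have {}h3 := h3 _ _ a3 b3; have {}h4 := h4 _ _ a4 b4.
set D := `|x - x0| + `|y - y0| in h1 h2 h3 h4 *.
rewrite -/F -/G in h3 h4 *.
have D0 : 0 <= D by rewrite addr_ge0.
have D5 : D <= 2 * s5 by rewrite /D; clear -a5 b5; lra.
set E1 := f x y - F - _ in h3; set E2 := g x y - G - _ in h4.
have -> : f x y * g x y - F * G -
   ((A * G + F * A') * (x - x0) + (B * G + F * B') * (y - y0)) =
   E1 * G + F * E2 + (f x y - F) * (g x y - G) by rewrite /E1 /E2; ring.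
have p1 : `|E1 * G| <= e / 4 * D.
  rewrite normrM; apply: (@le_trans _ _ (e / 4 / (1 + `|G|) * D * (1 + `|G|))).
    by apply: ler_pM => //; rewrite lerDr.
  by rewrite mulrAC divfK// gt_eqF.
have p2 : `|F * E2| <= e / 4 * D.
  rewrite normrM mulrC; apply: (@le_trans _ _ (e / 4 / (1 + `|F|) * D * (1 + `|F|))).
    by apply: ler_pM => //; rewrite lerDr.
  by rewrite mulrAC divfK// gt_eqF.
have p3 : `|(f x y - F) * (g x y - G)| <= e / 2 * D.
  rewrite normrM; apply: (@le_trans _ _ ((K1 * D) * (K2 * D))); first exact: ler_pM.
  have -> : K1 * D * (K2 * D) = D * (K1 * K2) * D by ring.
  apply: ler_wpM2r => //; apply: (@le_trans _ _ (2 * s5 * (K1 * K2))).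
    by rewrite ler_wpM2r// ltW// mulr_gt0.
  rewrite /s5 -mulrA divfK ?gt_eqF// ?mulr_gt0//; lra.
apply: (le_trans (ler_normD _ _)); apply: (le_trans (lerD (ler_normD _ _) p3)).
clear -p1 p2 D0; lra.
Qed.

Definition prim (a : R) (g : R -> R) (x : R) : R :=
  (\int[@lebesgue_measure R]_(t in `[a, x]) g t)%R.

(** The base point lies strictly to the left of [x] and continuity extends beyond [x], so that the
    derivative is two-sided. *)
Lemma is_derive_prim (a q : R) (g : R -> R) x :
  (forall t, a <= t < q -> {for t, continuous g}) -> a < x < q ->
  is_derive x (1:R) (prim a g) (g x).
Proof.
move=> gc /andP[ax xq]; pose u := (x + q) / 2.
have xu : x < u by rewrite /u; lra.
have uq : u < q by rewrite /u; lra.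
have ig : (@lebesgue_measure R).-integrable `[a, u] (EFin \o g).
  apply: continuous_compact_integrable; first exact: segment_compact.
  apply: continuous_in_subspaceT => t; rewrite inE/= in_itv/= => /andP[h1 h2].
  by apply: gc; rewrite h1 (le_lt_trans h2).
have gx : {for x, continuous g} by apply: gc; rewrite (ltW ax).
have [d1 d2] := @continuous_FTC1 R g (BLeft a) x u xu ig ax gx.
by split; [exact: d1|rewrite -derive1E; exact: d2].
Qed.

End real_calculus.

(** * Complex differentiability and Cauchy estimates *)

Section nm.
Context {R : realType}.

(* Norms over R[i] are R[i]-valued; [nm] is the underlying real number. *)
Definition nm (V : normedZmodType R[i]) (v : V) : R := complex.Re `|v|.

Lemma nmE (V : normedZmodType R[i]) (v : V) : `|v| = (nm v)%:C.
Proof. by rewrite /nm RRe_real// normr_real. Qed.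

Lemma nm_ge0 (V : normedZmodType R[i]) (v : V) : 0 <= nm v.
Proof. by rewrite -ler0c -nmE. Qed.

Lemma nmD (V : normedZmodType R[i]) (v w : V) : nm (v + w) <= nm v + nm w.
Proof. by rewrite -lecR rmorphD/= -!nmE ler_normD. Qed.

Lemma nmN (V : normedZmodType R[i]) (v : V) : nm (- v) = nm v.
Proof. by rewrite /nm normrN. Qed.

Lemma nmB (V : normedZmodType R[i]) (v w : V) : nm (v - w) = nm (w - v).
Proof. by rewrite -nmN opprB. Qed.

Lemma nm0 (V : normedZmodType R[i]) : nm (0 : V) = 0.
Proof. by rewrite /nm normr0. Qed.

Lemma nm_eq0 (V : normedZmodType R[i]) (v : V) : (nm v == 0) = (v == 0).
Proof.
apply/idP/idP => [/eqP h|/eqP->]; last by rewrite nm0.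
by rewrite -normr_eq0 nmE h.
Qed.

Lemma nm_gt0 (V : normedZmodType R[i]) (v : V) : (0 < nm v) = (v != 0).
Proof. by rewrite lt_def nm_ge0 andbT nm_eq0. Qed.

Lemma nmM (v w : R[i]) : nm (v * w) = nm v * nm w.
Proof. by apply: complexI; rewrite rmorphM/= -!nmE normrM. Qed.

Lemma nmV (v : R[i]) : nm v^-1 = (nm v)^-1.
Proof. by apply: complexI; rewrite -nmE normfV nmE fmorphV. Qed.

Lemma nmZ (V : normedModType R[i]) (k : R[i]) (v : V) : nm (k *: v) = nm k * nm v.
Proof. by apply: complexI; rewrite rmorphM/= -!nmE normrZ. Qed.

Lemma nmC (x : R) : nm (x%:C : R[i]) = `|x|.
Proof. by rewrite /nm normc_def/= expr0n/= addr0 sqrtr_sqr. Qed.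

Lemma nm1 : nm (1 : R[i]) = 1.
Proof. by rewrite /nm normr1. Qed.

Lemma nmRI (a b : R) : nm (a +i* b : R[i]) = Num.sqrt (a ^+ 2 + b ^+ 2).
Proof. by rewrite /nm normc_def. Qed.

Lemma nm_Re (z : R[i]) : `|complex.Re z| <= nm z.
Proof. by rewrite -lecR -nmE normc_ge_Re. Qed.

Lemma nm_Im (z : R[i]) : `|complex.Im z| <= nm z.
Proof.
have := nm_Re (z * 'i%C); rewrite ReiNIm normrN nmM.
by rewrite [nm 'i%C]nmRI expr0n/= add0r expr1n sqrtr1 mulr1.
Qed.

Lemma nm_le (a b : R) : nm (a +i* b : R[i]) <= `|a| + `|b|.
Proof.
have -> : (a +i* b : R[i]) = a%:C + 'i%C * b%:C by rewrite [LHS]complexE.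
apply: (le_trans (nmD _ _)); rewrite nmM !nmC [nm 'i%C]nmRI expr0n/= add0r.
by rewrite expr1n sqrtr1 mul1r.
Qed.

Lemma nm_lt_norm (V : normedZmodType R[i]) (v : V) (e : R) : (`|v| < e%:C) = (nm v < e).
Proof. by rewrite nmE ltcR. Qed.

Lemma nm_le_norm (V : normedZmodType R[i]) (v : V) (e : R) : (`|v| <= e%:C) = (nm v <= e).
Proof. by rewrite nmE lecR. Qed.

End nm.

Section cderiv.
Context {R : realType}.
Local Notation C := R[i].
Implicit Types (phi : C -> C) (z l : C).

Definition cderiv phi z l := forall e : R, 0 < e -> exists2 s : R, 0 < s &
  forall w, nm (w - z) < s -> nm (phi w - phi z - l * (w - z)) <= e * nm (w - z).

Definition ccont phi z := forall e : R, 0 < e -> exists2 s : R, 0 < s &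
  forall w, nm (w - z) < s -> nm (phi w - phi z) <= e.

Definition fd2c (f : R -> R -> C) x0 y0 (A B : C) :=
  forall e : R, 0 < e -> exists2 s : R, 0 < s &
  forall x y, `|x - x0| < s -> `|y - y0| < s ->
  nm (f x y - f x0 y0 - (A * (x - x0)%:C + B * (y - y0)%:C)) <=
    e * (`|x - x0| + `|y - y0|).

Lemma fd2c_complex (f g : R -> R -> R) x0 y0 A B A' B' :
  fd2 f x0 y0 A B -> fd2 g x0 y0 A' B' ->
  fd2c (fun x y => f x y +i* g x y) x0 y0 (A +i* A') (B +i* B').
Proof.
move=> hf hg e e0; have e20 : 0 < e / 2 by lra.
have [s s0 hs] := hf _ e20; have [t t0 ht] := hg _ e20.
exists (Num.min s t); first by rewrite lt_min s0.
move=> x y; rewrite !lt_min => /andP[h1 h2] /andP[h3 h4].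
have -> : f x y +i* g x y - (f x0 y0 +i* g x0 y0) -
   ((A +i* A') * (x - x0)%:C + (B +i* B') * (y - y0)%:C) =
  (f x y - f x0 y0 - (A * (x - x0) + B * (y - y0))) +i*
  (g x y - g x0 y0 - (A' * (x - x0) + B' * (y - y0))).
  by simpc; congr (_ +i* _); ring.
apply: (le_trans (nm_le _ _)); have := hs _ _ h1 h3; have := ht _ _ h2 h4.
lra.
Qed.

Lemma fd2c_Re f x0 y0 A B : fd2c f x0 y0 A B ->
  fd2 (fun x y => complex.Re (f x y)) x0 y0 (complex.Re A) (complex.Re B).
Proof.
move=> h e e0; have [s s0 hs] := h _ e0; exists s => // x y hx hy.
apply: le_trans (hs _ _ hx hy); apply: le_trans (nm_Re _).
clear h hs; case: (f x y) (f x0 y0) A B => [a b] [a' b'] [c d] [c' d'].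
by simpc => /=; rewrite le_eqVlt; apply/orP; left; apply/eqP; congr `|_|; ring.
Qed.

Lemma fd2c_Im f x0 y0 A B : fd2c f x0 y0 A B ->
  fd2 (fun x y => complex.Im (f x y)) x0 y0 (complex.Im A) (complex.Im B).
Proof.
move=> h e e0; have [s s0 hs] := h _ e0; exists s => // x y hx hy.
apply: le_trans (hs _ _ hx hy); apply: le_trans (nm_Im _).
clear h hs; case: (f x y) (f x0 y0) A B => [a b] [a' b'] [c d] [c' d'].
by simpc => /=; rewrite le_eqVlt; apply/orP; left; apply/eqP; congr `|_|; ring.
Qed.

(** The complex derivative multiplies both partial derivatives by the same [l]; this is the source
    of the Cauchy-Riemann equations below. *)
Lemma fd2c_chain f phi x0 y0 A B l : fd2c f x0 y0 A B -> cderiv phi (f x0 y0) l ->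
  fd2c (fun x y => phi (f x y)) x0 y0 (l * A) (l * B).
Proof.
move=> hf hphi e e0.
pose K := 1 + nm A + nm B.
have K0 : 0 < K by rewrite /K -addrA ltr_pwDl// addr_ge0// nm_ge0.
have l0 : 0 < 1 + nm l by rewrite ltr_pwDl// nm_ge0.
have [|s1 s10 h1] := hphi (e / 2 / K); first by rewrite !divr_gt0.
have [s2 s20 h2] := hf 1 ltr01.
have [|s3 s30 h3] := hf (e / 2 / (1 + nm l)); first by rewrite !divr_gt0.
exists (Num.min (s1 / (2 * K)) (Num.min s2 s3)).
  by rewrite !lt_min s20 s30 divr_gt0// mulr_gt0.
move=> x y; rewrite !lt_min => /and3P[a1 a2 a3] /and3P[b1 b2 b3].
have {}h2 := h2 _ _ a2 b2; have {}h3 := h3 _ _ a3 b3.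
have : `|x - x0| + `|y - y0| < s1 / K.
  by rewrite [s1 / K]splitr -mulrA -invfM (mulrC K 2) ltrD.
set D := `|x - x0| + `|y - y0| in h2 h3 * => DK.
have D0 : 0 <= D by rewrite addr_ge0.
set L := A * _ + B * _ in h2 h3.
have hL : nm L <= (nm A + nm B) * D.
  apply: (le_trans (nmD _ _)); rewrite !nmM !nmC mulrDl; apply: lerD; rewrite ler_wpM2l ?nm_ge0//.
    by rewrite lerDl.
  by rewrite lerDr.
have hf1 : nm (f x y - f x0 y0) <= K * D.
  have := nmD (f x y - f x0 y0 - L) L; rewrite subrK /K; clear -hL h2; lra.
have {}h1 : nm (phi (f x y) - phi (f x0 y0) - l * (f x y - f x0 y0)) <= e / 2 * D.
  have hs1 : nm (f x y - f x0 y0) < s1.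
    by apply: (le_lt_trans hf1); rewrite mulrC -ltr_pdivlMr.
  apply: (le_trans (h1 _ hs1)); apply: (@le_trans _ _ (e / 2 / K * (K * D))).
    by rewrite ler_wpM2l// !divr_ge0// ltW.
  by rewrite mulrA divfK// gt_eqF.
have {}h3 : nm (l * (f x y - f x0 y0 - L)) <= e / 2 * D.
  rewrite nmM mulrC; apply: (@le_trans _ _ (e / 2 / (1 + nm l) * D * (1 + nm l))).
    by apply: ler_pM => //; rewrite ?nm_ge0// lerDr.
  by rewrite mulrAC divfK// gt_eqF.
have -> : phi (f x y) - phi (f x0 y0) - (l * A * (x - x0)%:C + l * B * (y - y0)%:C) =
  (phi (f x y) - phi (f x0 y0) - l * (f x y - f x0 y0)) + l * (f x y - f x0 y0 - L).
  by rewrite /L; ring.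
apply: (le_trans (nmD _ _)); clear -h1 h3; lra.
Qed.

End cderiv.

(** * Comparison of values on concentric circles *)

Section mean_value.
Context {R : realType}.
Local Notation C := R[i].
Implicit Types (phi : C -> C) (z l : C) (a b r s t x y e rho B : R).

Lemma fd2_continuous_fst (f : R -> R -> R) x0 y0 A B :
  fd2 f x0 y0 A B -> {for x0, continuous (f^~ y0)}.
Proof.
move=> /fd2_lip[s s0]; set K := 1 + _ + _ => hs.
have K0 : 0 < K by rewrite /K -addrA ltr_wpDr// addr_ge0.
apply/cvgrPdist_lt => e e0.
apply/nbhs_ballP; exists (Num.min s (e / K)); first by rewrite /= lt_min s0 divr_gt0.
move=> x; rewrite /ball/= distrC lt_min => /andP[h1 h2]; rewrite distrC.
apply: (le_lt_trans (hs _ _ h1 _)); first by rewrite subrr normr0.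
by rewrite subrr normr0 addr0 mulrC -ltr_pdivlMr.
Qed.

Lemma fd2_continuous_snd (f : R -> R -> R) x0 y0 A B :
  fd2 f x0 y0 A B -> {for y0, continuous (f x0)}.
Proof.
move=> /fd2_lip[s s0]; set K := 1 + _ + _ => hs.
have K0 : 0 < K by rewrite /K -addrA ltr_wpDr// addr_ge0.
apply/cvgrPdist_lt => e e0.
apply/nbhs_ballP; exists (Num.min s (e / K)); first by rewrite /= lt_min s0 divr_gt0.
move=> x; rewrite /ball/= distrC lt_min => /andP[h1 h2]; rewrite distrC.
apply: (le_lt_trans (hs _ _ _ h1)); first by rewrite subrr normr0.
by rewrite subrr normr0 add0r mulrC -ltr_pdivlMr.
Qed.

Definition polar (r t : R) : C := (r * cos t) +i* (r * sin t).

Lemma nm_polar r t : 0 <= r -> nm (polar r t) = r.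
Proof.
move=> r0; rewrite nmRI !exprMn -mulrDr cos2Dsin2 mulr1 sqrtr_sqr ger0_norm//.
Qed.

Lemma fd2c_polar r t : fd2c polar r t (polar 1 t) ('i%C * (r%:C * polar 1 t)).
Proof.
have E1 : fd2 (fun x y => x * cos y) r t (1 * cos t + r * 0) (0 * cos t + r * - sin t).
  exact: (fd2_mul (fd2_fst _ (is_derive_id _ _)) (fd2_snd _ (is_derive_cos t))).
have E2 : fd2 (fun x y => x * sin y) r t (1 * sin t + r * 0) (0 * sin t + r * cos t).
  exact: (fd2_mul (fd2_fst _ (is_derive_id _ _)) (fd2_snd _ (is_derive_sin t))).
have := fd2c_complex E1 E2; congr fd2c; rewrite /polar; simpc => //.
Qed.

Section annulus.
Variables (phi : C -> C) (rho : R).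
Hypothesis phi_diff : forall z, 0 < nm z < rho -> exists l, cderiv phi z l.

Let U (r t : R) : R := complex.Re (phi (polar r t)) * r^-1.
Let V (r t : R) : R := complex.Im (phi (polar r t)).

(* In polar coordinates the Cauchy-Riemann equations say that the form
   (u / r) dr - v dt is closed. *)
Let UV_diff (r t : R) : 0 < r < rho -> exists A B D,
  fd2 U r t A B /\ fd2 V r t (- B) D.
Proof.
move=> /andP[r0 rr]; have [|l hl] := phi_diff (z := polar r t).
  by rewrite nm_polar ?ltW// r0.
have hg := fd2c_chain (fd2c_polar r t) hl.
have dV : is_derive r (1:R) (fun x : R => x^-1) (- (r ^- 2)).
  apply: is_derive_eq (is_deriveV (f := id) (lt0r_neq0 r0) (is_derive_id _ _)) _.
  by rewrite /GRing.scale/= mulr1.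
do 3 eexists; split; first exact: (fd2_mul (fd2c_Re hg) (fd2_fst _ dV)).
have := fd2c_Im hg; congr fd2.
rewrite mulr0 addr0; case: l {hl hg} => a b; rewrite /polar; simpc => /=.
by field; rewrite gt_eqF.
Qed.

(** Green's formula on the rectangle of radii in [a, b] and angles in [0, 2 pi] equates the angular
    integrals of [Im phi] over the two circles; the mean value theorem turns each into a value times
    2 pi. *)
Lemma circle_values_meet a b : 0 < a < b -> b < rho -> exists s t,
  complex.Im (phi (polar a s)) = complex.Im (phi (polar b t)).
Proof.
move=> /andP[a0 ab] br.
have [T TE] : exists T : R, T = pi *+ 2 by eexists.
have T0 : 0 < T by rewrite TE mulrn_wgt0 ?pi_gt0.
(* The base points [a / 2] and [-1] lie outside the rectangle, so that the primitives have two-sided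
   derivatives on its edges. *)
pose W r t := prim (a / 2) (U^~ t) r.
pose Z r t := prim (-1) (V r) t.
have hW r t : a <= r <= b -> is_derive r (1:R) (W^~ t) (U r t).
  move=> hr; apply: (@is_derive_prim _ (a / 2) rho (U^~ t)); last by lra.
  move=> s hs; have [|A [B [D [h _]]]] := UV_diff (r := s) t; first by lra.
  exact: fd2_continuous_fst h.
have hZ r t : a <= r <= b -> 0 <= t <= T -> is_derive t (1:R) (Z r) (V r t).
  move=> hr ht; apply: (@is_derive_prim _ (-1) (T + 1) (V r)); last by lra.
  move=> s hs; have [|A [B [D [_ h]]]] := UV_diff (r := r) s; first by lra.
  exact: fd2_continuous_snd h.
(* By periodicity the radial primitives agree at the angles 0 and 2 pi, so only [Z] survives in
   Green's formula. *)
have WE r : W r T = W r 0.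
  rewrite /W; congr prim; apply: funext => x; rewrite /U /polar.
  by rewrite -(add0r T) TE cosD2pi sinD2pi.
clearbody W Z.
have G : (W b T + Z b T) - (W b 0 + Z b 0) - (W a T + Z a T) + (W a 0 + Z a 0) = 0.
  apply: (@green_goursat R U V W Z a b 0 T ab T0).
  - by move=> x y hx hy; exact: hW.
  move=> x0 y0 hx hy; have [|A [B [D [h1 h2]]]] := UV_diff (r := x0) y0; first by lra.
  exists A, B, D => e e0; have [s s0 hs] := h1 e e0; have [s' s'0 hs'] := h2 e e0.
  exists (Num.min s s'); first by rewrite lt_min s0.
  move=> x y _ _; rewrite !lt_min => /andP[u1 u2] /andP[u3 u4]; split; first exact: hs.
  by have := hs' _ _ u2 u4; rewrite mulNr [- _ + _]addrC.
have mvt r : a <= r <= b -> exists t, Z r T - Z r 0 = V r t * T.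
  move=> hr; have [] := @MVT R (Z r) (V r) _ _ T0.
  - move=> x; rewrite in_itv/= => /andP[h1 h2].
    by apply: hZ; rewrite ?hr// !ltW.
  - apply: derivable_within_continuous => x; rewrite in_itv/= => hx.
    by have [] := hZ r x hr hx.
  by move=> t _; rewrite subr0; exists t.
have [|s hs] := mvt a; first by lra.
have [|t ht] := mvt b; first by lra.
exists s, t; apply: (mulIf (lt0r_neq0 T0)); rewrite -/(V a s) -/(V b t) -hs -ht.
rewrite !WE in G; lra.
Qed.
End annulus.

(** The inner circle shrinks to the centre while the outer one stays fixed. Only continuity is asked
    at 0, so that difference quotients qualify. *)
Lemma Im_center_bound phi rho r B :
  (forall z, 0 < nm z < rho -> exists l, cderiv phi z l) -> ccont phi 0 ->
  0 < r < rho -> (forall z, nm z = r -> `|complex.Im (phi z)| <= B) ->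
  `|complex.Im (phi 0)| <= B.
Proof.
move=> hphi h0 /andP[r0 rr] hB; apply/ler_addgt0Pr => e e0.
have [s s0 hs] := h0 e e0.
pose a := Num.min (s / 2) (r / 2).
have a0 : 0 < a by rewrite lt_min !divr_gt0.
have as_ : a < s by rewrite gt_min; apply/orP; left; lra.
have ar : a < r by rewrite gt_min; apply/orP; right; lra.
have [|x [y xy]] := circle_values_meet hphi (a := a) (b := r) _ rr; first by rewrite a0.
have := hB (polar r y) (nm_polar _ (ltW r0)); rewrite -xy.
have := hs (polar a x); rewrite subr0 (nm_polar _ (ltW a0)) => /(_ as_).
move=> /(le_trans (nm_Im _)).
have -> : complex.Im (phi (polar a x) - phi 0) =
  complex.Im (phi (polar a x)) - complex.Im (phi 0) by case: (phi _) (phi _) => [? ?] [? ?].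
set p := complex.Im (phi 0); set q := complex.Im _; rewrite !ler_norml; lra.
Qed.

Lemma cderivZ phi z l c : cderiv phi z l -> cderiv (fun w => c * phi w) z (c * l).
Proof.
move=> h e e0; have c0 : 0 < 1 + nm c by rewrite ltr_pwDl// nm_ge0.
have [|s s0 hs] := h (e / (1 + nm c)); first by rewrite divr_gt0.
exists s => // w hw; have -> : c * phi w - c * phi z - c * l * (w - z) =
  c * (phi w - phi z - l * (w - z)) by ring.
rewrite nmM; apply: (@le_trans _ _ ((1 + nm c) * (e / (1 + nm c) * nm (w - z)))).
  by apply: ler_pM; rewrite ?nm_ge0 ?lerDr ?hs.
by rewrite mulrA mulrCA divff ?gt_eqF// mulr1.
Qed.

Lemma ccontZ phi z c : ccont phi z -> ccont (fun w => c * phi w) z.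
Proof.
move=> h e e0; have c0 : 0 < 1 + nm c by rewrite ltr_pwDl// nm_ge0.
have [|s s0 hs] := h (e / (1 + nm c)); first by rewrite divr_gt0.
exists s => // w hw; rewrite -mulrBr nmM.
apply: (@le_trans _ _ ((1 + nm c) * (e / (1 + nm c)))).
  by apply: ler_pM; rewrite ?nm_ge0 ?lerDr ?hs.
by rewrite mulrCA divff ?gt_eqF// mulr1.
Qed.

Lemma center_bound phi rho r B :
  (forall z, 0 < nm z < rho -> exists l, cderiv phi z l) -> ccont phi 0 ->
  0 < r < rho -> (forall z, nm z = r -> nm (phi z) <= B) -> nm (phi 0) <= B.
Proof.
move=> hphi h0 hr hB.
have [E|n0] := eqVneq (phi 0) 0.
  rewrite E nm0; have /andP[/ltW r0 _] := hr.
  by apply: le_trans (hB _ (nm_polar 0 r0)); exact: nm_ge0.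
(* A unimodular [c] for which [c * phi 0] is [i] times the modulus of [phi 0]: the bound on
   imaginary parts then sees the whole modulus. *)
pose c : C := 'i%C * ((phi 0)^* / (nm (phi 0))%:C)%C.
have np : 0 < nm (phi 0) by rewrite nm_gt0.
have nc : nm c = 1.
  rewrite !nmM nmV nmC (ger0_norm (ltW np)) [nm 'i%C]nmRI expr0n/= add0r expr1n sqrtr1 mul1r.
  by rewrite {1}/nm normcJ -/(nm _) divff// gt_eqF.
have /= := @Im_center_bound (fun w => c * phi w) rho r B _ (ccontZ c h0) hr.
have -> : c * phi 0 = 'i%C * (nm (phi 0))%:C.
  rewrite /c -mulrA; congr (_ * _); rewrite mulrAC [_^* * _]mulrC -sqr_normc nmE.
  by rewrite expr2 mulfK// -nmE normr_eq0.
rewrite mulrC ImiRe /= ger0_norm ?nm_ge0//; apply.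
- by move=> z /hphi[l hl]; exists (c * l); exact: cderivZ.
- move=> z /hB h; apply: (le_trans (nm_Im _)); by rewrite nmM nc mul1r.
Qed.

End mean_value.

(** Real induction: the first local hypothesis bounds the upper right derivative and pushes the
    supremum of the good times further; the second forbids an upward jump at the end of an interval,
    so that this supremum is itself a good time. *)
Lemma dini_le (R : realType) (g : R -> R) (a b K : R) : a <= b -> 0 <= K ->
  (forall t, a <= t < b -> forall e : R, 0 < e -> exists2 s : R, 0 < s &
    forall u, t < u < t + s -> u <= b -> g u <= g t + (K + e) * (u - t)) ->
  (forall t, a < t <= b -> forall e : R, 0 < e -> exists2 s : R, 0 < s &
    forall u, t - s < u < t -> a <= u -> g t <= g u + e) ->
  g b <= g a + K * (b - a).
Proof.
move=> ab K0 hr hl.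
suff key e : 0 < e -> g b <= g a + (K + e) * (b - a).
  apply/ler_addgt0Pr => e e0.
  have d0 : 0 < 1 + (b - a) by lra.
  have := key (e / (1 + (b - a))); rewrite divr_gt0// => /(_ isT)/le_trans; apply.
  rewrite mulrDl addrA lerD2l mulrAC ler_pdivrMr// ler_wpM2l ?ltW//; lra.
move=> e0; pose S := [set t | a <= t <= b /\ g t <= g a + (K + e) * (t - a)].
have aS : S a by split; [rewrite lexx|rewrite subrr mulr0 addr0].
have Sub : ubound S b by move=> t [/andP[_ ?] _].
have hS : has_sup S by split; [exists a|exists b].
set c := sup S.
have ac : a <= c by apply: ub_le_sup => //; exists b.
have cb : c <= b by apply: ge_sup => //; exists a.
have cS : S c.
  split; first by rewrite ac.
  have [<-|ca] := eqVneq a c; first by rewrite subrr mulr0 addr0.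
  apply/ler_addgt0Pr => d d0.
  have [|s s0 hs] := hl c _ d d0; first by rewrite lt_neqAle ca ac.
  have [u uS cu] := sup_adherent s0 hS.
  have uc : u <= c by apply: ub_le_sup => //; exists b.
  case: uS => /andP[au ub] gu.
  have : g c <= g u + d.
    have [->|nuc] := eqVneq u c; first by rewrite lerDl ltW.
    by apply: hs => //; rewrite cu lt_neqAle nuc.
  have : (K + e) * (u - a) <= (K + e) * (c - a) by rewrite ler_wpM2l//; lra.
  lra.
have [cb'|nbc] := eqVneq c b; first by move: cS => []; rewrite cb'.
have {}cb : c < b by rewrite lt_neqAle nbc.
have [|s s0 hs] := hr c _ e e0; first by rewrite ac.
pose u := Num.min b (c + s / 2).
have cu : c < u by rewrite lt_min cb; lra.
have ub : u <= b by rewrite ge_min lexx.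
have us : u < c + s by rewrite gt_min; apply/orP; right; lra.
have := hs u _ ub; rewrite cu us => /(_ isT) gu.
have uS : S u.
  split; first by rewrite ub (le_trans ac (ltW cu)).
  by case: cS => _; lra.
have : u <= c by apply: ub_le_sup => //; exists b.
by rewrite leNgt cu.
Qed.

Section cauchy_estimates.
Context {R : realType}.
Local Notation C := R[i].
Implicit Types (phi psi : C -> C) (z w l : C) (a b r s t x y e rho B K : R).

Lemma cderiv_near phi psi z l s : 0 < s -> 
  (forall w, nm (w - z) < s -> phi w = psi w) -> cderiv phi z l -> cderiv psi z l.
Proof.
move=> s0 E h e e0; have [t t0 ht] := h e e0.
exists (Num.min s t); first by rewrite lt_min s0.
move=> w; rewrite lt_min => /andP[h1 h2]; rewrite -!E ?ht//.
by rewrite subrr nm0.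
Qed.

Lemma cderiv_shift phi z w l : cderiv phi (z + w) l -> cderiv (fun u => phi (u + w)) z l.
Proof.
move=> h e e0; have [t t0 ht] := h e e0; exists t => // u hu.
have E : u - z = (u + w) - (z + w) by ring.
by rewrite E; apply: ht; rewrite -E.
Qed.

Lemma cderiv_cst (k : C) z : cderiv (fun=> k) z 0.
Proof.
by move=> e e0; exists 1 => // w _; rewrite subrr mul0r subrr nm0 mulr_ge0 ?nm_ge0 ?ltW.
Qed.

Lemma cderiv_id z : cderiv id z 1.
Proof.
by move=> e e0; exists 1 => // w _; rewrite mul1r subrr nm0 mulr_ge0 ?nm_ge0 ?ltW.
Qed.

Lemma cderivD phi psi z l l' : cderiv phi z l -> cderiv psi z l' ->
  cderiv (fun w => phi w + psi w) z (l + l').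
Proof.
move=> h h' e e0; have e20 : 0 < e / 2 by lra.
have [s s0 hs] := h _ e20; have [t t0 ht] := h' _ e20.
exists (Num.min s t); first by rewrite lt_min s0.
move=> w; rewrite lt_min => /andP[h1 h2].
have -> : phi w + psi w - (phi z + psi z) - (l + l') * (w - z) =
  (phi w - phi z - l * (w - z)) + (psi w - psi z - l' * (w - z)) by ring.
by rewrite (splitr e) mulrDl (le_trans (nmD _ _))// lerD// ?hs ?ht.
Qed.

Lemma cderivB phi psi z l l' : cderiv phi z l -> cderiv psi z l' ->
  cderiv (fun w => phi w - psi w) z (l - l').
Proof.
move=> h /(cderivZ (-1)) h'; rewrite -(mulN1r l').
have := cderivD h h'; apply: (@cderiv_near _ _ _ _ 1) => // w _.
by rewrite mulN1r.
Qed.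

Lemma cderiv_divX phi z l : cderiv phi z l -> z != 0 ->
  cderiv (fun w => phi w / w) z ((l - phi z / z) / z).
Proof.
move=> h z0 e e0; have nz0 : 0 < nm z by rewrite nm_gt0.
set m := l - phi z / z.
have m0 : 0 < 1 + nm m by rewrite ltr_pwDl// nm_ge0.
have [|s s0 hs] := h (e * nm z / 4); first by rewrite divr_gt0// mulr_gt0.
exists (Num.min s (Num.min (nm z / 2) (e * nm z ^+ 2 / 4 / (1 + nm m)))).
  by rewrite !lt_min s0 divr_gt0//= !divr_gt0// mulr_gt0// exprn_gt0.
move=> w; rewrite !lt_min => /and3P[h1 h2 h3].
have nw : nm z / 2 <= nm w.
  have := nmD (z - w) w; rewrite subrK nmB; lra.
have nw0 : 0 < nm w by lra.
have w0 : w != 0 by rewrite -nm_gt0.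
set d := w - z in h1 h2 h3 *.
have wE : w = z + d by rewrite /d subrKC.
have -> : phi w / w - phi z / z - m / z * d =
   (phi w - phi z - l * d) / w - m * d * d / (w * z).
  by rewrite /m wE; field; rewrite z0 -wE w0.
have {}hs := hs _ h1; rewrite -/d in hs.
have p1 : nm ((phi w - phi z - l * d) / w) <= e / 2 * nm d.
  rewrite nmM nmV ler_pdivrMr//; apply: (le_trans hs).
  have -> : e * nm z / 4 * nm d = e / 2 * nm d * (nm z / 2) by field.
  by rewrite ler_wpM2l// mulr_ge0 ?nm_ge0//; lra.
have p2 : nm (m * d * d / (w * z)) <= e / 2 * nm d.
  rewrite nmM nmV !nmM ler_pdivrMr ?mulr_gt0//.
  have -> : nm m * nm d * nm d = nm d * (nm d * nm m) by ring.
  rewrite [e / 2 * _]mulrC -mulrA; apply: ler_wpM2l; first exact: nm_ge0.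
  move: h3; rewrite ltr_pdivlMr// => h3.
  apply: (@le_trans _ _ (e * nm z ^+ 2 / 4)).
    by have := nm_ge0 d; have := nm_ge0 m; lra.
  have -> : e * nm z ^+ 2 / 4 = e / 2 * (nm z / 2 * nm z) by field.
  by apply: ler_wpM2l; [lra|rewrite ler_wpM2r// ltW].
have := nmD ((phi w - phi z - l * d) / w) (- (m * d * d / (w * z))).
rewrite nmN; lra.
Qed.

(** The value at the centre of the difference quotient, completed by [l] at 0, is bounded by its
    values on the circle of radius [r / 2], which are at most [2 * B / (r / 2)]. *)
Lemma cauchy_estimate phi z l r B : 0 < r ->
  (forall w, nm (w - z) < r -> exists l', cderiv phi w l') ->
  (forall w, nm (w - z) < r -> nm (phi w) <= B) -> cderiv phi z l ->
  nm l <= 4 * B / r.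
Proof.
move=> r0 hd hB hl.
pose psi w := if w == 0 then l else (phi (w + z) - phi z) / w.
have -> : l = psi 0 by rewrite /psi eqxx.
apply: (@center_bound _ psi r (r / 2)).
- move=> w /andP[w0 wr]; have [|l' hl'] := hd (w + z); first by rewrite addrK.
  have wn0 : w != 0 by rewrite -nm_gt0.
  have := cderiv_divX (cderivB (cderiv_shift hl') (cderiv_cst (phi z) w)) wn0.
  move=> h; eexists; apply: (cderiv_near w0 _ h) => u hu.
  rewrite /psi; case: eqP => // u0; move: hu.
  by rewrite u0 sub0r nmN ltxx.
- move=> e e0; have [s s0 hs] := hl e e0; exists s => // w; rewrite subr0 => hw.
  rewrite /psi eqxx; case: eqP => [_|/eqP w0]; first by rewrite subrr nm0 ltW.
  have := hs (w + z); rewrite addrK => /(_ hw).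
  have -> : phi (w + z) - phi z - l * w = ((phi (w + z) - phi z) / w - l) * w.
    by rewrite mulrBl divfK.
  by rewrite nmM ler_pM2r// nm_gt0.
- lra.
- move=> w wr; rewrite /psi; case: eqP => [w0|_].
    by move: wr; rewrite w0 nm0; lra.
  rewrite nmM nmV wr invf_div -mulrA.
  have -> : 4 * (B / r) = (B + B) * (2 / r) by field; rewrite gt_eqF.
  apply: ler_wpM2r; first by rewrite divr_ge0// ltW.
  apply: (le_trans (nmD _ _)); rewrite nmN; apply: lerD; apply: hB.
    by rewrite addrK wr; lra.
  by rewrite subrr nm0.
Qed.

(** Along the segment, the distance to [phi z] has upper right derivative at most [K * nm (w - z)];
    [dini_le] takes the place of integrating the derivative. *)
Lemma cderiv_lip phi z w K : 0 <= K ->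
  (forall t, 0 <= t <= 1 -> exists2 l, cderiv phi (z + t%:C * (w - z)) l & nm l <= K) ->
  nm (phi w - phi z) <= K * nm (w - z).
Proof.
move=> K0 h; have [->|wz] := eqVneq w z; first by rewrite !subrr !nm0 mulr0.
have d0 : 0 < nm (w - z) by rewrite nm_gt0 subr_eq0.
pose p t := z + t%:C * (w - z).
have pB t u : p t - p u = (t - u)%:C * (w - z).
  by rewrite /p rmorphB/=; ring.
have pn t u : nm (p t - p u) = `|t - u| * nm (w - z) by rewrite pB nmM nmC.
pose g t := nm (phi (p t) - phi z).
have near t e : 0 <= t <= 1 -> 0 < e -> exists2 s : R, 0 < s &
    forall u, `|u - t| < s -> nm (phi (p u) - phi (p t)) <= (K * nm (w - z) + e) * `|u - t|.
  move=> ht e0; have [l hl lK] := h t ht.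
  have [|s s0 hs] := hl (e / nm (w - z)); first by rewrite divr_gt0.
  exists (s / nm (w - z)); first by rewrite divr_gt0.
  move=> u; rewrite ltr_pdivlMr// -pn => /hs; rewrite -/(p t) pn mulrCA divfK ?gt_eqF//.
  have := nmD (phi (p u) - phi (p t) - l * (p u - p t)) (l * (p u - p t)).
  rewrite subrK nmM pn => h1 h2; apply: (le_trans h1).
  have : nm l * (`|u - t| * nm (w - z)) <= K * (`|u - t| * nm (w - z)).
    by rewrite ler_wpM2r// mulr_ge0// ltW.
  lra.
have tri t u : g u <= g t + nm (phi (p u) - phi (p t)).
  by rewrite /g -[in leLHS](subrK (phi (p t)) (phi (p u))) -addrA addrC nmD.
have g0 : g 0 = 0 by rewrite /g /p mul0r addr0 subrr nm0.
have g1 : g 1 = nm (phi w - phi z) by rewrite /g /p rmorph1 mul1r subrKC.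
have Kd : 0 <= K * nm (w - z) by rewrite mulr_ge0 ?nm_ge0.
rewrite -g1; have := @dini_le R g 0 1 (K * nm (w - z)) ler01 Kd.
rewrite g0 add0r subr0 mulr1; apply.
- move=> t /andP[t0 t1] e e0; have [|s s0 hs] := near t e _ e0; first by rewrite t0 ltW.
  exists s => // u /andP[tu us] _.
  have ut : `|u - t| = u - t by rewrite gtr0_norm ?subr_gt0.
  by have := hs u; rewrite ut => /(_ _)/(le_trans (tri t u) \o (lerD (lexx _)))-> //; lra.
- move=> t /andP[t0 t1] e e0; have [|s s0 hs] := near t 1 _ ltr01; first by rewrite ltW.
  have M0 : 0 < K * nm (w - z) + 1 by lra.
  exists (Num.min s (e / (K * nm (w - z) + 1))); first by rewrite lt_min s0 divr_gt0.
  move=> u /andP[us ut] u0; have ut' : `|u - t| = t - u by rewrite ltr0_norm ?opprB ?subr_lt0.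
  have : t - u < Num.min s (e / (K * nm (w - z) + 1)) by lra.
  rewrite lt_min -ut' => /andP[/hs h1]; rewrite ltr_pdivlMr// => h2.
  by have := tri u t; rewrite nmB; lra.
Qed.

Lemma taylor1 phi l r B v : 0 < r ->
  (forall z, nm z < r -> exists l', cderiv phi z l') ->
  (forall z, nm z < r -> nm (phi z) <= B) -> cderiv phi 0 l -> nm v < r / 4 ->
  nm (phi v - phi 0 - l * v) <= 128 * B / r ^+ 2 * nm v ^+ 2.
Proof.
move=> r0 hd hB hl hv.
have B0 : 0 <= B by apply: (le_trans (nm_ge0 (phi 0))); rewrite hB// nm0.
have hd1 z m : nm z < r / 2 -> cderiv phi z m -> nm m <= 8 * B / r.
  move=> hz hm; have -> : 8 * B / r = 4 * B / (r / 2) by field; rewrite gt_eqF.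
  apply: (cauchy_estimate _ _ _ hm); first by rewrite divr_gt0.
    by move=> w hw; apply: hd; have := nmD (w - z) z; rewrite subrK; lra.
  by move=> w hw; apply: hB; have := nmD (w - z) z; rewrite subrK; lra.
have lip z w : nm z < r / 2 -> nm w < r / 2 ->
    nm (phi w - phi z) <= 8 * B / r * nm (w - z).
  move=> hz hw; apply: cderiv_lip => [|t /andP[t0 t1]].
    by rewrite divr_ge0 ?mulr_ge0// ltW.
  have ht : nm (z + t%:C * (w - z)) < r / 2.
    have -> : z + t%:C * (w - z) = (1 - t)%:C * z + t%:C * w.
      by rewrite rmorphB rmorph1; ring.
    have t1' : 0 <= 1 - t by lra.
    have := nmD ((1 - t)%:C * z) (t%:C * w); rewrite !nmM !nmC !ger0_norm//.
    have [zw|/ltW wz] := lerP (nm z) (nm w).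
      by have := ler_wpM2l t1' zw; lra.
    by have := ler_wpM2l t0 wz; lra.
  have [|m hm] := hd (z + t%:C * (w - z)); first by lra.
  by exists m => //; exact: hd1 hm.
(* For fixed [w], the function sending [u] to [(phi (u + w) - phi u) / w] is bounded by [8 * B / r]
   on the disc of radius [r / 4], and its derivative at 0 is [(m - l) / w]. Cauchy's estimate then
   gives the constant 4 * 8 * 4 = 128. *)
have key w m : nm w < r / 4 -> w != 0 -> cderiv phi w m ->
    nm (m - l) <= 128 * B / r ^+ 2 * nm w.
  move=> hw w0 hm; have nw0 : 0 < nm w by rewrite nm_gt0.
  have hm' : cderiv phi (0 + w) m by rewrite add0r.
  have hpsi := cderivZ w^-1 (cderivB (cderiv_shift hm') hl).
  suff : nm (w^-1 * (m - l)) <= 4 * (8 * B / r) / (r / 4).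
    rewrite nmM nmV ler_pdivrMl// => /le_trans; apply.
    by rewrite le_eqVlt; apply/orP; left; apply/eqP; field; rewrite gt_eqF.
  apply: (cauchy_estimate _ _ _ hpsi); first by rewrite divr_gt0.
    move=> u; rewrite subr0 => hu.
    have hu' : nm (u + w) < r by have := nmD u w; lra.
    have [a ha] := hd _ hu'; have [|b hb] := hd u; first by lra.
    exists (w^-1 * (a - b)); exact: cderivZ (cderivB (cderiv_shift ha) hb).
  move=> u; rewrite subr0 => hu; rewrite nmM nmV ler_pdivrMl// mulrC.
  have {2}-> : w = u + w - u by rewrite addrC addKr.
  by apply: lip; [lra|have := nmD u w; lra].
have K0 : 0 <= 128 * B / r ^+ 2 * nm v.
  by rewrite mulr_ge0 ?nm_ge0// divr_ge0 ?exprn_ge0 ?mulr_ge0// ltW.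
have := @cderiv_lip (fun w => phi w - l * w) 0 v _ K0.
rewrite mulr0 !subr0 expr2 mulrA.
have -> : phi v - l * v - phi 0 = phi v - phi 0 - l * v by ring.
apply => t /andP[t0 t1]; rewrite add0r; set u := _ * v.
have uv : nm u <= nm v.
  by rewrite nmM nmC ger0_norm// ler_piMl// nm_ge0.
have [u0|u0] := eqVneq u 0.
  exists (l - l * 1); last by rewrite mulr1 subrr nm0.
  by rewrite u0; apply: cderivB hl (cderivZ l (cderiv_id 0)).
have [|m hm] := hd u; first by lra.
exists (m - l * 1); first exact: cderivB hm (cderivZ l (cderiv_id _)).
rewrite mulr1; apply: (le_trans (key _ _ _ u0 hm)); first by lra.
by apply: ler_wpM2l => //; rewrite divr_ge0 ?exprn_ge0 ?mulr_ge0// ltW.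
Qed.
End cauchy_estimates.

(** * Limits of holomorphic maps *)

Section weierstrass.
Context {R : realType}.
Local Notation C := R[i].
Local Notation "''C^' n" := 'rV[R[i]^o]_n (at level 8, n at level 2).
Implicit Types (e s r t : R).

Lemma nm_coord n (v : 'C^n) j : nm (v 0 j) <= nm v.
Proof.
rewrite -lecR -!nmE [X in _ <= X]/Num.Def.normr/= mx_normE.
by rewrite -[leLHS]nngE num_le; exact: (le_bigmax _ _ (0, j)).
Qed.

Lemma nm_row_le n (v : 'C^n) e : 0 <= e -> (forall j, nm (v 0 j) <= e) -> nm v <= e.
Proof.
move=> e0 h; have [v0|v0] := eqVneq (mx_norm v) 0.
  by rewrite /nm [`|v|]/Num.Def.normr/= v0.
have [[i j] /= E] := mx_norm_neq0 v0.
by rewrite /nm [`|v|]/Num.Def.normr/= E (ord1 i); exact: h.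
Qed.

Lemma differentiable_eps (V W : normedModType C) (f : V -> W) x :
  differentiable f x -> forall e, 0 < e -> exists2 s : R, 0 < s &
    forall v, nm v < s -> nm (f (x + v) - f x - 'd f x v) <= e * nm v.
Proof.
move=> /diff_locally df e e0.
have e0' : 0 < e%:C by rewrite ltcR.
have /eqaddoP /(_ _ e0') /nbhs_ballP [s /= s0 hs] := df.
have sE : s = (complex.Re s)%:C by rewrite RRe_real// gtr0_real.
exists (complex.Re s); first by rewrite -ltcR -sE.
move=> v vs; have := hs v; rewrite -ball_normE/= sub0r normrN sE nm_lt_norm => /(_ vs).
by rewrite !fctE /= !nmE -rmorphM lecR opprD addrA [v + x]addrC.
Qed.

Lemma eps_differentiable (V W : normedModType C) (f : V -> W) (L : {linear V -> W}) x :
  continuous L ->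
  (forall e, 0 < e -> exists2 s : R, 0 < s &
    forall v, nm v < s -> nm (f (x + v) - f x - L v) <= e * nm v) ->
  differentiable f x.
Proof.
move=> cL h.
have E : f \o shift x = cst (f x) + L +o_ 0 id.
  apply/eqaddoP => e e0; have eE : e = (complex.Re e)%:C by rewrite RRe_real// gtr0_real.
  have [|s s0 hs] := h (complex.Re e); first by rewrite -ltcR -eE.
  apply/nbhs_ballP; exists s%:C; first by rewrite /= ltcR.
  move=> v; rewrite -ball_normE/= sub0r normrN nm_lt_norm => vs.
  by rewrite !fctE /= eE !nmE -rmorphM lecR opprD addrA [v + x]addrC hs.
apply/diff_locallyP; rewrite (diff_unique cL E); split => //.
Qed.

Lemma cauchy_complex (u : nat -> C) :
  (forall e, 0 < e -> exists N, forall m n, (N <= m)%N -> (N <= n)%N -> nm (u m - u n) <= e) ->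
  exists l : C, forall e, 0 < e -> \forall m \near \oo, nm (u m - l) <= e.
Proof.
move=> h.
have real_lim (w : nat -> R) : (forall m n, `|w m - w n| <= nm (u m - u n)) ->
    exists l : R, w m @[m --> \oo] --> l.
  move=> hw; suff : cvg (w @ \oo) by move=> /cvg_ex[l hl]; exists l.
  apply: R_complete; apply: cauchy_exP => e e0.
  have e20 : 0 < e / 2 by lra.
  have [N hN] := h _ e20; exists (w N); exists N => // m /= Nm.
  rewrite -ball_normE/=; apply: (le_lt_trans (hw _ _)).
  by apply: (le_lt_trans (hN _ _ _ Nm)) => //; lra.
have [|a ha] := real_lim (fun m => complex.Re (u m)).
  by move=> m n; apply: le_trans (nm_Re _); case: (u m) (u n) => [? ?] [? ?].
have [|b hb] := real_lim (fun m => complex.Im (u m)).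
  by move=> m n; apply: le_trans (nm_Im _); case: (u m) (u n) => [? ?] [? ?].
exists (a +i* b) => e e0; have e20 : 0 < e / 2 by lra.
move/cvgrPdist_le : ha => /(_ _ e20) ha; move/cvgrPdist_le : hb => /(_ _ e20) hb.
apply: filterS2 ha hb => m; case: (u m) => [c d] /= h1 h2.
apply: (le_trans (nm_le _ _)); rewrite distrC [`|d - b|]distrC (splitr e).
exact: lerD.
Qed.

Lemma cauchy_row n (u : nat -> 'C^n) :
  (forall e, 0 < e -> exists N, forall m k, (N <= m)%N -> (N <= k)%N -> nm (u m - u k) <= e) ->
  exists l : 'C^n, forall e, 0 < e -> \forall m \near \oo, nm (u m - l) <= e.
Proof.
move=> h.
have H j : {l : C | forall e, 0 < e -> \forall m \near \oo, nm ((u m 0 j : C) - l) <= e}.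
  apply: cid; apply: cauchy_complex => e e0; have [N hN] := h e e0.
  exists N => m k Nm Nk; apply: le_trans (hN _ _ Nm Nk).
  by have := nm_coord (u m - u k) j; rewrite !mxE.
exists (\row_j (sval (H j) : R[i]^o)) => e e0.
have : \forall m \near \oo, forall j, nm ((u m 0 j : C) - sval (H j)) <= e.
  by apply: filter_forall => j; case: (H j) => l hl /=; exact: hl.
apply: filterS => m hm; apply: nm_row_le; first exact: ltW.
by move=> j; have := hm j; rewrite !mxE.
Qed.

Lemma slice_cderiv p q (g : 'C^p -> 'C^q) x v (j : 'I_q) (z : C) :
  differentiable g (x + z *: v) ->
  cderiv (fun w => g (x + w *: v) 0 j) z ('d g (x + z *: v) v 0 j).
Proof.
move=> dg e e0.
have v0 : 0 < 1 + nm v by rewrite ltr_pwDl// nm_ge0.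
have [|s s0 hs] := differentiable_eps dg (e := e / (1 + nm v)); first by rewrite divr_gt0.
exists (s / (1 + nm v)); first by rewrite divr_gt0.
move=> w; rewrite ltr_pdivlMr// => hw.
have hn : nm ((w - z) *: v) <= nm (w - z) * (1 + nm v).
  by rewrite nmZ ler_wpM2l ?nm_ge0// lerDr.
have E : x + z *: v + (w - z) *: v = x + w *: v by rewrite -addrA -scalerDl subrKC.
have := hs _ (le_lt_trans hn hw); rewrite E linearZ/= => h.
apply: (@le_trans _ _ (e / (1 + nm v) * (nm (w - z) * (1 + nm v)))); last first.
  by rewrite [nm _ * _]mulrC mulrA divfK// gt_eqF.
apply: (@le_trans _ _ (e / (1 + nm v) * nm ((w - z) *: v))); last first.
  by rewrite ler_wpM2l// divr_ge0// ltW.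
apply: le_trans h; have := nm_coord (g (x + w *: v) - g (x + z *: v) -
  (w - z) *: 'd g (x + z *: v) v) j.
by rewrite !mxE/= [_ * (w - z)]mulrC.
Qed.

(** Reduction to one variable on the complex line through [x] in the direction [v]: the slice lives
    on the disc of radius [r / nm v] and is evaluated at 1. *)
Lemma taylor_row p q (g : 'C^p -> 'C^q) x r B v : 0 < r ->
  (forall u, nm u < r -> differentiable g (x + u)) ->
  (forall u, nm u < r -> nm (g (x + u)) <= B) -> nm v < r / 4 ->
  nm (g (x + v) - g x - 'd g x v) <= 128 * B / r ^+ 2 * nm v ^+ 2.
Proof.
move=> r0 hd hB hv.
have B0 : 0 <= B by apply: (le_trans (nm_ge0 (g (x + 0)))); rewrite hB// nm0.
have [->|v0] := eqVneq v 0.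
  by rewrite addr0 linear0 !subrr !nm0 expr0n/= mulr0.
have nv0 : 0 < nm v by rewrite nm_gt0.
apply: nm_row_le.
  by rewrite mulr_ge0 ?exprn_ge0 ?nm_ge0// divr_ge0 ?exprn_ge0 ?mulr_ge0// ltW.
move=> j; pose phi (w : C) : C := g (x + w *: v) 0 j.
have x0 : x + 0 *: v = x by rewrite scale0r addr0.
have rv z : nm z < r / nm v -> nm (z *: v) < r by rewrite ltr_pdivlMr// nmZ.
have := @taylor1 R phi ('d g x v 0 j) (r / nm v) B 1.
rewrite /phi scale1r x0 nm1 expr1n !mulr1 !mxE.
have -> : 128 * B / r ^+ 2 * nm v ^+ 2 = 128 * B / (r / nm v) ^+ 2.
  by field; rewrite !gt_eqF.
apply.
- by rewrite divr_gt0.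
- by move=> z hz; eexists; apply: slice_cderiv; apply: hd; exact: rv.
- by move=> z hz; apply: le_trans (nm_coord _ _) _; apply: hB; exact: rv.
- have d0 : differentiable g x by rewrite -(addr0 x); apply: hd; rewrite nm0.
  by have := @slice_cderiv _ _ g x v j 0; rewrite x0; apply.
- by rewrite -mulrA mulrC -mulrA ltr_pdivlMl// mulr1 mulrC.
Qed.

Definition nlim (V : normedZmodType C) (u : nat -> V) (l : V) :=
  forall e, 0 < e -> \forall m \near \oo, nm (u m - l) <= e.

Lemma nm_lim_le (V : normedZmodType C) (u : nat -> V) l B :
  nlim u l ->
  (\forall m \near \oo, nm (u m) <= B) -> nm l <= B.
Proof.
move=> h hB; apply/ler_addgt0Pr => e e0.
have [m [h1 h2]] := @filter_ex _ \oo _ _ (filterI (h e e0) hB).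
have := nmD (u m) (- (u m - l)); rewrite opprB subrKC nmB; lra.
Qed.

Lemma nm_lim_unique (V : normedZmodType C) (u : nat -> V) l l' :
  nlim u l ->
  nlim u l' -> l = l'.
Proof.
move=> h h'; apply/eqP; rewrite -subr_eq0 -nm_eq0 eq_le nm_ge0 andbT.
apply/ler_addgt0Pr => e e0; rewrite add0r; have e20 : 0 < e / 2 by lra.
have [m [h1 h2]] := @filter_ex _ \oo _ _ (filterI (h _ e20) (h' _ e20)).
have := nmD (u m - l') (- (u m - l)).
by rewrite nmN opprB addrC addrA subrK; lra.
Qed.

Lemma nlimD (V : normedZmodType C) (u w : nat -> V) l l' :
  nlim u l -> nlim w l' -> nlim (fun m => u m + w m) (l + l').
Proof.
move=> h h' e e0; have e20 : 0 < e / 2 by lra.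
apply: filterS2 (h _ e20) (h' _ e20) => m h1 h2.
by rewrite opprD addrACA (splitr e); apply: (le_trans (nmD _ _)); exact: lerD.
Qed.

Lemma nlimZ (V : normedModType C) (u : nat -> V) l (k : C) :
  nlim u l -> nlim (fun m => k *: u m) (k *: l).
Proof.
move=> h e e0; have k0 : 0 < 1 + nm k by rewrite ltr_pwDl// nm_ge0.
have e20 : 0 < e / (1 + nm k) by rewrite divr_gt0.
apply: filterS (h _ e20) => m; rewrite ler_pdivlMr// -scalerBr nmZ mulrC.
by apply: le_trans; rewrite ler_wpM2r ?nm_ge0// lerDr.
Qed.

Lemma nlimN (V : normedModType C) (u : nat -> V) l :
  nlim u l -> nlim (fun m => - u m) (- l).
Proof.
move=> /(nlimZ (-1)); rewrite scaleN1r => h e /h; apply: filterS => m.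
by rewrite scaleN1r.
Qed.

Lemma bounded_continuous (V W : normedModType C) (L : {linear V -> W}) M :
  (forall v, nm (L v) <= M * nm v) -> continuous L.
Proof.
move=> hM x; apply/cvgrPdist_le => e e0.
have eE : e = (complex.Re e)%:C by rewrite RRe_real// gtr0_real.
have e0' : 0 < complex.Re e by rewrite -ltcR -eE.
have M0 : 0 < 1 + `|M| by rewrite ltr_pwDl.
apply/nbhs_ballP; exists (complex.Re e / (1 + `|M|))%:C; first by rewrite /= ltcR divr_gt0.
move=> y; rewrite -ball_normE/= nm_lt_norm ltr_pdivlMr// => h.
rewrite -linearB eE nm_le_norm; apply: (le_trans (hM _)).
apply: le_trans (ltW h); rewrite mulrC ler_wpM2l ?nm_ge0//.
by apply: (le_trans (ler_norm _)); rewrite lerDr.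
Qed.

(* Only pointwise convergence is assumed: the uniform bound makes the
   second-order Taylor remainders of the [g m] uniform in [m]. *)
Lemma weierstrass p q (g : nat -> 'C^p -> 'C^q) (G : 'C^p -> 'C^q) (x : 'C^p) r B : 0 < r ->
  (forall m (u : 'C^p), nm u < r -> differentiable (g m) (x + u)) ->
  (forall m (u : 'C^p), nm u < r -> nm (g m (x + u)) <= B) ->
  (forall u : 'C^p, nm u < r -> nlim (fun m => g m (x + u)) (G (x + u))) ->
  differentiable G x.
Proof.
move=> r0 hd hB hG.
have B0 : 0 <= B by apply: (le_trans (nm_ge0 (g 0%N (x + 0)))); rewrite hB// nm0.
pose K := 128 * B / r ^+ 2.
have K0 : 0 <= K by rewrite /K divr_ge0 ?exprn_ge0 ?mulr_ge0// ltW.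
have [L LE] : exists L : nat -> {linear 'C^p -> 'C^q}, forall m, L m = 'd (g m) x.
  by exists (fun m => 'd (g m) x).
have LZ m (a : C) u : L m (a *: u) = a *: L m u by exact: linearZ.
have LD m u v : L m (u + v) = L m u + L m v by exact: linearD.
have T m (v : 'C^p) : nm v < r / 4 -> nm (g m (x + v) - g m x - L m v) <= K * nm v ^+ 2.
  by rewrite LE => hv; apply: (taylor_row r0) => // u hu; [exact: hd|exact: hB].
have small (v : 'C^p) e : 0 < e -> exists2 s : R, 0 < s & nm (s%:C *: v) < r / 4 /\ K * (s * nm v ^+ 2) <= e.
  move=> e0; pose M := 1 + nm v + K * nm v ^+ 2.
  have v0 := nm_ge0 v; have Kv : 0 <= K * nm v ^+ 2 by rewrite mulr_ge0// exprn_ge0.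
  have M0 : 0 < M by rewrite /M; lra.
  pose t := Num.min (r / 8) e.
  have t0 : 0 < t by rewrite lt_min e0 divr_gt0.
  have tr : t <= r / 8 by rewrite ge_min lexx.
  have te : t <= e by rewrite ge_min lexx orbT.
  have s0 : 0 < t / M by rewrite divr_gt0.
  have tM a : 0 <= a <= M -> t / M * a <= t.
    by move=> /andP[? ?]; rewrite mulrAC ler_pdivrMr// ler_wpM2l// ltW.
  exists (t / M) => //; split.
    rewrite nmZ nmC gtr0_norm//; apply: (@le_lt_trans _ _ t); last by lra.
    by apply: tM; rewrite /M; lra.
  by rewrite mulrCA; apply: le_trans te; apply: tM; rewrite /M; lra.
(* [L m v] differs from the difference quotient of [g m] with step [s] by at most [e / 4], uniformly
   in [m]; these quotients converge for fixed [s], so the differentials form a Cauchy sequence at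
   each [v]. *)
have Lcauchy (v : 'C^p) e : 0 < e -> exists N, forall m n, (N <= m)%N -> (N <= n)%N ->
    nm (L m v - L n v) <= e.
  move=> e0; have e40 : 0 < e / 4 by lra.
  have [s s0 [hs1 hs2]] := small v _ e40.
  have es0 : 0 < e / 8 * s by rewrite mulr_gt0// divr_gt0.
  have r0' : nm (0 : 'C^p) < r by rewrite nm0.
  have sv : nm (s%:C *: v) < r by lra.
  have [N _ hN] := filterI (hG _ sv _ es0) (hG _ r0' _ es0).
  exists N => m n /hN[h1 h2] /hN[h3 h4]; rewrite addr0 in h2 h4.
  pose X := s%:C *: v.
  have EX : nm (L m X - L n X) = s * nm (L m v - L n v).
    by rewrite /X !LZ -scalerBr nmZ nmC gtr0_norm.
  rewrite -(ler_pM2l s0) -EX.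
  have nX : nm X = s * nm v by rewrite /X nmZ nmC gtr0_norm.
  have t1 : nm (g m (x + X) - g m x - L m X) <= e / 4 * s.
    apply: (le_trans (T m _ hs1)); rewrite nX exprMn expr2 -mulrA mulrCA mulrC.
    by rewrite ler_wpM2r// ltW.
  have t2 : nm (g n (x + X) - g n x - L n X) <= e / 4 * s.
    apply: (le_trans (T n _ hs1)); rewrite nX exprMn expr2 -mulrA mulrCA mulrC.
    by rewrite ler_wpM2r// ltW.
  rewrite -/X in h1 h3.
  clearbody X.
  have -> : L m X - L n X =
     - (g m (x + X) - g m x - L m X) + (g n (x + X) - g n x - L n X)
     + (g m (x + X) - G (x + X)) - (g n (x + X) - G (x + X))
     - (g m x - G x) + (g n x - G x).
    by set a := L m X; set b := L n X; apply/rowP => j; rewrite !mxE; ring.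
  have n6 (a b c d y z : 'C^q) :
      nm (a + b + c + d + y + z) <= nm a + nm b + nm c + nm d + nm y + nm z.
    by do ![apply: (le_trans (nmD _ _)); apply: lerD => //].
  apply: (le_trans (n6 _ _ _ _ _ _)); rewrite !nmN; clear -t1 t2 h1 h2 h3 h4; lra.
pose Lf v := sval (cid (cauchy_row (Lcauchy v))).
have LfP v : nlim (L^~ v) (Lf v) by rewrite /Lf; case: cid.
have lin : linear Lf.
  move=> a u v; apply: (nm_lim_unique (LfP (a *: u + v))).
  have := nlimD (nlimZ a (LfP u)) (LfP v).
  by under [X in nlim X]funext => m do rewrite -LZ -LD.
pose LA := GRing.isLinear.Build _ _ _ _ Lf lin.
pose LL : {linear 'C^p -> 'C^q} := HB.pack Lf LA.
have limT (v : 'C^p) : nm v < r / 4 -> nm (G (x + v) - G x - LL v) <= K * nm v ^+ 2.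
  move=> hv; have vr : nm v < r by lra.
  have hx := hG 0; rewrite addr0 nm0 in hx.
  apply: (nm_lim_le (u := fun m => g m (x + v) - g m x - L m v)).
    exact: nlimD (nlimD (hG _ vr) (nlimN (hx r0))) (nlimN (LfP v)).
  by apply: nearW => m; exact: T.
have GB (v : 'C^p) : nm v < r -> nm (G (x + v)) <= B.
  move=> hv; apply: (nm_lim_le (hG _ hv)); apply: nearW => m; exact: hB.
(* An operator bound for the limit differential, read off from its Taylor estimate at vectors of
   norm [r / 8]. *)
pose M := (2 * B + K * (r / 4) ^+ 2) / (r / 8).
have bnd v : nm (LL v) <= M * nm v.
  have [->|v0] := eqVneq v 0; first by rewrite linear0 !nm0 mulr0.
  have nv0 : 0 < nm v by rewrite nm_gt0.
  pose s := r / 8 / nm v.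
  have s0 : 0 < s by rewrite !divr_gt0.
  have sv : nm (s%:C *: v) = r / 8 by rewrite nmZ nmC gtr0_norm// divfK// gt_eqF.
  have h1 : nm (s%:C *: v) < r / 4 by rewrite sv; lra.
  have := limT _ h1; have h2 : nm (s%:C *: v) < r by rewrite sv; lra.
  have := GB _ h2; have := GB 0; rewrite addr0 nm0 => /(_ r0) hx.
  set X := G (x + _); set Y := LL _ => hX hY.
  have : nm Y <= 2 * B + K * (r / 4) ^+ 2.
    have -> : Y = X - G x - (X - G x - Y) by rewrite opprB addrC subrK.
    apply: (le_trans (nmD _ _)); rewrite nmN; apply: lerD.
      by apply: (le_trans (nmD _ _)); rewrite nmN; lra.
    apply: (le_trans hY); apply: ler_wpM2l => //.
    by rewrite ler_sqr ?nnegrE ?nm_ge0// ?ltW// divr_gt0.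
  rewrite /Y linearZ/= nmZ nmC gtr0_norm// mulrC -ler_pdivlMr//.
  rewrite /s /M => /le_trans; apply; rewrite le_eqVlt; apply/orP; left; apply/eqP.
  by field; rewrite !gt_eqF.
apply: (eps_differentiable (L := LL)); first exact: bounded_continuous bnd.
move=> e e0; have K1 : 0 < K + 1 by lra.
exists (Num.min (r / 4) (e / (K + 1))); first by rewrite lt_min !divr_gt0.
move=> v; rewrite lt_min => /andP[h1]; rewrite ltr_pdivlMr// => h2.
apply: (le_trans (limT v h1)); rewrite expr2 mulrA ler_wpM2r ?nm_ge0//.
have := nm_ge0 v; lra.
Qed.

End weierstrass.

(** * Chernoff products of nonexpansive maps *)

Section chernoff.
Context {R : realType} {T : Type}.
Variables (d : T -> T -> R) (F : R -> T -> T) (lambda : R).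
Implicit Types (x y z w : T) (e s t h a : R) (i j k n : nat).

Hypothesis d_ge0 : forall x y, 0 <= d x y.
Hypothesis d_eq0 : forall x y, d x y = 0 <-> x = y.
Hypothesis d_sym : forall x y, d x y = d y x.
Hypothesis d_tri : forall x y z, d x z <= d x y + d y z.
Hypothesis d_complete : forall u : nat -> T,
  (forall e, 0 < e -> exists N, forall m n, (N <= m)%N -> (N <= n)%N -> d (u m) (u n) < e) ->
  exists x, d (u n) x @[n --> \oo] --> (0 : R).
Hypothesis lambda_gt0 : 0 < lambda.
Hypothesis F_nonexp : forall h x y, 0 < h < lambda -> d (F h x) (F h y) <= d x y.

Notation "F ^[ k , h ]" := (iter k (F h)) (at level 2, format "F ^[ k ,  h ]").

(** Short products started near [w] depend on step and count only through the elapsed time, up to an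
    error small relative to that time. Nothing is uniform in [w]. The case [j' = 0] bounds the
    initial speed. *)
Hypothesis F_consistent : forall w, exists2 rho : R, 0 < rho &
  exists2 C : R, 0 <= C & forall e, 0 < e -> exists2 s : R, 0 < s &
  forall h h' j j' y, 0 < h < s -> 0 < h' < s -> j%:R * h < s -> j'%:R * h' < s ->
    d w y < rho -> d (F^[j, h] y) (F^[j', h'] y) <=
      C * `|j%:R * h - j'%:R * h'| + e * (j%:R * h + j'%:R * h').

Let dxx x : d x x = 0. Proof. exact/d_eq0. Qed.

Lemma iter_nonexp h k x y : 0 < h < lambda -> d (F^[k, h] x) (F^[k, h] y) <= d x y.
Proof.
move=> hh; elim: k => //= k IH; exact: le_trans (F_nonexp _ _ hh) IH.
Qed.

Lemma step_bound z : exists2 D : R, 0 <= D & exists2 s : R, 0 < s <= lambda &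
  forall h, 0 < h < s -> d (F h z) z <= D * h.
Proof.
have [rho rho0 [C C0 H]] := F_consistent z.
have [s s0 hs] := H 1 ltr01.
exists (C + 1); first lra.
exists (Num.min s lambda); first by rewrite lt_min s0 lambda_gt0 ge_min lexx orbT.
move=> h /andP[h0]; rewrite lt_min => /andP[h1 h2].
have := hs h h 1%N 0%N z; rewrite h0 h1 !mul1r mul0r subr0 addr0 (ger0_norm (ltW h0)) /=.
by rewrite dxx => /(_ isT isT h1 s0 rho0); lra.
Qed.

Section orbit.
Variables (z : T) (D s0 : R).
Hypothesis s0l : s0 <= lambda.
Hypothesis hD : forall h, 0 < h < s0 -> d (F h z) z <= D * h.

Lemma orbit_le h k : 0 < h < s0 -> d (F^[k, h] z) z <= D * (k%:R * h).
Proof.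
move=> hh; elim: k => [|k IH]; first by rewrite dxx mul0r mulr0.
apply: (le_trans (d_tri _ (F h z) _)); rewrite -natr1 mulrDl mul1r mulrDr.
apply: lerD; last exact: hD.
by apply: le_trans IH; apply: F_nonexp; case/andP: hh => -> /lt_le_trans->.
Qed.

(** The common factors are stripped off by nonexpansiveness, so the speed at [z] bounds the whole
    discrete orbit with a constant independent of [h] and of the counts. *)
Lemma orbit_lip h k k' : 0 < h < s0 ->
  d (F^[k, h] z) (F^[k', h] z) <= D * `|k%:R * h - k'%:R * h|.
Proof.
move=> hh; wlog kk : k k' / (k' <= k)%N.
  by move=> W; have [/W//|/ltnW/W] := leqP k' k; rewrite d_sym distrC.
have hl : 0 < h < lambda by case/andP: hh => -> /lt_le_trans->.
rewrite -(subnKC kk) iterD; apply: (le_trans (iter_nonexp _ _ _ hl)).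
apply: (le_trans (orbit_le _ hh)); rewrite natrD -mulrBl addrAC subrr add0r.
by rewrite ger0_norm// mulr_ge0//; case/andP: hh => /ltW.
Qed.
End orbit.

Definition net_lim z t x := forall e, 0 < e -> exists2 s : R, 0 < s &
  forall h k, 0 < h < s -> `|k%:R * h - t| < s -> d (F^[k, h] z) x <= e.

Definition net_cauchy z t := forall e, 0 < e -> exists2 s : R, 0 < s &
  forall h k h' k', 0 < h < s -> 0 < h' < s ->
    `|k%:R * h - t| < s -> `|k'%:R * h' - t| < s ->
    d (F^[k, h] z) (F^[k', h'] z) <= e.

Lemma steps h t : 0 < h -> 0 <= t -> exists k, t - h < k%:R * h <= t.
Proof.
move=> h0 t0; exists (Num.truncn (t / h)).
have th : 0 <= t / h by rewrite divr_ge0// ltW.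
have /andP[h1 h2] := truncn_itv th.
rewrite ler_pdivlMr// in h1; rewrite ltr_pdivrMr// -natr1 mulrDl mul1r in h2.
by rewrite h1 andbT; lra.
Qed.

Lemma net_cauchy_lim z t : 0 <= t -> net_cauchy z t -> exists x, net_lim z t x.
Proof.
move=> t0 hc.
have hk n : {k | t - n.+1%:R^-1 < k%:R * n.+1%:R^-1 <= t}.
  by apply: cid; apply: steps.
pose u n := F^[sval (hk n), n.+1%:R^-1] z.
have small s : 0 < s -> \forall n \near \oo, n.+1%:R^-1 < s.
  by move=> hs; exact: near_infty_natSinv_lt (PosNum hs).
have uk n : `|(sval (hk n))%:R * n.+1%:R^-1 - t| <= n.+1%:R^-1.
  case: (hk n) => k /=; have : 0 < n.+1%:R^-1 :> R by rewrite invr_gt0.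
  by move: (n.+1%:R^-1) => q q0 hq; rewrite ler_norml; lra.
have [|x hx] := d_complete (u := u).
  move=> e e0; have e20 : 0 < e / 2 by lra.
  have [s s0 hs] := hc _ e20; have [N _ hN] := small _ s0.
  exists N => m n Nm Nn; apply: (@le_lt_trans _ _ (e / 2)); last by lra.
  by apply: hs; rewrite ?invr_gt0 ?ltr0Sn ?hN ?(le_lt_trans (uk _) (hN _ _)).
exists x => e e0; have e20 : 0 < e / 2 by lra.
have [s s0 hs] := hc _ e20; exists s => // h k hh hkt.
move/cvgrPdist_le : hx => /(_ _ e20) hx.
have [n [h1 h2]] := @filter_ex _ \oo _ _ (filterI hx (small _ s0)).
move: h1; rewrite sub0r normrN ger0_norm// => h1.
apply: (le_trans (d_tri _ (u n) _)); rewrite (splitr e); apply: lerD => //.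
by apply: hs; rewrite ?invr_gt0 ?ltr0Sn ?h2 ?(le_lt_trans (uk _)).
Qed.

Lemma net_cauchy_local z : exists2 tau : R, 0 < tau &
  forall t, 0 <= t <= tau -> net_cauchy z t.
Proof.
have [D D0 [s0 /andP[s00 s0l] hD]] := step_bound z.
have [rho rho0 [C C0 HC]] := F_consistent z.
(* Up to this time an orbit moves by less than [rho], so every block starts in the ball where
   [F_consistent] applies. *)
exists (rho / 2 / (D + 1)); first by rewrite !divr_gt0//; lra.
move=> t /andP[t0 tt] e e0.
have Dt : D * t < rho.
  have D1 : 0 < D + 1 by lra.
  by move: tt; rewrite ler_pdivlMr//; lra.
have t1 : 0 < 4 * (t + 1) by lra.
have [|sg sg0 hsg] := HC (e / (4 * (t + 1))); first by rewrite divr_gt0.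
set eta := e / _ in hsg.
have eta0 : 0 <= eta by rewrite ltW// divr_gt0.
have etat : eta * t <= e / 4.
  rewrite /eta mulrAC ler_pdivrMr//.
  have -> : e / 4 * (4 * (t + 1)) = e * (t + 1) by field.
  by rewrite ler_wpM2l// ?ltW//; lra.
(* Both products are cut into [n] blocks of total time about [t / n], which are
   compared one after the other. *)
have [n n0 tn] : exists2 n, (0 < n)%N & t / n%:R < sg.
  have [N _ /(_ N (leqnn _)) hN] := near_infty_natSinv_lt (PosNum (divr_gt0 sg0 t1)).
  exists N.+1 => //; rewrite /= in hN; move: hN; rewrite ltr_pdivlMr// => hN.
  apply: le_lt_trans hN; rewrite mulrC ler_wpM2l//; lra.
pose a := t / n%:R; have nR : 0 < n%:R :> R by rewrite ltr0n.
have na : n%:R * a = t by rewrite /a mulrC divfK// gt_eqF.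
have a0 : 0 <= a by rewrite divr_ge0.
(* The number [n] of blocks is fixed before the step. [K] collects the rounding errors: two end
   corrections of at most [D * ((1 + n%:R) * s)] and [n] block errors [C * s]. The other half of [e]
   pays for the consistency errors, [2 * eta * t] in total. *)
pose K := 2 * D * (1 + n%:R) + n%:R * C + 1.
have K0 : 0 < K by rewrite /K ltr_wpDl// addr_ge0// !mulr_ge0//; lra.
pose s := Num.min (Num.min s0 sg) (e / 2 / K).
have s_gt0 : 0 < s by rewrite !lt_min s00 sg0 !divr_gt0.
have ss0 : s <= s0 by rewrite !ge_min lexx.
have ssg : s <= sg by rewrite !ge_min lexx orbT.
have sK : K * s <= e / 2 by rewrite mulrC -ler_pdivlMr// ge_min lexx orbT.
exists s => // h k h' k' /andP[h0 hs] /andP[h'0 h's] hk hk'.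
have [j /andP[j1 j2]] := steps h0 a0.
have [j' /andP[j'1 j'2]] := steps h'0 a0.
have hh : 0 < h < s0 by rewrite h0 (lt_le_trans hs).
have hh' : 0 < h' < s0 by rewrite h'0 (lt_le_trans h's).
have jn (g : R) m l : 0 < g < s -> `|l%:R * g - t| < s -> a - g < m%:R * g <= a ->
    d (F^[l, g] z) (F^[(n * m)%N, g] z) <= D * ((1 + n%:R) * s).
  move=> /andP[g0 gs] lt /andP[m1 m2].
  apply: (le_trans (orbit_lip s0l hD _ _ _)); first by rewrite g0 (lt_le_trans gs).
  apply: ler_wpM2l => //; rewrite natrM.
  have -> : l%:R * g - n%:R * m%:R * g = (l%:R * g - t) + n%:R * (a - m%:R * g).
    by rewrite mulrBr na; ring.
  apply: (le_trans (ler_normD _ _)); rewrite mulrDl mul1r; apply: lerD; first exact: ltW.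
  rewrite normrM (ger0_norm (ltW nR)); apply: ler_wpM2l; first exact: ltW.
  by rewrite ger0_norm; lra.
have Dja i : (i <= n)%N -> d (F^[(i * j')%N, h'] z) z < rho.
  move=> ni; apply: le_lt_trans Dt; apply: (le_trans (orbit_le s0l hD _ hh')).
  rewrite natrM -mulrA -na; apply: ler_wpM2l => //.
  by apply: ler_pM => //; [rewrite mulr_ge0// ltW|rewrite ler_nat].
pose b := C * s + eta * (2 * a).
have tel i : (i <= n)%N -> d (F^[(i * j)%N, h] z) (F^[(i * j')%N, h'] z) <= i%:R * b.
  elim: i => [_|i IH ni]; first by rewrite !mul0n /= dxx mul0r.
  rewrite !mulSn !iterD -natr1 mulrDl mul1r.
  have hl : 0 < h < lambda by rewrite h0 (lt_le_trans hs)// (le_trans ss0).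
  (* The intermediate point runs the [h]-block from the [h']-orbit: nonexpansiveness carries the old
     error along, consistency bounds the new one. *)
  apply: (le_trans (d_tri _ (F^[j, h] (F^[(i * j')%N, h'] z)) _)); apply: lerD.
    by apply: (le_trans (iter_nonexp _ _ _ hl)); apply: IH; exact: ltnW.
  have := hsg h h' j j' (F^[(i * j')%N, h'] z).
  rewrite h0 h'0 (lt_le_trans hs ssg) (lt_le_trans h's ssg) d_sym Dja ?(ltnW ni)//=.
  rewrite (le_lt_trans j2 tn) (le_lt_trans j'2 tn) => /(_ isT isT isT isT isT).
  rewrite d_sym => /le_trans; apply; apply: lerD; apply: ler_wpM2l => //; last lra.
  by rewrite ler_norml; lra.
have h1 := jn h j k; rewrite h0 hs j1 j2 in h1; have {}h1 := h1 isT hk isT.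
have h2 := jn h' j' k'; rewrite h'0 h's j'1 j'2 in h2; have {}h2 := h2 isT hk' isT.
have h3 := tel n (leqnn n).
have h4 := d_tri (F^[k, h] z) (F^[(n * j)%N, h] z) (F^[k', h'] z).
have h5 := d_tri (F^[(n * j)%N, h] z) (F^[(n * j')%N, h'] z) (F^[k', h'] z).
rewrite [d (F^[(n * j')%N, h'] z) _]d_sym in h5.
have nb : n%:R * b = n%:R * C * s + 2 * (eta * t) by rewrite /b -na; ring.
rewrite nb in h3; rewrite /K in sK.
clear -h1 h2 h3 h4 h5 etat sK s_gt0; lra.
Qed.

(** Both orbits are compared at the earlier time [t - r]. The shift [r], the rounding and the
    deviation from [t] are each at most [r], so going back costs [D * (3 * r)] per orbit; the
    constant 12 keeps the two costs below [e / 2]. *)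
Lemma net_cauchy_closed z t : 0 < t -> (forall u, 0 <= u < t -> net_cauchy z u) ->
  net_cauchy z t.
Proof.
move=> t0 hu e e0.
have [D D0 [s0 /andP[s00 s0l] hD]] := step_bound z.
pose r := Num.min t (e / (12 * (D + 1))).
have D1 : 0 < 12 * (D + 1) by lra.
have r0 : 0 < r by rewrite lt_min t0 divr_gt0.
have rt : r <= t by rewrite ge_min lexx.
have rD : r * (12 * (D + 1)) <= e by rewrite -ler_pdivlMr// ge_min lexx orbT.
clearbody r.
have [||s1 s10 hs1] := hu (t - r) _ (e / 2); [lra|lra|].
exists (Num.min (Num.min s0 s1) r); first by rewrite !lt_min s00 s10.
move=> h k h' k'; rewrite !lt_min => /andP[h0 /andP[/andP[a1 a2] a3]].
move=> /andP[h'0 /andP[/andP[b1 b2] b3]] /andP[/andP[c1 c2] c3] /andP[/andP[d1 d2] d3].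
have tr0 : 0 <= t - r by lra.
have [j /andP[j1 j2]] := steps h0 tr0.
have [j' /andP[j'1 j'2]] := steps h'0 tr0.
have h1 : d (F^[k, h] z) (F^[j, h] z) <= D * (3 * r).
  apply: (le_trans (orbit_lip s0l hD _ _ _)); first by rewrite h0.
  apply: ler_wpM2l => //; move: c3; rewrite ltr_norml ler_norml; lra.
have h2 : d (F^[k', h'] z) (F^[j', h'] z) <= D * (3 * r).
  apply: (le_trans (orbit_lip s0l hD _ _ _)); first by rewrite h'0.
  apply: ler_wpM2l => //; move: d3; rewrite ltr_norml ler_norml; lra.
have h3 : d (F^[j, h] z) (F^[j', h'] z) <= e / 2.
  by apply: hs1; rewrite ?h0 ?h'0//= ltr_norml; lra.
have h4 := d_tri (F^[k, h] z) (F^[j, h] z) (F^[k', h'] z).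
have h5 := d_tri (F^[j, h] z) (F^[j', h'] z) (F^[k', h'] z).
rewrite [d (F^[j', h'] z) _]d_sym in h5; lra.
Qed.

(** The product is cut after [i] steps with [i%:R * h] near [t]; its first part may be replaced by
    the limit [x], because the remaining factors do not increase [d]. *)
Lemma net_cauchy_add z x t u : 0 <= t -> 0 < u -> net_lim z t x -> net_cauchy x u ->
  net_cauchy z (t + u).
Proof.
move=> t0 u0 hx hc e e0; have e30 : 0 < e / 3 by lra.
have [s1 s10 h1] := hx _ e30; have [s2 s20 h2] := hc _ e30.
(* The bound [u] ensures that the cut comes before the end of the product; half of [s2] is reserved
   for rounding. *)
pose s := Num.min (Num.min lambda u) (Num.min s1 (s2 / 2)).
have s0 : 0 < s by rewrite !lt_min lambda_gt0 u0 s10 divr_gt0.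
exists s => // h k h' k'.
have main (g : R) l : 0 < g < s -> `|l%:R * g - (t + u)| < s ->
    exists2 j, `|j%:R * g - u| < s2 & d (F^[l, g] z) (F^[j, g] x) <= e / 3.
  rewrite !lt_min => /andP[g0 /andP[/andP[a1 a2] /andP[a3 a4]]].
  move=> /andP[/andP[b1 b2] /andP[b3 b4]].
  have [i /andP[i1 i2]] := steps g0 t0.
  have il : (i <= l)%N.
    rewrite -(ler_nat R) -(ler_pM2r g0); move: b2; rewrite ltr_norml; lra.
  exists (l - i)%N.
    rewrite natrB// mulrBl; move: b4; rewrite !ltr_norml; lra.
  rewrite -{1}(subnK il) iterD.
  have gl : 0 < g < lambda by rewrite g0.
  apply: (le_trans (iter_nonexp _ _ _ gl)); apply: h1; rewrite ?g0//.
  by rewrite ltr_norml; lra.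
move=> hh hh' /(main _ _ hh)[j j1 j2] /(main _ _ hh')[j' j'1 j'2].
have h3 : d (F^[j, h] x) (F^[j', h'] x) <= e / 3.
  move: hh hh'; rewrite !lt_min => /andP[h0 /andP[_ /andP[_ c]]] /andP[h'0 /andP[_ /andP[_ c']]].
  by apply: h2; rewrite ?h0 ?h'0//=; lra.
have h4 := d_tri (F^[k, h] z) (F^[j, h] x) (F^[k', h'] z).
have h5 := d_tri (F^[j, h] x) (F^[j', h'] x) (F^[k', h'] z).
rewrite [d (F^[j', h'] x) _]d_sym in h5; lra.
Qed.

(** Continuation: if the property fails at [t], the times up to which it holds have a supremum; it
    holds there by closedness, and restarting from the limit point goes beyond the supremum. *)
Lemma net_cauchy_all z t : 0 <= t -> net_cauchy z t.
Proof.
move=> t0; apply: contrapT => nc.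
pose S := [set a | 0 <= a /\ forall u, 0 <= u <= a -> net_cauchy z u].
have Sub : ubound S t.
  move=> a [a0 ha]; rewrite leNgt; apply/negP => ta; apply: nc; apply: ha; lra.
have [tau tau0 ht] := net_cauchy_local z.
have S0 : S tau by split; [exact: ltW|].
have hS : has_sup S by split; [exists tau|exists t].
set c := sup S.
have tc : tau <= c by apply: ub_le_sup => //; exists t.
have below u : 0 <= u < c -> net_cauchy z u.
  move=> /andP[u0 uc]; have cu : 0 < c - u by lra.
  have [a [a0 ha] ca] := sup_adherent cu hS.
  by apply: ha; rewrite u0 /=; move: ca; rewrite -/c; lra.
have c0 : 0 < c by lra.
have hc := net_cauchy_closed c0 below.
have [x hx] := net_cauchy_lim (ltW c0) hc.
have [r r0 hr] := net_cauchy_local x.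
have : S (c + r).
  split; first lra; move=> u /andP[u0 uc].
  have [uc'|] := ltP u c; first by apply: below; rewrite u0.
  rewrite le_eqVlt => /predU1P[<-//|cu].
  have -> : u = c + (u - c) by ring.
  by apply: net_cauchy_add hx _; [lra|lra|apply: hr; lra].
move/(ub_le_sup (ex_intro _ t Sub)); rewrite -/c; lra.
Qed.

(** The value [z] at negative times is only a filler. *)
Definition limit_flow t z : T :=
  if pselect (0 <= t) is left t0 then sval (cid (net_cauchy_lim t0 (net_cauchy_all z t0)))
  else z.

Lemma limit_flowP t z : 0 <= t -> net_lim z t (limit_flow t z).
Proof.
by move=> t0; rewrite /limit_flow; case: pselect => // t0'; case: cid.
Qed.

Lemma net_lim_unique z t x y : 0 <= t -> net_lim z t x -> net_lim z t y -> x = y.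
Proof.
move=> t0 hx hy; apply/d_eq0/eqP; rewrite eq_le d_ge0 andbT.
apply/ler_addgt0Pr => e e0; rewrite add0r; have e20 : 0 < e / 2 by lra.
have [s s0 hs] := hx _ e20; have [s' s'0 hs'] := hy _ e20.
pose m := Num.min s s'.
have m0 : 0 < m by rewrite lt_min s0.
have [m1 m2] : m <= s /\ m <= s' by rewrite !ge_min !lexx orbT.
pose h := m / 2.
have [h0 hs1 hs2] : [/\ 0 < h, h < s & h < s'] by rewrite /h; split; lra.
have [k /andP[k1 k2]] := steps h0 t0.
have := hs h k; rewrite h0 hs1 => /(_ isT).
have := hs' h k; rewrite h0 hs2 => /(_ isT).
have l1 : `|k%:R * h - t| < s by rewrite ltr_norml; lra.
have l2 : `|k%:R * h - t| < s' by rewrite ltr_norml; lra.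
move=> /(_ l2) u1 /(_ l1) u2; have := d_tri x (F^[k, h] z) y.
have := d_sym x (F^[k, h] z); lra.
Qed.

Lemma limit_flow0 z : limit_flow 0 z = z.
Proof.
apply: (net_lim_unique (lexx 0) (limit_flowP z (lexx 0))) => e e0.
have [D D0 [s0 /andP[s00 s0l] hD]] := step_bound z.
have D1 : 0 < D + 1 by lra.
exists (Num.min s0 (e / (D + 1))); first by rewrite lt_min s00 divr_gt0.
move=> h k; rewrite !lt_min subr0 => /andP[h0 /andP[h1 h2]] /andP[k1 k2].
have hh : 0 < h < s0 by rewrite h0.
apply: (le_trans (orbit_le s0l hD _ hh)).
rewrite ger0_norm ?mulr_ge0 ?(ltW h0)// ltr_pdivlMr// in k2.
have kh0 : 0 <= k%:R * h by rewrite mulr_ge0// ltW.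
lra.
Qed.

Lemma limit_flow_nonexp t x y : 0 <= t -> d (limit_flow t x) (limit_flow t y) <= d x y.
Proof.
move=> t0; apply/ler_addgt0Pr => e e0; have e20 : 0 < e / 2 by lra.
have [s s0 hs] := limit_flowP x t0 e20; have [s' s'0 hs'] := limit_flowP y t0 e20.
have [h [k [h0 hl h1 h2]]] : exists h k, [/\ 0 < h, h < lambda, h < Num.min s s' &
    `|k%:R * h - t| < Num.min s s'].
  pose m := Num.min (Num.min s s') lambda.
  have m0 : 0 < m by rewrite !lt_min s0 s'0.
  have m1 : m <= Num.min s s' by rewrite ge_min lexx.
  have m2 : m <= lambda by rewrite ge_min lexx orbT.
  have h0 : 0 < m / 2 by lra.
  have [k /andP[k1 k2]] := steps h0 t0.
  by exists (m / 2), k; split; rewrite ?ltr_norml; lra.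
rewrite !lt_min in h1 h2; case/andP: h1 => h1 h1'; case/andP: h2 => h2 h2'.
have := hs h k; rewrite h0 h1 => /(_ isT h2) u1.
have := hs' h k; rewrite h0 h1' => /(_ isT h2') u2.
have hh : 0 < h < lambda by rewrite h0.
have := iter_nonexp k x y hh.
have := d_tri (limit_flow t x) (F^[k, h] x) (limit_flow t y).
have := d_tri (F^[k, h] x) (F^[k, h] y) (limit_flow t y).
have := d_sym (limit_flow t x) (F^[k, h] x); lra.
Qed.

Lemma limit_flowD t u z : 0 <= t -> 0 <= u ->
  limit_flow (t + u) z = limit_flow u (limit_flow t z).
Proof.
move=> t0 u0; apply/d_eq0/eqP; rewrite eq_le d_ge0 andbT.
apply/ler_addgt0Pr => e e0; rewrite add0r; have e30 : 0 < e / 3 by lra.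
have tu0 : 0 <= t + u by lra.
set x := limit_flow t z.
have [s1 s10 h1] := limit_flowP z tu0 e30; have [s2 s20 h2] := limit_flowP z t0 e30.
have [s3 s30 h3] := limit_flowP x u0 e30.
pose m := Num.min (Num.min s1 s2) (Num.min s3 lambda).
have m0 : 0 < m by rewrite !lt_min s10 s20 s30.
have [m1 m2 m3 m4] : [/\ m <= s1, m <= s2, m <= s3 & m <= lambda].
  by rewrite /m; split; rewrite !ge_min lexx ?orbT.
pose h := m / 3.
have h0 : 0 < h by rewrite /h; lra.
have [i /andP[i1 i2]] := steps h0 t0; have [j /andP[j1 j2]] := steps h0 u0.
have hm : h = m / 3 by [].
have u1 : d (F^[(j + i)%N, h] z) (limit_flow (t + u) z) <= e / 3.
  apply: h1; rewrite ?h0 ?natrD ?mulrDl ?ltr_norml /=; lra.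
have u2 : d (F^[i, h] z) x <= e / 3.
  by apply: h2; rewrite ?h0 ?ltr_norml /=; lra.
have u3 : d (F^[j, h] x) (limit_flow u x) <= e / 3.
  by apply: h3; rewrite ?h0 ?ltr_norml /=; lra.
rewrite iterD in u1.
have hl : 0 < h < lambda by rewrite h0 /=; lra.
have := iter_nonexp j (F^[i, h] z) x hl.
have := d_tri (limit_flow (t + u) z) (F^[j, h] (F^[i, h] z)) (limit_flow u x).
have := d_tri (F^[j, h] (F^[i, h] z)) (F^[j, h] x) (limit_flow u x).
have := d_sym (limit_flow (t + u) z) (F^[j, h] (F^[i, h] z)); lra.
Qed.

(** Since [t] and [u] may be exchanged in the semigroup law, nonexpansiveness reduces to [t = 0]:
    the speed at [z] bounds the speed along the whole orbit. *)
Lemma limit_flow_lip z : exists2 D : R, 0 <= D &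
  forall t u, 0 <= t -> 0 <= u -> d (limit_flow (t + u) z) (limit_flow t z) <= D * u.
Proof.
have [D D0 [s0 /andP[s00 s0l] hD]] := step_bound z.
exists D => // t u t0 u0; rewrite addrC limit_flowD//.
apply: (le_trans (limit_flow_nonexp _ _ t0)).
apply/ler_addgt0Pr => e e0.
have e20 : 0 < e / 2 by lra.
have [s s0' hs] := limit_flowP z u0 e20.
have D1 : 0 < 2 * (D + 1) by lra.
pose m := Num.min (Num.min s0 s) (e / (2 * (D + 1))).
have m0 : 0 < m by rewrite !lt_min s00 s0' divr_gt0.
have [m1 m2 m3] : [/\ m <= s0, m <= s & m * (2 * (D + 1)) <= e].
  by rewrite /m -ler_pdivlMr//; split; rewrite !ge_min lexx ?orbT.
have h0 : 0 < m / 2 by lra.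
have [k /andP[k1 k2]] := steps h0 u0.
have hh : 0 < m / 2 < s0 by lra.
have := orbit_le s0l hD k hh.
have : D * (k%:R * (m / 2)) <= D * u by rewrite ler_wpM2l.
have : d (F^[k, m / 2] z) (limit_flow u z) <= e / 2.
  by apply: hs; rewrite ?ltr_norml; lra.
have := d_tri (limit_flow u z) (F^[k, m / 2] z) z.
have := d_sym (limit_flow u z) (F^[k, m / 2] z); lra.
Qed.

Lemma product_flow_exists : exists X : R -> T -> T,
  [/\ forall t z, 0 <= t -> net_lim z t (X t z), forall z, X 0 z = z,
      forall t u z, 0 <= t -> 0 <= u -> X (t + u) z = X u (X t z),
      forall t x y, 0 <= t -> d (X t x) (X t y) <= d x y &
      forall z, exists2 D : R, 0 <= D &
        forall t u, 0 <= t -> 0 <= u -> d (X (t + u) z) (X t z) <= D * u].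
Proof.
exists limit_flow; split.
- by move=> t z; exact: limit_flowP.
- exact: limit_flow0.
- by move=> t u z; exact: limit_flowD.
- by move=> t x y; exact: limit_flow_nonexp.
- exact: limit_flow_lip.
Qed.

End chernoff.

(** * The Kobayashi distance *)

Section complex_topology.
Context {R : realType}.
Local Notation C := R[i].
Local Notation "''C^' n" := 'rV[R[i]^o]_n (at level 8, n at level 2).
Implicit Types (e s r t : R).

Lemma nbhs_nm (V : normedModType C) (x : V) (A : set V) :
  nbhs x A <-> exists2 e : R, 0 < e & forall v, nm (v - x) < e -> A v.
Proof.
split=> [/nbhs_ballP[e /= e0 h]|[e e0 h]].
  have eE : e = (complex.Re e)%:C by rewrite RRe_real// gtr0_real.
  exists (complex.Re e); first by rewrite -ltcR -eE.
  by move=> v hv; apply: h; rewrite -ball_normE/= eE nm_lt_norm nmB.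
apply/nbhs_ballP; exists e%:C; first by rewrite /= ltcR.
by move=> v; rewrite -ball_normE/= nm_lt_norm nmB; exact: h.
Qed.

Lemma nm_continuous (V : normedModType C) : continuous (@nm R V : V -> R).
Proof.
move=> x; apply/cvgrPdist_lt => e e0; apply/nbhs_nm; exists e => // v hv.
apply: le_lt_trans hv; rewrite ler_norml.
have := nmD (v - x) x; have := nmD (x - v) v; rewrite !subrK (nmB x v); lra.
Qed.

Lemma near_differentiable (V W : normedModType C) (f g : V -> W) x :
  differentiable f x -> (\forall y \near x, f y = g y) -> differentiable g x.
Proof.
move=> df /nbhs_nm[r r0 hr].
apply: (eps_differentiable (L := 'd f x)); first exact: diff_continuous.
move=> e e0; have [s s0 hs] := differentiable_eps df e0.
exists (Num.min r s); first by rewrite lt_min r0.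
move=> v; rewrite lt_min => /andP[h1 h2].
by rewrite -!hr ?hs// ?subrr ?nm0// addrAC subrr add0r.
Qed.

Lemma real_complex_continuous : continuous (fun x : R => x%:C : R[i]^o).
Proof.
move=> x A /nbhs_nm[e e0 h]; apply/nbhs_ballP; exists e => //= y.
rewrite /ball/= => xy; apply: h; rewrite -rmorphB nmC distrC//.
Qed.

Lemma compact_disc r : compact [set z : R[i]^o | nm z <= r].
Proof.
pose f (p : R * R) : R[i]^o := p.1%:C + 'i%C * p.2%:C.
have cf : continuous f.
  move=> p; apply: cvgD.
    by apply: continuous_comp; [exact: cvg_fst|exact: real_complex_continuous].
  apply: cvgMr; apply: continuous_comp; [exact: cvg_snd|exact: real_complex_continuous].
have cK : compact (f @` (`[-r, r]%classic `*` `[-r, r]%classic)).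
  apply: continuous_compact; first exact: continuous_subspaceT.
  by apply: compact_setX; exact: segment_compact.
apply: (subclosed_compact _ cK).
  have -> : [set z : R[i]^o | nm z <= r] = @nm R R[i]^o @^-1` [set x | x <= r] by [].
  by apply: closed_comp; [move=> x _; exact: nm_continuous|exact: closed_le].
move=> z /= hz; exists (complex.Re z, complex.Im z); last by rewrite /f/= -complexE.
split => /=; rewrite in_itv/= -ler_norml (le_trans _ hz)// ?nm_Re ?nm_Im//.
Qed.

Lemma compact_rV_ball n (p : 'C^n) r : compact [set v | nm (v - p) <= r].
Proof.
have [r0|r0] := ltP r 0.
  rewrite (_ : mkset _ = set0); first exact: compact0.
  by apply/seteqP; split => // v /= hv; have := nm_ge0 (v - p); lra.
have -> : [set v | nm (v - p) <= r] = (fun u : 'C^n => u + p) @` [set u | nm u <= r].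
  apply/seteqP; split => [v hv|_ [u hu <-]] /=; last by rewrite addrK.
  by exists (v - p) => //=; rewrite subrK.
apply: continuous_compact.
  apply: continuous_subspaceT => u A /nbhs_nm[e e0 h]; apply/nbhs_nm; exists e => // v hv.
  by apply: h; rewrite opprD addrACA subrr addr0.
have -> : [set u : 'C^n | nm u <= r] = [set u | forall i, nm (u ord0 i) <= r].
  apply/seteqP; split => u /= hu; last exact: nm_row_le.
  by move=> i; apply: le_trans hu; exact: nm_coord.
exact: (@rV_compact R[i]^o n (fun=> [set z : R[i]^o | nm z <= r]) (fun=> @compact_disc r)).
Qed.

End complex_topology.

(** * The Poincare distance of the unit disc *)

Section poincare.
Context {R : realType}.
Local Notation C := R[i].
Implicit Types (a b : C) (e s r t : R).

Definition mobius a b : C := (a - b) / (1 - (a^*)%C * b).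

Lemma normc_nm a : Normc.normc a = nm a.
Proof. by case: a => x y; rewrite nmRI. Qed.

Lemma poincareE a b : poincare_distance a b =
  2^-1 * ln ((1 + nm (mobius a b)) / (1 - nm (mobius a b))).
Proof. by rewrite /poincare_distance normc_nm. Qed.

Lemma nm_conj a : nm (a^*)%C = nm a.
Proof. by rewrite /nm normcJ. Qed.

Lemma nm_sqr a : nm a ^+ 2 = complex.Re a ^+ 2 + complex.Im a ^+ 2.
Proof. by case: a => x y; rewrite nmRI sqr_sqrtr// addr_ge0// sqr_ge0. Qed.

Lemma nm_sqr_lt1 a : nm a < 1 -> complex.Re a ^+ 2 + complex.Im a ^+ 2 < 1.
Proof. by move=> h; rewrite -nm_sqr expr_lt1 ?nm_ge0. Qed.

Lemma nm_lt1_den a b : nm a < 1 -> nm b < 1 -> 0 < complex.Re (1 - (a^*)%C * b).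
Proof.
move=> ha hb; have h : nm ((a^*)%C * b) < 1.
  rewrite nmM nm_conj; apply: (@le_lt_trans _ _ (nm a)) => //.
  by rewrite ler_piMr ?nm_ge0// ltW.
have := nm_Re ((a^*)%C * b); rewrite ler_norml => /andP[_ h2].
have -> : complex.Re (1 - (a^*)%C * b) = 1 - complex.Re ((a^*)%C * b) by case: (_ * b).
lra.
Qed.

Lemma mobius_lt1 a b : nm a < 1 -> nm b < 1 -> nm (mobius a b) < 1.
Proof.
move=> ha hb; have := nm_lt1_den ha hb => h.
have d0 : 0 < nm (1 - (a^*)%C * b).
  by apply: lt_le_trans h _; apply: (le_trans (ler_norm _)); exact: nm_Re.
rewrite nmM nmV ltr_pdivrMr// mul1r -ltr_sqr ?nnegrE ?nm_ge0//.
rewrite !nm_sqr; move: (nm_sqr_lt1 ha) (nm_sqr_lt1 hb); clear ha hb; case: a {h d0} => x y; case: b => u v; simpc => /= h1 h2.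
rewrite -subr_gt0; set G := (X in 0 < X).
(* The classical identity for the squared moduli of numerator and denominator of a Moebius map. *)
have -> : G = (1 - (x ^+ 2 + y ^+ 2)) * (1 - (u ^+ 2 + v ^+ 2)) by rewrite /G; ring.
by rewrite mulr_gt0// subr_gt0.
Qed.

Lemma poincare_mono (x y : R) : 0 <= x -> x <= y -> y < 1 ->
  2^-1 * ln ((1 + x) / (1 - x)) <= 2^-1 * ln ((1 + y) / (1 - y)).
Proof.
move=> x0 xy y1; rewrite ler_pM2l ?invr_gt0//.
rewrite ler_ln ?posrE; [|by rewrite divr_gt0; lra..].
rewrite ler_pdivrMr; last lra.
rewrite mulrAC ler_pdivlMr; last lra.
nra.
Qed.

Lemma poincare_ge0 a b : nm a < 1 -> nm b < 1 -> 0 <= poincare_distance a b.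
Proof.
move=> ha hb; rewrite poincareE.
have := poincare_mono (lexx 0) (nm_ge0 (mobius a b)) (mobius_lt1 ha hb).
by rewrite addr0 subr0 divr1 ln1 mulr0.
Qed.

Definition segment a b t : C := a + t%:C * (b - a).

Lemma segment_lt1 a b t : nm a < 1 -> nm b < 1 -> 0 <= t <= 1 -> nm (segment a b t) < 1.
Proof.
move=> ha hb /andP[t0 t1].
have -> : segment a b t = (1 - t)%:C * a + t%:C * b.
  by rewrite /segment rmorphB rmorph1; ring.
have t1' : 0 <= 1 - t by lra.
apply: (le_lt_trans (nmD _ _)); rewrite !nmM !nmC !ger0_norm//.
have [ab|/ltW ba] := lerP (nm a) (nm b).
  by have := ler_wpM2l t1' ab; lra.
by have := ler_wpM2l t0 ba; lra.
Qed.

(* Hyperbolic balls are convex in the Euclidean sense. *)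
Lemma poincare_segment a b t : nm a < 1 -> nm b < 1 -> 0 <= t <= 1 ->
  poincare_distance a (segment a b t) <= poincare_distance a b.
Proof.
move=> ha hb t01; have hs := segment_lt1 ha hb t01.
rewrite !poincareE; apply: poincare_mono; rewrite ?nm_ge0 ?mobius_lt1//.
case/andP: t01 => t0 t1.
have pos z : nm z < 1 -> 0 < nm (1 - (a^*)%C * z).
  move=> hz; apply: lt_le_trans (nm_lt1_den ha hz) _.
  by apply: (le_trans (ler_norm _)); exact: nm_Re.
rewrite !nmM !nmV ler_pdivrMr ?pos// mulrAC ler_pdivlMr ?pos//.
have -> : a - segment a b t = t%:C * (a - b) by rewrite /segment; ring.
rewrite nmM nmC ger0_norm// mulrAC mulrC; apply: ler_wpM2l; first exact: nm_ge0.
rewrite -[X in X * _]ger0_norm// -nmC -nmM.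
rewrite -ler_sqr ?nnegrE ?nm_ge0// !nm_sqr.
have := nm_lt1_den ha hb; move: (nm_sqr_lt1 ha).
rewrite /segment; clear pos hs ha hb; case: a => x y; case: b => u v.
simpc => /= h1 h2; set A := 1 - (x ^+ 2 + y ^+ 2).
rewrite -subr_ge0; set G := (X in 0 <= X).
(* With [s] the point of the segment, [1 - conj a * s] equals [(1 - t) * A + t * (1 - conj a * b)];
   expanding its squared modulus leaves a sum of nonnegative terms. *)
have -> : G = 2 * t * (1 - t) * A * (1 - (x * u + y * v)) + (1 - t) ^+ 2 * A ^+ 2.
  by rewrite /G /A; ring.
have A0 : 0 < A by rewrite /A; lra.
have h2' : 0 <= 1 - (x * u + y * v) by move: h2; lra.
have t1' : 0 <= 1 - t by lra.
by rewrite addr_ge0// ?mulr_ge0// ?sqr_ge0// ltW.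
Qed.

(** From [ln (1 + x) <= x], the denominator [1 - r] being at least one half. *)
Lemma poincare_small b : nm b <= 2^-1 -> poincare_distance 0 b <= 2 * nm b.
Proof.
move=> hb; rewrite poincareE.
have -> : nm (mobius 0 b) = nm b.
  by rewrite /mobius conjc0 mul0r subr0 divr1 sub0r nmN.
have n0 := nm_ge0 b; set r := nm b in hb n0 *.
have p0 : 0 < 1 - r by lra.
have -> : 2 * r = 2^-1 * (4 * r) by field.
rewrite ler_pM2l ?invr_gt0//.
have : ln (1 + ((1 + r) / (1 - r) - 1)) <= (1 + r) / (1 - r) - 1.
  apply: le_ln1Dx; have : 0 <= r / (1 - r) by rewrite divr_ge0// ltW.
  have -> : (1 + r) / (1 - r) - 1 = 2 * (r / (1 - r)) by field; rewrite gt_eqF.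
  lra.
rewrite subrKC => /le_trans; apply.
have -> : (1 + r) / (1 - r) - 1 = 2 * r / (1 - r) by field; rewrite gt_eqF.
rewrite ler_pdivrMr//; nra.
Qed.

End poincare.

(** * Chains of discs and the topology defined by the Kobayashi distance *)

Section manifold.
Context {R : realType} {q : nat} (M : complex_manifold R q).
Local Notation C := R[i].
Local Notation "''C^' n" := 'rV[R[i]^o]_n (at level 8, n at level 2).
Implicit Types (c : chart R q M) (x y z w : M) (e r s t l : R).

Lemma dom_nbhs c w : dom c w -> nbhs w (dom c).
Proof. by move=> cw; apply: open_nbhs_nbhs; split => //; exact: open_dom. Qed.

Lemma chart_continuous c w : dom c w -> {for w, continuous c}.
Proof. by move=> cw; apply: chart_map_continuous; rewrite inE. Qed.

Lemma chart_inv_continuous_at c w : dom c w -> {for c w, continuous (chart_inv c)}.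
Proof. by move=> cw; apply: chart_inv_continuous; rewrite inE; exists w. Qed.

Lemma chart_ball_nbhs c w r : dom c w -> 0 < r ->
  nbhs w [set y | dom c y /\ nm (c y - c w) < r].
Proof.
move=> cw r0; apply: filterI; first exact: dom_nbhs.
have : nbhs (c w) [set v : 'C^q | nm (v - c w) < r] by apply/nbhs_nm; exists r.
by move=> /(chart_continuous cw).
Qed.

Lemma chart_near c w (U : set M) : dom c w -> nbhs w U -> exists2 r : R, 0 < r &
  forall v, nm (v - c w) < r ->
    [/\ dom c (chart_inv c v), c (chart_inv c v) = v & U (chart_inv c v)].
Proof.
move=> cw Uw.
have nU : nbhs (c w) (chart_inv c @^-1` U).
  by apply: (chart_inv_continuous_at cw); rewrite chart_mapK.
have nV : nbhs (c w) (c @` dom c).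
  by apply: open_nbhs_nbhs; split; [exact: open_codom|exists w].
have [r r0 h] := (@nbhs_nm R 'C^q _ _).1 (filterI nU nV).
exists r => // v /h[Uv [y cy E]]; split => //; first by rewrite -E chart_mapK.
by rewrite -E chart_mapK.
Qed.

Lemma chart_inj c x y : dom c x -> dom c y -> c x = c y -> x = y.
Proof. by move=> cx cy E; rewrite -(chart_mapK cx) E chart_mapK. Qed.

Lemma holomorphic_disc_comp (f : M -> M) (h : R[i]^o -> M) :
  holomorphic_map f -> holomorphic_disc h -> holomorphic_disc (f \o h).
Proof.
move=> [cf df] hh z z1; have [ch dh] := hh z z1.
split; first by apply: continuous_comp; [exact: ch|exact: cf].
move=> c cM cfz; have [c1 c1M c1z] := atlas_cover (h z).
have d1 := dh _ c1M c1z; have d2 := df c1 c (h z) c1M cM c1z cfz.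
apply: (near_differentiable (differentiable_comp d1 d2)).
have : \forall y \near z, dom c1 (h y) by apply: ch; exact: dom_nbhs.
by apply: filterS => y cy /=; rewrite chart_mapK.
Qed.

Lemma disc_chain_image (f : M -> M) x y l :
  holomorphic_map f -> disc_chain x y l -> disc_chain (f x) (f y) l.
Proof.
move=> hf; elim=> [z|h a b z k hh ha hb _ IH]; first exact: disc_chain_nil.
exact: (@disc_chain_cons _ _ _ (f \o h) a b _ _ (holomorphic_disc_comp hf hh) ha hb IH).
Qed.

Lemma nm_lt1 (z : C) : `|z| < 1 -> nm z < 1.
Proof. by rewrite -(rmorph1 (real_complex R)) nm_lt_norm. Qed.

Lemma lt1_nm (z : C) : nm z < 1 -> `|z| < 1.
Proof. by rewrite -(rmorph1 (real_complex R)) nm_lt_norm. Qed.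

Lemma disc_chain_ge0 x y l : disc_chain x y l -> 0 <= l.
Proof.
elim=> [//|h a b z k _ ha hb _ IH].
by rewrite addr_ge0// poincare_ge0// nm_lt1.
Qed.

Lemma disc_chain_segment (h : R[i]^o -> M) (a b : C) t : holomorphic_disc h ->
  `|a| < 1 -> `|b| < 1 -> 0 <= t <= 1 ->
  exists2 l : R, l <= poincare_distance a b & disc_chain (h a) (h (segment a b t)) l.
Proof.
move=> hh ha hb ht; exists (poincare_distance a (segment a b t) + 0).
  by rewrite addr0 poincare_segment ?nm_lt1.
apply: disc_chain_cons => //; last exact: disc_chain_nil.
by apply: lt1_nm; rewrite segment_lt1 ?nm_lt1.
Qed.

Local Notation D := (@kobayashi R q M).

Lemma kobayashi_le x y l : disc_chain x y l -> D x y <= l.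
Proof.
move=> h; apply: ge_inf => //; exists 0 => k /disc_chain_ge0//.
Qed.

Section distance.
Hypothesis hD : is_distance D.

Lemma kobayashi_lt x y e : D x y < e -> exists2 l : R, l < e & disc_chain x y l.
Proof.
move=> h; have [_ D0 _ _] := hD.
(* If there were no chain, the infimum would be [inf set0 = 0]. *)
have [[l hl]|hn] := pselect (exists l, disc_chain x y l); last first.
  have E : [set l | disc_chain x y l] = set0.
    by apply/seteqP; split => // l hl; apply: hn; exists l.
  by exfalso; apply: hn; exists 0; have -> : x = y;
    [apply/D0; rewrite /kobayashi E inf0|exact: disc_chain_nil].
have hi : has_inf [set l | disc_chain x y l].
  by split; [exists l|exists 0 => k /disc_chain_ge0].
have d0 : 0 < e - D x y by lra.
have [k hk1 hk2] := inf_adherent d0 hi.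
by exists k => //; move: hk2; rewrite -/(D x y); lra.
Qed.

Lemma kobayashi_nonexp (f : M -> M) x y : holomorphic_map f -> D (f x) (f y) <= D x y.
Proof.
move=> hf; apply/ler_addgt0Pr => e e0.
have [|l hl hc] := @kobayashi_lt x y (D x y + e); first by lra.
by apply: le_trans (ltW hl); apply: kobayashi_le; exact: disc_chain_image.
Qed.

Lemma affine_disc c (p u : 'C^q) : atlas M c ->
  (forall z : C, nm z < 1 -> dom c (chart_inv c (p + z *: u)) /\
     c (chart_inv c (p + z *: u)) = p + z *: u) ->
  holomorphic_disc (fun z : R[i]^o => chart_inv c (p + z *: u)).
Proof.
move=> cM hc z /nm_lt1 hz; have [h1 h2] := hc z hz.
have dA : differentiable (fun z : R[i]^o => p + z *: u) (z : R[i]^o).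
  apply: differentiableD; first exact: differentiable_cst.
  by apply: differentiableZl; exact: ex_diff.
split.
  apply: continuous_comp; first exact: differentiable_continuous.
  by rewrite /= -h2; exact: chart_inv_continuous_at.
move=> c' c'M c'z; have [d1 _] := atlas_compatible cM c'M h1 c'z.
by rewrite h2 in d1; exact: (differentiable_comp dA d1).
Qed.

(** One affine disc of radius [r / 2] centred at [c x] passes through [c y] at the parameter
    [2 / r * d], which is at most one half; [poincare_small] then gives the constant [4 / r]. *)
Lemma kobayashi_chart c w : atlas M c -> dom c w -> exists2 r : R, 0 < r &
  exists2 L : R, 0 <= L & forall x y, dom c x -> dom c y ->
    nm (c x - c w) < r -> nm (c y - c w) < r -> D x y <= L * nm (c x - c y).
Proof.
move=> cM cw; have [r r0 hr] := chart_near cw (filterT : nbhs w setT).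
have [_ D0 _ _] := hD.
exists (r / 8); first by rewrite divr_gt0.
exists (4 / r); first by rewrite divr_ge0// ltW.
move=> x y cx cy hx hy; have [E|nE] := eqVneq (c x) (c y).
  by rewrite E subrr nm0 mulr0 (chart_inj cx cy E); rewrite (D0 y y).2.
have d0 : 0 < nm (c x - c y) by rewrite nm_gt0 subr_eq0.
set d := nm (c x - c y) in d0 *.
have dr : d < r / 4.
  rewrite /d; have := nmD (c x - c w) (- (c y - c w)).
  by rewrite nmN opprB addrA subrK; lra.
pose N := r / 2 / d.
have N0 : 0 < N by rewrite !divr_gt0.
pose u := N%:C *: (c y - c x).
have nu : nm u = r / 2 by rewrite nmZ nmC gtr0_norm// nmB divfK// gt_eqF.
have inside (z : C) : nm z < 1 -> nm (c x + z *: u - c w) < r.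
  move=> hz; have -> : c x + z *: u - c w = (c x - c w) + z *: u by rewrite addrAC.
  apply: (le_lt_trans (nmD _ _)); rewrite nmZ nu.
  have : nm z * (r / 2) <= r / 2 by rewrite ler_piMl ?divr_ge0// ltW.
  lra.
pose h (z : R[i]^o) := chart_inv c (c x + z *: u).
have hh : holomorphic_disc h.
  by apply: affine_disc => // z /inside/hr[].
have h0 : h 0 = x by rewrite /h scale0r addr0 chart_mapK.
have h1 : h (N^-1)%:C = y.
  rewrite /h /u scalerA -rmorphM mulVf ?gt_eqF// rmorph1 scale1r subrKC.
  by rewrite chart_mapK.
have nN : nm ((N^-1)%:C : C) = N^-1 by rewrite nmC gtr0_norm// invr_gt0.
have NE : N^-1 = 2 / r * d by rewrite /N; field; rewrite !gt_eqF.
have N2 : N^-1 <= 2^-1.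
  rewrite NE mulrAC ler_pdivrMr//; lra.
rewrite -{1}h0 -{1}h1; apply: (@le_trans _ _ (poincare_distance 0 (N^-1)%:C + 0)).
  apply: kobayashi_le; apply: disc_chain_cons => //; last exact: disc_chain_nil.
    by apply: lt1_nm; rewrite nm0.
  by apply: lt1_nm; rewrite nN; lra.
rewrite addr0; apply: le_trans (poincare_small _) _; rewrite nN// NE.
by rewrite le_eqVlt; apply/orP; left; apply/eqP; field; rewrite gt_eqF.
Qed.

(** In the first disc whose end lies outside [A], the image of the Euclidean segment between the
    marked parameters is connected and must meet [S]. By [poincare_segment], stopping there does not
    lengthen the chain. *)
Lemma disc_chain_cross (A S : set M) x y l : open A -> closed (A `|` S) ->
  disc_chain x y l -> A x -> ~ A y ->
  exists2 s, S s & exists2 k : R, k <= l & disc_chain x s k.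
Proof.
move=> oA cAS; elim=> [z|h a b z k hh ha hb hc IH] Aa nAz //.
have p0 := poincare_ge0 (nm_lt1 ha) (nm_lt1 hb).
have [Ab|nAb] := pselect (A (h b)).
  have [s Ss [j jk hj]] := IH Ab nAz.
  exists s => //; exists (poincare_distance a b + j); first by rewrite lerD2l.
  exact: disc_chain_cons.
have k0 := disc_chain_ge0 hc.
pose g (t : R) := h (segment a b t).
have [[t ht St]|nS] := pselect (exists2 t, 0 <= t <= 1 & S (g t)).
  have [j hj cj] := disc_chain_segment hh ha hb ht.
  by exists (g t) => //; exists j => //; lra.
(* If the image of the segment missed [S], its part in [A] would be both open and closed in it. *)
exfalso; apply: nAb.
have cg : {within `[0, 1], continuous g}.
  apply: continuous_in_subspaceT => t; rewrite inE/= in_itv/= => ht.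
  have st1 : `|segment a b t| < 1 by apply: lt1_nm; rewrite segment_lt1 ?nm_lt1.
  apply: (@continuous_comp _ _ _ (segment a b : R -> R[i]^o) h); last by case: (hh _ st1).
  rewrite /segment; apply: cvgD; first exact: cvg_cst.
  by apply: cvgMl; exact: real_complex_continuous.
have cI := connected_continuous_connected (@segment_connected R 0 1) cg.
set I := g @` _ in cI.
have I0 : I (h a) by exists 0; rewrite ?/g /segment /= ?in_itv/= ?lexx ?ler01// mul0r addr0.
have I1 : I (h b).
  by exists 1; rewrite ?/g /segment /= ?in_itv/= ?lexx ?ler01// mul1r subrKC.
suff : I `&` A = I by move/seteqP => [_ /(_ _ I1)[]].
apply: cI; first by exists (h a).
- by exists A.
- exists (A `|` S) => //; apply/seteqP; split => [m [Im Am]|m [[t ht <-] []]//].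
    by split => //; left.
  by move=> At; split => //; exists t.
  by move=> St; exfalso; apply: nS; exists t => //; move: ht; rewrite /= in_itv.
Qed.

Lemma kobayashi_continuous x : continuous (D x : M -> R).
Proof.
move=> y; have [c cM cy] := atlas_cover y.
have [r r0 [L L0 hL]] := kobayashi_chart cM cy.
have [_ D0 Ds Dt] := hD.
apply/cvgrPdist_le => e e0.
have L1 : 0 < L + 1 by lra.
have m0 : 0 < Num.min r (e / (L + 1)) by rewrite lt_min r0 divr_gt0.
apply: filterS (chart_ball_nbhs cy m0) => z [cz]; rewrite lt_min ltr_pdivlMr// => /andP[h1 h2].
have : D y z <= e.
  apply: (le_trans (hL _ _ cy cz _ h1)); first by rewrite subrr nm0.
  by rewrite nmB; apply: le_trans (ltW h2); rewrite mulrC ler_wpM2l ?nm_ge0//; lra.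
have := Dt x y z; have := Dt x z y; have := Ds y z.
by rewrite ler_norml; lra.
Qed.

Lemma kobayashi_ball_nbhs w e : 0 < e -> nbhs w [set y | D w y < e].
Proof.
move=> e0; have [_ D0 _ _] := hD.
apply: (@kobayashi_continuous w w [set x | x < e]).
by rewrite (D0 w w).2//; exact: lt_nbhsl.
Qed.

Lemma nbhs_kobayashi w (U : set M) : nbhs w U ->
  exists2 e : R, 0 < e & forall y, D w y < e -> U y.
Proof.
move=> Uw; have [c cM cw] := atlas_cover w.
have [r r0 hr] := chart_near cw Uw.
have [Dge D0 _ _] := hD.
pose B := [set v : 'C^q | nm (v - c w) <= r / 2].
pose A := [set y | dom c y /\ nm (c y - c w) < r / 2].
pose S := chart_inv c @` [set v : 'C^q | nm (v - c w) = r / 2].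
have hB v : B v -> [/\ dom c (chart_inv c v), c (chart_inv c v) = v & U (chart_inv c v)].
  by move=> Bv; apply: hr; rewrite /B /= in Bv; lra.
have cont (K : set 'C^q) : K `<=` B -> {within K, continuous (chart_inv c)}.
  move=> KB; apply: continuous_in_subspaceT => v; rewrite inE => /KB/hB[h1 h2 _].
  by rewrite -h2; exact: chart_inv_continuous_at.
have AS : A `|` S = chart_inv c @` B.
  apply/seteqP; split=> [y [[cy hy]|[v hv <-]]|_ [v Bv <-]].
  - by exists (c y); [exact: ltW|rewrite chart_mapK].
  - by exists v => //; rewrite /B /= hv.
  - have [h1 h2 _] := hB _ Bv; have [E|nE] := eqVneq (nm (v - c w)) (r / 2).
      by right; exists v.
    by left; split => //; rewrite h2 lt_neqAle nE.
have oA : open A.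
  rewrite openE => y [cy hy]; rewrite /interior.
  have d0 : 0 < r / 2 - nm (c y - c w) by lra.
  apply: filterS (chart_ball_nbhs cy d0) => z [cz hz]; split => //.
  have := nmD (c z - c y) (c y - c w); rewrite addrA subrK; lra.
have cB : compact B by exact: compact_rV_ball.
(* The closed coordinate ball is compact, hence closed in the Hausdorff space M: this excludes limit
   points outside the domain of the chart. *)
have cAS : closed (A `|` S).
  rewrite AS; apply: compact_closed; first exact: manifold_hausdorff.
  by apply: continuous_compact => //; exact: cont.
have cS : compact S.
  have SB : [set v : 'C^q | nm (v - c w) = r / 2] `<=` B by move=> v /= E; rewrite /B /= E.
  apply: continuous_compact; first exact: cont.
  apply: (subclosed_compact _ cB) => //.
  have -> : [set v : 'C^q | nm (v - c w) = r / 2] =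
    (fun v : 'C^q => @nm R 'C^q (v - c w)) @^-1` [set r / 2] by [].
  apply: closed_comp; last exact: closed_eq.
  move=> v _; apply: (@continuous_comp _ _ _ (fun v : 'C^q => v - c w)).
    move=> X /nbhs_nm[e e0 h]; apply/nbhs_nm; exists e => // u hu.
    by apply: h; rewrite opprB addrA subrK.
  exact: nm_continuous.
have cDS : closed (D w @` S).
  apply: compact_closed; first exact: Rhausdorff.
  apply: continuous_compact => //; apply: continuous_subspaceT; exact: kobayashi_continuous.
have n0 : (~` (D w @` S)) 0.
  move=> [_ [v hv <-]] /D0 E; have [|h1 h2 _] := hB v; first by rewrite /B /= hv.
  by move: hv => /=; rewrite -h2 -E subrr nm0; lra.
(* Definiteness of the distance excludes 0 from its values on the sphere, and compactness turns this
   into a gap [e]: a chain shorter than [e] cannot reach the sphere. *)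
have /nbhs_ballP[e /= e0 he] : nbhs 0 (~` (D w @` S)).
  by apply: open_nbhs_nbhs; split => //; exact: closed_openC.
exists e => // y hy.
have Aw : A w by split => //; rewrite subrr nm0 divr_gt0.
have [Ay|nAy] := pselect (A y).
  have [cy hcy] := Ay; have [] := hB (c y); first exact: ltW.
  by rewrite chart_mapK.
have [l le hc] := kobayashi_lt hy.
have [s Ss [k kl hk]] := disc_chain_cross oA cAS hc Aw nAy.
exfalso; apply: (he (D w s)); last by exists s.
have := kobayashi_le hk; rewrite /ball/= sub0r normrN ger0_norm//; lra.
Qed.

End distance.
End manifold.

(** * Chernoff products of holomorphic maps *)

Section lipschitz.
Context {R : realType}.
Local Notation C := R[i].
Local Notation "''C^' n" := 'rV[R[i]^o]_n (at level 8, n at level 2).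
Implicit Types (e s r t B : R).

(** Cauchy's estimate is applied on the complex line through the two points, and the bound on the
    derivative is carried along the segment by [cderiv_lip]. *)
Lemma holomorphic_lip p q (g : 'C^p -> 'C^q) (x : 'C^p) r B (u v : 'C^p) : 0 < r ->
  (forall u : 'C^p, nm u < r -> differentiable g (x + u)) ->
  (forall u : 'C^p, nm u < r -> nm (g (x + u)) <= B) ->
  nm u < r / 4 -> nm v < r / 4 ->
  nm (g (x + v) - g (x + u)) <= 16 * B / r * nm (v - u).
Proof.
move=> r0 hd hB hu hv.
have B0 : 0 <= B by apply: (le_trans (nm_ge0 (g (x + 0)))); rewrite hB// nm0.
have [->|nuv] := eqVneq v u; first by rewrite !subrr !nm0 mulr0.
have d0 : 0 < nm (v - u) by rewrite nm_gt0 subr_eq0.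
have d1 : nm (v - u) < r / 2 by have := nmD v (- u); rewrite nmN; lra.
set d := nm (v - u) in d0 d1 *.
apply: nm_row_le.
  by rewrite mulr_ge0 ?nm_ge0// divr_ge0 ?mulr_ge0// ltW.
move=> j; rewrite !mxE.
pose y := x + u; pose phi (z : C) : C := g (y + z *: (v - u)) 0 j.
(* The line stays in the ball of radius [r] for parameters up to [rho], because [u] has norm below
   [r / 4]. As [rho] exceeds 3/2, discs of radius [rho / 3] about points of [0, 1] fit, whence
   [4 * B / (rho / 3) = 16 * B / r * d]. *)
pose rho := 3 * r / 4 / d.
have rho1 : 1 + rho / 3 < rho.
  have : 3 / 2 < rho by rewrite /rho ltr_pdivlMr//; lra.
  lra.
have rd : rho * d = 3 * r / 4 by rewrite /rho divfK// gt_eqF.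
have ins z : nm z < rho -> nm (u + z *: (v - u)) < r.
  move=> hz; apply: (le_lt_trans (nmD _ _)); rewrite nmZ -/d.
  by move: hz; rewrite -(ltr_pM2r d0) rd; lra.
have K0 : 0 <= 16 * B / r * d by rewrite mulr_ge0 ?nm_ge0// divr_ge0 ?mulr_ge0// ltW.
have := @cderiv_lip R phi 0 1 (16 * B / r * d) K0.
rewrite subr0 nm1 mulr1 /phi scale1r scale0r addr0 /y.
rewrite -[x + u + (v - u)]addrA subrKC; apply => t /andP[t0 t1].
rewrite add0r mulr1.
have der z : nm z < rho -> cderiv (fun z => g (x + u + z *: (v - u)) 0 j) z
   ('d g (x + u + z *: (v - u)) (v - u) 0 j).
  by move=> /ins hz; apply: slice_cderiv; rewrite -addrA; exact: hd.
have near z : nm (z - t%:C) < rho / 3 -> nm z < rho.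
  move=> hz; have := nmD (z - t%:C) t%:C; rewrite subrK nmC ger0_norm//.
  clear -hz t1 rho1; lra.
have tn : nm (t%:C : C) < rho by apply: near; rewrite subrr nm0; clear -rho1; lra.
exists ('d g (x + u + t%:C *: (v - u)) (v - u) 0 j); first exact: der.
have -> : 16 * B / r * d = 4 * B / (rho / 3) by rewrite /rho; field; rewrite !gt_eqF.
apply: (cauchy_estimate _ _ _ (der _ tn)).
- by clear -rho1 d0 r0; rewrite /rho !divr_gt0// mulr_gt0.
- by move=> z /near hz; eexists; exact: der.
- move=> z /near/ins hz; apply: (le_trans (nm_coord _ _)); rewrite -addrA; exact: hB.
Qed.

End lipschitz.

Section consistency.
Context {R : realType} {q : nat} (M : complex_manifold R q).
Variables (H : holomorphic_vector_field M) (f : R -> M -> M).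
Local Notation C := R[i].
Local Notation "''C^' n" := 'rV[R[i]^o]_n (at level 8, n at level 2).
Implicit Types (c : chart R q M) (x y z w : M) (e r s t h l : R).

Hypothesis f_tangent : forall w : M, tangent_near H f w.

Lemma field_continuous c w e : atlas M c -> dom c w -> 0 < e ->
  exists2 r : R, 0 < r & forall y, dom c y -> nm (c y - c w) < r ->
    nm (H c y - H c w) <= e.
Proof.
move=> cM cw e0; have := differentiable_continuous (vf_holomorphic H cM cw).
move=> /cvgrPdist_le/(_ e%:C); rewrite ltcR e0 => /(_ isT).
move=> /(@nbhs_nm R 'C^q)[r r0 h]; exists r => // y cy hy.
by have := h _ hy; rewrite /= !chart_mapK// nm_le_norm nmB.
Qed.

(** Each step is compared with the field frozen at the starting point [y]: half of the error [h * e]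
    comes from the tangency condition, the other half from the Lipschitz continuity of [H] over the
    small distance travelled. *)
Lemma tangent_consistent w : exists2 c, atlas M c /\ dom c w &
  exists2 r : R, 0 < r & exists2 B : R, 0 <= B &
  (forall y, dom c y -> nm (c y - c w) < r -> nm (H c y) <= B) /\
  forall e, 0 < e -> exists2 s : R, 0 < s & forall h j y, 0 < h < s -> j%:R * h < s ->
    dom c y -> nm (c y - c w) < r ->
    dom c (iter j (f h) y) /\
    nm (c (iter j (f h) y) - c y - (j%:R * h)%:C *: H c y) <= j%:R * h * e.
Proof.
have [c [cM cw] [V [wV Vc] hV]] := f_tangent w; exists c => //.
have [r1 r10 hr1] := chart_near cw wV.
have [r2 r20 hr2] := field_continuous cM cw ltr01.
pose B := 1 + nm (H c w); pose r := Num.min r1 r2.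
have B1 : 1 <= B by rewrite /B lerDl nm_ge0.
have r0 : 0 < r by rewrite lt_min r10.
have rr1 : r <= r1 by rewrite ge_min lexx.
have rr2 : r <= r2 by rewrite ge_min lexx orbT.
have HB y : dom c y -> nm (c y - c w) < r -> nm (H c y) <= B.
  move=> cy hy; have := hr2 y cy (lt_le_trans hy rr2).
  by have := nmD (H c y - H c w) (H c w); rewrite subrK /B; lra.
have inV y : dom c y -> nm (c y - c w) < r -> V y.
  by move=> cy hy; have [_ _] := hr1 _ (lt_le_trans hy rr1); rewrite chart_mapK.
pose L := 16 * B / r.
have L0 : 0 <= L by rewrite divr_ge0 ?mulr_ge0//; lra.
have lip y x : dom c y -> nm (c y - c w) < r / 4 -> dom c x -> nm (c x - c w) < r / 4 ->
    nm (H c x - H c y) <= L * nm (c x - c y).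
  move=> cy hy cx hx; pose g := H c \o chart_inv c.
  have ball (u : 'C^q) : nm u < r -> dom c (chart_inv c (c w + u)) /\
      c (chart_inv c (c w + u)) = c w + u.
    move=> hu; have hcu : nm (c w + u - c w) < r1.
      by rewrite addrAC subrr add0r (lt_le_trans hu).
    by have [] := hr1 _ hcu.
  have := @holomorphic_lip R q q g (c w) r B (c y - c w) (c x - c w) r0.
  rewrite !subrKC /g /= !chart_mapK// opprB addrA subrK; apply => //.
    by move=> u /ball[h1 h2]; rewrite -[X in differentiable _ X]h2; exact: vf_holomorphic.
  by move=> u hu; have [h1 h2] := ball u hu; apply: HB => //; rewrite h2 addrAC subrr add0r.
exists (r / 8); first by rewrite divr_gt0.
exists B; first lra.
split=> [y cy hy|]; first by apply: HB => //; lra.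
(* Capping [e] at 1 keeps the displacement below [j%:R * h * (B + 1)], which confines the orbit to
   the ball where the Lipschitz bound holds. *)
move=> e0' e0'0; pose e := Num.min e0' 1.
have e0 : 0 < e by rewrite lt_min e0'0 ltr01.
have e1 : e <= 1 by rewrite ge_min lexx orbT.
have ee : e <= e0' by rewrite ge_min lexx.
have e20 : 0 < e / 2 by lra.
have [s1 /= s10 hs1] := hV _ e20.
have LB0 : 0 <= L * (B + 1) by apply: mulr_ge0 => //; clear -B1; lra.
have LB : 0 < L * (B + 1) + 1 by clear -LB0; lra.
pose s := Num.min s1 (Num.min (r / 8 / (B + 1)) (e / 2 / (L * (B + 1) + 1))).
have s0 : 0 < s by rewrite !lt_min s10 !divr_gt0//; lra.
have ss1 : s <= s1 by rewrite ge_min lexx.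
have sr : s * (B + 1) <= r / 8.
  by rewrite -ler_pdivlMr; [rewrite !ge_min lexx orbT|lra].
have se : s * (L * (B + 1) + 1) <= e / 2.
  by rewrite -ler_pdivlMr// !ge_min lexx !orbT.
exists s => // h j y /andP[h0 hs] js cy hy.
clearbody s.
suff : dom c (iter j (f h) y) /\
    nm (c (iter j (f h) y) - c y - (j%:R * h)%:C *: H c y) <= j%:R * h * e.
  move=> [h1 h2]; split => //; apply: (le_trans h2); apply: ler_wpM2l => //.
  by rewrite mulr_ge0// ltW.
have Hy : nm (H c y) <= B by apply: HB => //; lra.
elim: j js => [|j IH] js.
  by rewrite !mul0r scale0r subr0 subrr nm0.
have jS : j.+1%:R * h = j%:R * h + h by rewrite -natr1 mulrDl mul1r.
have jh0 : 0 <= j%:R * h by rewrite mulr_ge0// ltW.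
have js' : j%:R * h < s by move: js; rewrite jS; lra.
have [cx hx] := IH js'.
rewrite /=; set x := iter j (f h) y in cx hx *.
have dx : nm (c x - c y) <= j%:R * h * (B + 1).
  have := nmD (c x - c y - (j%:R * h)%:C *: H c y) ((j%:R * h)%:C *: H c y).
  rewrite subrK nmZ nmC (ger0_norm jh0).
  have := ler_wpM2l jh0 Hy; have := ler_wpM2l jh0 e1.
  clear -hx; lra.
have sB : j%:R * h * (B + 1) <= s * (B + 1).
  by apply: ler_wpM2r; [lra|exact: ltW].
have xw : nm (c x - c w) < r / 4.
  have := nmD (c x - c y) (c y - c w); rewrite addrA subrK; clear -dx hy sB sr r0; lra.
have yw : nm (c y - c w) < r / 4 by clear -hy r0; lra.
have Vx : V x by apply: inV => //; clear -xw r0; lra.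
have := hs1 h; rewrite /ball/= sub0r normrN gtr0_norm// => /(_ (lt_le_trans hs ss1) h0 x Vx).
rewrite nm_lt_norm => -[cfx hfx]; split => //.
have dH := lip y x cy yw cx xw.
have {}dH : nm (H c x - H c y) <= e / 2.
  apply: (le_trans dH); apply: (@le_trans _ _ (L * (s * (B + 1)))).
    by apply: ler_wpM2l => //; exact: le_trans sB.
  by clear -se s0; lra.
(* The accumulated error, the error of the new step, and the drift of the field between [y] and
   [x]. *)
have E : c (f h x) - c y - (j.+1%:R * h)%:C *: H c y =
  (c x - c y - (j%:R * h)%:C *: H c y) +
  h%:C *: ((h^-1)%:C *: (c (f h x) - c x) - H c x) + h%:C *: (H c x - H c y).
  rewrite scalerBr scalerA -rmorphM divff ?gt_eqF// rmorph1 scale1r.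
  have -> : (j.+1%:R * h)%:C = (j%:R * h)%:C + h%:C :> C by rewrite jS rmorphD.
  move: (c (f h x)) (c x) (c y) (H c y) (H c x) (h%:C) ((j%:R * h)%:C) => a b a' u v k k'.
  by apply/rowP => i; rewrite !mxE; ring.
rewrite E; apply: (le_trans (nmD _ _)); rewrite nmZ nmC gtr0_norm//.
apply: (le_trans (lerD (nmD _ _) (lexx _))); rewrite nmZ nmC gtr0_norm// jS.
have := ler_wpM2l (ltW h0) dH; have := ler_wpM2l (ltW h0) (ltW hfx).
clear -hx; lra.
Qed.

End consistency.

(** * Velocities of curves in coordinates *)

Section curves.
Context {R : realType}.
Local Notation C := R[i].
Local Notation "''C^' n" := 'rV[R[i]^o]_n (at level 8, n at level 2).
Implicit Types (e s t u : R).

(** The derivative relative to the half-line of nonnegative times, stated without a quotient so that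
    [u = t] is harmless. *)
Definition velocity n (g : R -> 'C^n) t (v : 'C^n) := forall e, 0 < e ->
  exists2 s : R, 0 < s & forall u, 0 <= u -> `|u - t| < s ->
    nm (g u - g t - (u - t)%:C *: v) <= e * `|u - t|.

Lemma velocity_cvg n (g : R -> 'C^n) t (v : 'C^n) : velocity g t v <->
  ((u - t)^-1)%:C *: (g u - g t) @[u --> within [set u | 0 <= u] t^'] --> v.
Proof.
have E u : u != t -> nm (v - ((u - t)^-1)%:C *: (g u - g t)) * `|u - t| =
    nm (g u - g t - (u - t)%:C *: v).
  move=> ut; rewrite nmB -nmC mulrC -nmZ scalerBr scalerA -rmorphM divff ?subr_eq0//.
  by rewrite rmorph1 scale1r.
split=> [h|].
  apply/cvgrPdist_le => e e0.
  have eE : e = (complex.Re e)%:C by rewrite RRe_real// gtr0_real.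
  have e0' : 0 < complex.Re e by rewrite -ltcR -eE.
  have [s s0 hs] := h _ e0'.
  apply/nbhs_ballP; exists s => // u; rewrite /ball/= distrC => us ut u0.
  rewrite eE nm_le_norm -(ler_pM2r (x := `|u - t|)) ?normr_gt0 ?subr_eq0// E//.
  exact: hs.
move=> /cvgrPdist_le h e e0.
have e0' : 0 < e%:C by rewrite ltcR.
have /nbhs_ballP[s /= s0 hs] := h _ e0'.
exists s => // u u0 us; have [->|ut] := eqVneq u t.
  by rewrite !subrr scale0r subrr nm0 normr0 mulr0.
rewrite -E//; apply: ler_wpM2r => //.
by have := hs u; rewrite /ball/= distrC => /(_ us ut u0); rewrite nm_le_norm.
Qed.

Lemma velocity_continuous n (g : R -> 'C^n) t v : velocity g t v ->
  forall e, 0 < e -> exists2 s : R, 0 < s & forall u, 0 <= u -> `|u - t| < s ->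
    nm (g u - g t) <= e.
Proof.
move=> h e e0; have [s s0 hs] := h 1 ltr01.
have v0 : 0 < 1 + nm v by rewrite ltr_pwDl// nm_ge0.
exists (Num.min s (e / (1 + nm v))); first by rewrite lt_min s0 divr_gt0.
move=> u u0; rewrite lt_min => /andP[h1]; rewrite ltr_pdivlMr// => h2.
have := hs u u0 h1; have := nmD (g u - g t - (u - t)%:C *: v) ((u - t)%:C *: v).
rewrite subrK nmZ nmC; lra.
Qed.

(** Serves to change charts: the estimates come in one chart per point, whereas [cauchy_solution]
    quantifies over all charts. *)
Lemma velocity_comp n p (g : R -> 'C^n) (G : 'C^n -> 'C^p) t v :
  velocity g t v -> differentiable G (g t) -> velocity (G \o g) t ('d G (g t) v).
Proof.
move=> hg dG e e0.
pose L := 'd G (g t).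
have LZ (a : C) w : L (a *: w) = a *: L w by exact: linearZ.
have LB a b : L (a - b) = L a - L b by exact: linearB.
have [K K0 hK] : exists2 K : R, 0 < K & forall w : 'C^n, nm (L w) <= K * nm w.
  have cL : {for 0, continuous L} by exact: diff_continuous.
  have L0 : L 0 = 0 by exact: linear0.
  have hA : nbhs (L 0) [set y : 'C^p | nm (y - L 0) < 1] by apply/nbhs_nm; exists 1.
  have [r r0 hr] := (@nbhs_nm R 'C^n _ _).1 (cL _ hA).
  exists (2 / r); first by rewrite divr_gt0.
  move=> w; have [->|w0] := eqVneq w 0; first by rewrite linear0 !nm0 mulr0.
  have nw : 0 < nm w by rewrite nm_gt0.
  pose k := r / 2 / nm w; have k0 : 0 < k by rewrite !divr_gt0.
  have := hr (k%:C *: w); rewrite subr0 nmZ nmC gtr0_norm// divfK ?gt_eqF//.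
  have r2 : r / 2 < r by lra.
  move=> /(_ r2)/ltW; rewrite /= L0 subr0 LZ nmZ nmC gtr0_norm// -ler_pdivlMl// mulr1 => /le_trans; apply.
  by rewrite /k le_eqVlt; apply/orP; left; apply/eqP; field; rewrite !gt_eqF.
pose V := 1 + nm v; have V0 : 0 < V by rewrite ltr_pwDl// nm_ge0.
have eV : 0 < e / 2 / V by rewrite !divr_gt0.
have eK : 0 < Num.min 1 (e / 2 / K) by rewrite lt_min ltr01 !divr_gt0.
have [s1 s10 hs1] := differentiable_eps dG eV.
have [s2 s20 hs2] := hg _ eK.
have [s3 s30 hs3] := velocity_continuous hg (e := s1 / 2) ltac:(lra).
exists (Num.min s2 s3); first by rewrite lt_min s20.
move=> u u0; rewrite lt_min => /andP[u2 u3].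
have {}hs2 := hs2 u u0 u2; have {}hs3 := hs3 u u0 u3.
have gs1 : nm (g u - g t) < s1 by lra.
have := hs1 _ gs1; rewrite subrKC => h1.
have d0 := normr_ge0 (u - t); set d := `|u - t| in d0 hs2 *.
have h2 : nm (g u - g t) <= V * d.
  have := nmD (g u - g t - (u - t)%:C *: v) ((u - t)%:C *: v).
  rewrite subrK nmZ nmC -/d => /le_trans; apply.
  rewrite /V mulrDl; apply: lerD; last by rewrite mulrC.
  by apply: (le_trans hs2); apply: ler_wpM2r => //; rewrite ge_min lexx.
have h3 : nm (L (g u - g t - (u - t)%:C *: v)) <= e / 2 * d.
  apply: (le_trans (hK _)); apply: (@le_trans _ _ (K * (e / 2 / K * d))).
    apply: ler_wpM2l; first exact: ltW.
    by apply: (le_trans hs2); apply: ler_wpM2r => //; rewrite ge_min lexx orbT.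
  by rewrite mulrA [K * _]mulrC divfK// gt_eqF.
have -> : (G \o g) u - (G \o g) t - (u - t)%:C *: 'd G (g t) v =
  (G (g u) - G (g t) - L (g u - g t)) + L (g u - g t - (u - t)%:C *: v).
  by rewrite [L (_ - _ *: _)]LB LZ addrA subrK.
apply: (le_trans (nmD _ _)).
have : e / 2 / V * nm (g u - g t) <= e / 2 * d.
  apply: (@le_trans _ _ (e / 2 / V * (V * d))); first by rewrite ler_wpM2l// ltW.
  by rewrite mulrA divfK// gt_eqF.
rewrite -/L in h1; lra.
Qed.

End curves.

(** * The limit flow, its velocity, and uniqueness of solutions *)

Section product_flow.
Context {R : realType} {q : nat} (M : complex_manifold R q).
Local Notation C := R[i].
Local Notation "''C^' n" := 'rV[R[i]^o]_n (at level 8, n at level 2).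
Implicit Types (c : chart R q M) (x y z w : M) (e r s t u h l : R).
Variables (H : holomorphic_vector_field M) (lambda : R) (f : R -> M -> M).
Hypothesis M_hyperbolic : complete_hyperbolic M.
Hypothesis lambda_gt0 : 0 < lambda.
Hypothesis f_holo : forall t : R, 0 <= t < lambda -> holomorphic_map (f t).
Hypothesis f_tangent : forall w : M, tangent_near H f w.

Local Notation D := (@kobayashi R q M).

Let hD : is_distance D. Proof. by case: M_hyperbolic. Qed.
Let D_ge0 x y : 0 <= D x y. Proof. by case: hD. Qed.
Let D_eq0 x y : D x y = 0 <-> x = y. Proof. by case: hD. Qed.
Let D_sym x y : D x y = D y x. Proof. by case: hD. Qed.
Let D_tri x y z : D x z <= D x y + D y z. Proof. by case: hD. Qed.
Let Dxx x : D x x = 0. Proof. exact/D_eq0. Qed.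

(** In the chart both products are [y] plus elapsed time times the same vector [H c y], up to small
    errors; [kobayashi_chart] converts the coordinate bound into the distance, at the cost of the
    factor [L]. *)
Lemma kobayashi_consistent w : exists2 rho : R, 0 < rho &
  exists2 K : R, 0 <= K & forall e, 0 < e -> exists2 s : R, 0 < s &
  forall h h' j j' y, 0 < h < s -> 0 < h' < s -> j%:R * h < s -> j'%:R * h' < s ->
    D w y < rho -> D (iter j (f h) y) (iter j' (f h') y) <=
      K * `|j%:R * h - j'%:R * h'| + e * (j%:R * h + j'%:R * h').
Proof.
have [c [cM cw] [r r0 [B B0 [HB hr]]]] := tangent_consistent f_tangent w.
have [r' r'0 [L L0 hL]] := kobayashi_chart hD cM cw.
have m0 : 0 < Num.min r (r' / 2) by rewrite lt_min r0 divr_gt0.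
have [rho rho0 hrho] := nbhs_kobayashi hD (chart_ball_nbhs cw m0).
exists rho => //; exists (L * B); first exact: mulr_ge0.
move=> e e0; pose e' := Num.min 1 (e / (L + 1)).
have L1 : 0 < L + 1 by lra.
have B1 : 0 < B + 1 by lra.
have e'0 : 0 < e' by rewrite lt_min ltr01 divr_gt0.
have e'1 : e' <= 1 by rewrite ge_min lexx.
have e'L : e' * (L + 1) <= e by rewrite -ler_pdivlMr// ge_min lexx orbT.
have Le' : L * e' <= e by lra.
have [s s0 hs] := hr _ e'0.
exists (Num.min s (r' / 2 / (B + 1))); first by rewrite lt_min s0 !divr_gt0.
move=> h h' j j' y; rewrite !lt_min !(ltr_pdivlMr _ _ B1).
move=> /andP[h0 /andP[h1 h2]] /andP[h'0 /andP[h'1 h'2]] /andP[j1 j2] /andP[j'1 j'2].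
move=> /hrho[cy]; rewrite lt_min => /andP[y1 y2].
have Hy := HB _ cy y1.
have far (g : R) n : 0 < g -> nm (c (iter n (f g) y) - c y - (n%:R * g)%:C *: H c y) <= n%:R * g * e' ->
    n%:R * g * (B + 1) < r' / 2 -> nm (c (iter n (f g) y) - c w) < r'.
  move=> g0 h3 h4; have ng : 0 <= n%:R * g by rewrite mulr_ge0// ltW.
  have := nmD (c (iter n (f g) y) - c y - (n%:R * g)%:C *: H c y) ((n%:R * g)%:C *: H c y).
  rewrite subrK nmZ nmC (ger0_norm ng).
  have := nmD (c (iter n (f g) y) - c y) (c y - c w); rewrite addrA subrK.
  have := ler_wpM2l ng Hy; have := ler_wpM2l ng e'1.
  lra.
have hh : 0 < h < s by rewrite h0.
have hh' : 0 < h' < s by rewrite h'0.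
have [cx hx] := hs h j y hh j1 cy y1.
have [cx' hx'] := hs h' j' y hh' j'1 cy y1.
have := hL _ _ cx cx' (far _ _ h0 hx j2) (far _ _ h'0 hx' j'2).
move=> /le_trans; apply.
set x := iter j _ _ in cx hx *; set x' := iter j' _ _ in cx' hx' *.
set a := j%:R * h in hx *; set a' := j'%:R * h' in hx' *.
have a0 : 0 <= a by rewrite mulr_ge0// ltW.
have a'0 : 0 <= a' by rewrite mulr_ge0// ltW.
clearbody x x' a a' e'.
have E : c x - c x' = (c x - c y - a%:C *: H c y) - (c x' - c y - a'%:C *: H c y)
    + (a - a')%:C *: H c y.
  rewrite rmorphB/=; move: (c x) (c x') (c y) (H c y) (a%:C) (a'%:C) => p p' o v k k'.
  by apply/rowP => i; rewrite !mxE; ring.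
have : nm (c x - c x') <= a * e' + a' * e' + `|a - a'| * B.
  rewrite E; apply: (le_trans (nmD _ _)); apply: lerD.
    by apply: (le_trans (nmD _ _)); rewrite nmN; exact: lerD.
  by rewrite nmZ nmC ler_wpM2l.
move=> /(ler_wpM2l L0) /le_trans; apply.
have -> : L * (a * e' + a' * e' + `|a - a'| * B) =
  L * B * `|a - a'| + L * e' * (a + a') by ring.
by rewrite lerD2l ler_wpM2r// addr_ge0.
Qed.

Lemma product_flow : exists X : R -> M -> M,
  [/\ forall t z, 0 <= t -> net_lim D f z t (X t z), forall z, X 0 z = z,
      forall t u z, 0 <= t -> 0 <= u -> X (t + u) z = X u (X t z),
      forall t x y, 0 <= t -> D (X t x) (X t y) <= D x y &
      forall z, exists2 K : R, 0 <= K &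
        forall t u, 0 <= t -> 0 <= u -> D (X (t + u) z) (X t z) <= K * u].
Proof.
apply: (product_flow_exists D_ge0 D_eq0 D_sym D_tri _ lambda_gt0 _ kobayashi_consistent).
  by case: M_hyperbolic.
move=> h x y /andP[h0 hl]; apply: kobayashi_nonexp => //.
by apply: f_holo; rewrite hl ltW.
Qed.

Section flow.
Variable X : R -> M -> M.
Hypothesis X_lim : forall t z, 0 <= t -> net_lim D f z t (X t z).
Hypothesis X0 : forall z, X 0 z = z.
Hypothesis X_add : forall t u z, 0 <= t -> 0 <= u -> X (t + u) z = X u (X t z).
Hypothesis X_nonexp : forall t x y, 0 <= t -> D (X t x) (X t y) <= D x y.
Hypothesis X_lip : forall z, exists2 K : R, 0 <= K &
  forall t u, 0 <= t -> 0 <= u -> D (X (t + u) z) (X t z) <= K * u.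

(** The estimate for the products survives in the limit. It is uniform in the starting point [y],
    which the left derivative of an orbit requires. *)
Lemma flow_estimate w : exists2 c, atlas M c /\ dom c w & exists2 r : R, 0 < r &
  forall e, 0 < e -> exists2 s : R, 0 < s & forall t y, 0 <= t < s ->
    dom c y -> nm (c y - c w) < r ->
    dom c (X t y) /\ nm (c (X t y) - c y - t%:C *: H c y) <= t * e.
Proof.
have [c [cM cw] [r r0 [B B0 [HB hr]]]] := tangent_consistent f_tangent w.
have [rho rho0 [K K0 hK]] := kobayashi_consistent w.
have [s1 s10 hs1] := hK 1 ltr01.
have [d d0 hd] := nbhs_kobayashi hD (dom_nbhs cw).
have m0 : 0 < Num.min rho (d / 2) by rewrite lt_min rho0 divr_gt0.
have [r2 r20 hr2] := chart_near cw (kobayashi_ball_nbhs hD w m0).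
exists c => //; exists (Num.min r r2); first by rewrite lt_min r0.
move=> e e0; have [s s0 hs] := hr _ e0.
have K1 : 0 < K + 1 by lra.
exists (Num.min (Num.min s s1) (d / 2 / (K + 1))); first by rewrite !lt_min s0 s10 !divr_gt0.
move=> t y /andP[t0]; rewrite !lt_min ltr_pdivlMr// => /andP[/andP[ts ts1] tK] cy /andP[y1 y2].
have [_ _] := hr2 _ y2; rewrite chart_mapK//= lt_min => /andP[wy1 wy2].
(* Coordinates of [X t y] make sense only once it is known to lie in the chart; hence a first bound
   in the distance, by comparison with the product of no factors. *)
have Xy : D (X t y) y <= (K + 1) * t.
  apply/ler_addgt0Pr => e2 e20; have [s3 s30 hs3] := X_lim y t0 e20.
  pose m := Num.min s1 s3; have m00 : 0 < m by rewrite lt_min s10.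
  have [m1 m2] : m <= s1 /\ m <= s3 by rewrite !ge_min !lexx orbT.
  have h0 : 0 < m / 2 by lra.
  have [k /andP[k1 k2]] := steps h0 t0.
  have hh1 : 0 < m / 2 < s1 by lra.
  have hh3 : 0 < m / 2 < s3 by lra.
  have kt : `|k%:R * (m / 2) - t| < s3 by rewrite ltr_norml; lra.
  have ks : k%:R * (m / 2) < s1 by lra.
  have z1 : 0%:R * (m / 2) < s1 by rewrite mul0r.
  have := hs1 _ _ k 0%N y hh1 hh1 ks z1 wy1; have := hs3 _ _ hh3 kt.
  rewrite mul0r subr0 addr0 mul1r /=.
  have kh0 : 0 <= k%:R * (m / 2) by rewrite mulr_ge0// ltW.
  rewrite (ger0_norm kh0).
  have := D_tri (X t y) (iter k (f (m / 2)) y) y; have := D_sym (X t y) (iter k (f (m / 2)) y).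
  have := ler_wpM2l (ltW K1) k2; lra.
have cX : dom c (X t y).
  apply: hd; have := D_tri w y (X t y); have := D_sym (X t y) y; lra.
split => //; apply/ler_addgt0Pr => e2 e20.
have e40 : 0 < e2 / 2 by lra.
have [d1 d10 hd1] := nbhs_kobayashi hD (chart_ball_nbhs cX e40).
have d20 : 0 < d1 / 2 by lra.
have [s3 s30 hs3] := X_lim y t0 d20.
have B1 : 0 < B + 1 by lra.
pose m := Num.min (Num.min s3 s) (e2 / 2 / (B + 1)).
have m00 : 0 < m by rewrite !lt_min s30 s0 !divr_gt0.
have [m1 m2 m3] : [/\ m <= s3, m <= s & m * (B + 1) <= e2 / 2].
  by rewrite -ler_pdivlMr// /m; split; rewrite !ge_min lexx ?orbT.
have h0 : 0 < m / 2 by lra.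
have [k /andP[k1 k2]] := steps h0 t0.
have hh3 : 0 < m / 2 < s3 by lra.
have hhs : 0 < m / 2 < s by lra.
have kt : `|k%:R * (m / 2) - t| < s3 by rewrite ltr_norml; lra.
have ks : k%:R * (m / 2) < s by lra.
have := hs3 _ _ hh3 kt; set x := iter k _ _ => xX.
have [|cx hx] := hd1 x; first by rewrite D_sym; lra.
have [_ hxy] := hs _ k y hhs ks cy y1; rewrite -/x in hxy.
set a := k%:R * (m / 2) in k1 k2 hxy.
clearbody x a.
have E : c (X t y) - c y - t%:C *: H c y = - (c x - c (X t y)) +
   (c x - c y - a%:C *: H c y) + (a - t)%:C *: H c y.
  rewrite rmorphB/=; move: (c x) (c (X t y)) (c y) (H c y) (a%:C) (t%:C) => p p' o v k' k''.
  by apply/rowP => i; rewrite !mxE; ring.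
rewrite E; apply: (le_trans (nmD _ _)); rewrite nmZ nmC.
have at' : `|a - t| <= m / 2 by rewrite ler_norml; lra.
have h5 : `|a - t| * nm (H c y) <= m / 2 * B.
  by apply: ler_pM => //; [exact: nm_ge0|exact: HB].
have := nmD (- (c x - c (X t y))) (c x - c y - a%:C *: H c y); rewrite nmN.
have := ler_wpM2r (ltW e0) k2; lra.
Qed.

Lemma flow_continuous z t (U : set M) : 0 <= t -> nbhs (X t z) U ->
  exists2 s : R, 0 < s & forall u, 0 <= u -> `|u - t| < s -> U (X u z).
Proof.
move=> t0 /(nbhs_kobayashi hD)[e e0 he]; have [K K0 hK] := X_lip z.
have K1 : 0 < K + 1 by lra.
exists (e / (K + 1)); first by rewrite divr_gt0.
move=> u u0; rewrite ltr_pdivlMr// => ut; apply: he.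
have [tu|ut'] := leP t u.
  have ut0 : 0 <= u - t by lra.
  have := hK t (u - t) t0 ut0; rewrite subrKC D_sym.
  by move: ut; rewrite ger0_norm//; lra.
have tu0 : 0 <= t - u by lra.
have := hK u (t - u) u0 tu0; rewrite subrKC.
by move: ut; rewrite distrC ger0_norm//; lra.
Qed.

Lemma flow_velocity z t c : 0 <= t -> atlas M c -> dom c (X t z) ->
  velocity (fun u => c (X u z)) t (H c (X t z)).
Proof.
move=> t0 c'M c'X; have [c0 [cM cX] [r r0 hr]] := flow_estimate (X t z).
have hc0 : velocity (fun u => c0 (X u z)) t (H c0 (X t z)).
  move=> e e0; have e20 : 0 < e / 2 by lra.
  have [s s0 hs] := hr _ e20; have [r1 r10 hr1] := field_continuous H cM cX e20.
  have m0 : 0 < Num.min r r1 by rewrite lt_min r0.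
  have [s2 s20 hs2] := flow_continuous t0 (chart_ball_nbhs cX m0).
  exists (Num.min s s2); first by rewrite lt_min s0.
  move=> u u0; rewrite lt_min => /andP[us us2].
  have [tu|ut] := leP t u.
    have ut0 : 0 <= u - t by lra.
    rewrite ger0_norm// in us *.
    have [||_] := hs (u - t) (X t z) _ cX; rewrite ?ut0 ?subrr ?nm0//.
    rewrite -X_add// subrKC => /le_trans; apply; rewrite mulrC ler_wpM2r//; lra.
  (* To the left of [t] the flow runs from the moving point [X u z] to [X t z], so the field appears
     at [X u z] and is brought to [X t z] by continuity. *)
  have tu0 : 0 <= t - u by lra.
  rewrite distrC ger0_norm// in us *.
  have [cy] := hs2 u u0 us2; rewrite lt_min => /andP[y1 y2].
  have [|_] := hs (t - u) (X u z) _ cy y1; first by rewrite tu0.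
  rewrite -X_add// subrKC => h1; have h2 := hr1 _ cy y2.
  have -> : c0 (X u z) - c0 (X t z) - (u - t)%:C *: H c0 (X t z) =
    - (c0 (X t z) - c0 (X u z) - (t - u)%:C *: H c0 (X u z)) +
    - ((t - u)%:C *: (H c0 (X u z) - H c0 (X t z))).
    have -> : (u - t)%:C = - (t - u)%:C :> C by rewrite -rmorphN opprB.
    move: (c0 _) (c0 _) (H c0 _) (H c0 _) (_%:C) => p p' v v' k.
    by apply/rowP => i; rewrite !mxE; ring.
  apply: (le_trans (nmD _ _)); rewrite !nmN nmZ nmC (ger0_norm tu0).
  have := ler_wpM2l tu0 h2; lra.
have [d1 _] := atlas_compatible cM c'M cX c'X.
have := velocity_comp hc0 d1; rewrite -(vf_change H cM c'M cX c'X) => hv.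
move=> e e0; have [s s0 hs] := hv e e0.
have [s2 s20 hs2] := flow_continuous t0 (dom_nbhs cX).
exists (Num.min s s2); first by rewrite lt_min s0.
move=> u u0; rewrite lt_min => /andP[us us2].
have := hs u u0 us; rewrite /transition /= !chart_mapK//.
exact: hs2.
Qed.

Lemma flow_solution z : cauchy_solution H z (X^~ z).
Proof.
split=> [||t c t0 cM cX].
- exact: X0.
- apply/subspace_continuousP => t /= t0 U /(flow_continuous t0)[s s0 hs].
  apply/nbhs_ballP; exists s => // u; rewrite /ball/= distrC => us u0; exact: hs.
- exact/velocity_cvg/flow_velocity.
Qed.

(** The flow started from [z t] at time [t] has the same velocity as [z], so the two separate by
    [o(u - t)], while the flow does not increase the distance from [z t] to [X t z0]. Continuity
    gives the left-hand condition of [dini_le]. *)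
Lemma solution_unique z0 (z : R -> M) : cauchy_solution H z0 z ->
  forall T : R, 0 <= T -> z T = X T z0.
Proof.
move=> [z00 zc zd] T T0.
have zcont t (U : set M) : 0 <= t -> nbhs (z t) U ->
    exists2 s : R, 0 < s & forall u, 0 <= u -> `|u - t| < s -> U (z u).
  move=> t0 Uz; have /subspace_continuousP/(_ t t0) := zc.
  move=> /(_ _ Uz)/nbhs_ballP[s /= s0 hs]; exists s => // u u0 ut.
  by apply: hs => //; rewrite /ball/= distrC.
suff : D (z T) (X T z0) <= 0.
  move=> h; apply/D_eq0/eqP; rewrite eq_le h; exact: D_ge0.
have := @dini_le R (fun t => D (z t) (X t z0)) 0 T 0 T0 (lexx 0).
rewrite z00 X0 Dxx add0r mul0r; apply.
- move=> t /andP[t0 tT] e e0; set w := z t.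
  have [c [cM cw] [r r0 hr]] := flow_estimate w.
  have [r' r'0 [L L0 hL]] := kobayashi_chart hD cM cw.
  have L1 : 0 < 2 * (L + 1) by lra.
  have e'0 : 0 < e / (2 * (L + 1)) by rewrite divr_gt0.
  have e'L : e / (2 * (L + 1)) * (2 * L) <= e.
    rewrite mulrAC ler_pdivrMr// ler_wpM2l ?ltW//; lra.
  set e' := e / _ in e'0 e'L.
  have [s s0 hs] := hr _ e'0.
  have /velocity_cvg zv := zd t c t0 cM cw.
  have [s1 s10 hs1] := zv _ e'0.
  have [s2 s20 hs2] := zcont t _ t0 (chart_ball_nbhs cw r'0).
  have [s3 s30 hs3] : exists2 s : R, 0 < s & forall u, 0 <= u -> `|u - 0| < s ->
      [set y | dom c y /\ nm (c y - c w) < r'] (X u w).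
    by apply: flow_continuous => //; rewrite X0; exact: chart_ball_nbhs.
  exists (Num.min (Num.min s s1) (Num.min s2 s3)); first by rewrite !lt_min s0 s10 s20.
  move=> u /andP[tu]; rewrite -ltrBlDl !lt_min => /andP[/andP[u1 u2] /andP[u3 u4]] uT.
  have u0 : 0 <= u by lra.
  have ut0 : 0 <= u - t by lra.
  have nut : `|u - t| = u - t by rewrite ger0_norm.
  have [cz hz] : [set y | dom c y /\ nm (c y - c w) < r'] (z u).
    by apply: hs2 => //; rewrite nut.
  have [cX hX] := hs3 (u - t) ut0 ltac:(by rewrite subr0 nut).
  have ww : nm (c w - c w) < r by rewrite subrr nm0.
  have [_ h1] := hs (u - t) w ltac:(by rewrite ut0) cw ww.
  have h2 := hs1 u u0 ltac:(by rewrite nut); rewrite nut in h2.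
  have h3 : nm (c (z u) - c (X (u - t) w)) <= 2 * e' * (u - t).
    have -> : c (z u) - c (X (u - t) w) = (c (z u) - c (z t) - (u - t)%:C *: H c (z t)) -
      (c (X (u - t) w) - c w - (u - t)%:C *: H c w).
      by rewrite -/w; apply/rowP => i; rewrite !mxE; ring.
    by apply: (le_trans (nmD _ _)); rewrite nmN; lra.
  have h4 := hL _ _ cz cX hz hX.
  have h5 : D (X (u - t) w) (X u z0) <= D (z t) (X t z0).
    have -> : X u z0 = X (u - t) (X t z0) by rewrite -X_add// subrKC.
    exact: X_nonexp.
  have := D_tri (z u) (X (u - t) w) (X u z0).
  have h6 := ler_wpM2l L0 h3; have h7 := ler_wpM2r ut0 e'L.
  rewrite add0r; lra.
- move=> t /andP[t0 tT] e e0; have e20 : 0 < e / 2 by lra.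
  have [s s0 hs] := zcont t _ (ltW t0) (kobayashi_ball_nbhs hD (z t) e20).
  have [s' s'0 hs'] := flow_continuous (ltW t0) (kobayashi_ball_nbhs hD (X t z0) e20).
  exists (Num.min s s'); first by rewrite lt_min s0.
  move=> u /andP[us ut] u0.
  have : t - u < Num.min s s' by lra.
  have nut : `|u - t| = t - u by rewrite distrC ger0_norm//; lra.
  rewrite lt_min -nut => /andP[h1 h2].
  have := hs _ u0 h1; have := hs' _ u0 h2 => /=.
  have := D_tri (z t) (z u) (X t z0); have := D_tri (z u) (X u z0) (X t z0).
  have := D_sym (X t z0) (X u z0); lra.
Qed.

End flow.
End product_flow.

(** * Holomorphy of the flow and convergence on compacta *)

Section holomorphic_maps.
Context {R : realType} {q : nat} (M : complex_manifold R q).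

Lemma holomorphic_id : holomorphic_map (id : M -> M).
Proof.
split=> [x|c c' p cM c'M cp c'p]; first exact: cvg_id.
exact: (atlas_compatible cM c'M cp c'p).1.
Qed.

Lemma holomorphic_comp (f g : M -> M) :
  holomorphic_map f -> holomorphic_map g -> holomorphic_map (g \o f).
Proof.
move=> [cf df] [cg dg]; split=> [x|c c' p cM c'M cp c'gp].
  by apply: continuous_comp; [exact: cf|exact: cg].
have [c1 c1M c1f] := atlas_cover (f p).
have d1 := df c c1 p cM c1M cp c1f.
have d2 := dg c1 c' (f p) c1M c'M c1f c'gp.
have E : c1 (f p) = (c1 \o f \o chart_inv c) (c p) by rewrite /= chart_mapK.
rewrite E in d2.
apply: (near_differentiable (differentiable_comp d1 d2)).
have cfi : {for c p, continuous (f \o chart_inv c)}.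
  apply: continuous_comp; first exact: chart_inv_continuous_at.
  exact: cf.
have : \forall y \near c p, dom c1 (f (chart_inv c y)).
  by apply: cfi; rewrite /= chart_mapK//; exact: dom_nbhs.
by apply: filterS => y cy /=; rewrite chart_mapK.
Qed.

Lemma holomorphic_iter (f : M -> M) n :
  holomorphic_map f -> holomorphic_map (iter n f).
Proof.
move=> hf; elim: n => [|n IH]; first exact: holomorphic_id.
exact: (holomorphic_comp IH hf).
Qed.

End holomorphic_maps.

Lemma near_div_natS (R : realType) (t s : R) : 0 <= t -> 0 < s ->
  \forall m \near \oo, t / m.+1%:R < s.
Proof.
move=> t0 s0; have t1 : 0 < t + 1 by lra.
apply: filterS (near_infty_natSinv_lt (PosNum (divr_gt0 s0 t1))) => m /=.
rewrite ltr_pdivlMr// => h; apply: le_lt_trans h.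
by rewrite mulrC ler_wpM2l ?invr_ge0//; lra.
Qed.

Section flow_holomorphic.
Context {R : realType} {q : nat} (M : complex_manifold R q).
Local Notation C := R[i].
Local Notation "''C^' n" := 'rV[R[i]^o]_n (at level 8, n at level 2).
Local Notation D := (@kobayashi R q M).
Variables (lambda : R) (f : R -> M -> M) (X : R -> M -> M).
Hypothesis hD : is_distance D.
Hypothesis lambda_gt0 : 0 < lambda.
Hypothesis f_holo : forall t : R, 0 <= t < lambda -> holomorphic_map (f t).
Hypothesis f_0 : f 0 =1 id.
Hypothesis X_lim : forall (t : R) z, 0 <= t -> net_lim D f z t (X t z).
Hypothesis X0 : forall z, X 0 z = z.
Hypothesis X_nonexp : forall (t : R) x y, 0 <= t -> D (X t x) (X t y) <= D x y.

(** Indices are shifted to [m.+1] to avoid [t / 0]. At [t = 0] the step is 0, outside the range of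
    [net_lim], and [f_0] is used instead. *)
Lemma product_cvg (t e : R) z : 0 <= t -> 0 < e ->
  \forall m \near \oo, D (iter m.+1 (f (t / m.+1%:R)) z) (X t z) <= e.
Proof.
rewrite le_eqVlt => /predU1P[<- e0|t0 e0].
  near=> m; rewrite mul0r X0; suff -> : iter m.+1 (f 0) z = z.
    by case: hD => _ /(_ z z)[_ -> //] _ _; exact: ltW.
  by elim: m.+1 => //= k ->.
have [s s0 hs] := X_lim z (ltW t0) e0.
apply: filterS (near_div_natS (ltW t0) s0) => m hm; apply: hs.
  by rewrite hm divr_gt0.
by rewrite mulrC divfK// subrr normr0.
Unshelve. all: by end_near. Qed.

Lemma product_holomorphic (t : R) : 0 <= t ->
  \forall m \near \oo, holomorphic_map (iter m.+1 (f (t / m.+1%:R))).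
Proof.
move=> t0; apply: filterS (near_div_natS t0 lambda_gt0) => m hm.
by apply: holomorphic_iter; apply: f_holo; rewrite hm divr_ge0.
Qed.

Lemma flow_continuous_space (t : R) : 0 <= t -> continuous (X t).
Proof.
move=> t0 x U /(nbhs_kobayashi hD)[e e0 he].
apply: filterS (kobayashi_ball_nbhs hD x e0) => y /= xy.
by apply: he; apply: le_lt_trans xy; exact: X_nonexp.
Qed.

(** Nonexpansiveness makes the products equicontinuous: late ones send one neighbourhood of [p] into
    a single chart domain, with bounded coordinates, as Weierstrass's theorem requires. *)
Lemma flow_holomorphic (t : R) : 0 <= t -> holomorphic_map (X t).
Proof.
move=> t0; have [Dge _ Ds Dt] := hD.
split=> [|c c' p cM c'M cp c'p]; first exact: flow_continuous_space.
have [d d0 hd] := nbhs_kobayashi hD (chart_ball_nbhs c'p ltr01).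
have d20 : 0 < d / 2 by lra.
have d40 : 0 < d / 4 by lra.
have [r r0 hr] := chart_near cp (kobayashi_ball_nbhs hD p d20).
(* From [N] on, the products are holomorphic and within [d / 4] of their limit at [p]; points within
   [d / 2] of [p] are thus sent within [d] of [X t p]. *)
have [N _ hN] := filterI (product_cvg p t0 d40) (product_holomorphic t0).
pose P m := iter (N + m).+1 (f (t / (N + m).+1%:R)).
have PN m : D (P m p) (X t p) <= d / 4 /\ holomorphic_map (P m).
  by have [] := hN (N + m)%N (leq_addr _ _).
pose y u := chart_inv c (c p + u).
have yP (u : 'C^q) : nm u < r -> [/\ dom c (y u), c (y u) = c p + u & D p (y u) < d / 2].
  by move=> hu; apply: hr; rewrite addrAC subrr add0r.
have Py m u : nm u < r -> dom c' (P m (y u)) /\ nm (c' (P m (y u)) - c' (X t p)) < 1.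
  move=> /yP[_ _ hy]; apply: hd; have [h1 h2] := PN m.
  have := Dt (X t p) (P m p) (P m (y u)); have := kobayashi_nonexp hD p (y u) h2.
  have := Ds (X t p) (P m p); lra.
apply: (@weierstrass R q q (fun m v => c' (P m (chart_inv c v))) _ (c p) r
  (1 + nm (c' (X t p)))) => //.
- move=> m u hu; have [h1 h2 _] := yP u hu; have [_ [_ h4]] := PN m.
  by rewrite -h2; apply: h4 => //; case: (Py m u hu).
- move=> m u hu; have [_ h] := Py m u hu.
  have := nmD (c' (P m (y u)) - c' (X t p)) (c' (X t p)); rewrite subrK.
  by rewrite /y in h *; lra.
- move=> u hu e e0; have [_ _ hy] := yP u hu.
  have [c'X _] : [set z | dom c' z /\ nm (c' z - c' (X t p)) < 1] (X t (y u)).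
    by apply: hd; have := X_nonexp p (y u) t0; lra.
  have [d2 d2_0 hd2] := nbhs_kobayashi hD (chart_ball_nbhs c'X e0).
  have d22 : 0 < d2 / 2 by lra.
  have [N' _ hN'] := product_cvg (y u) t0 d22.
  exists N' => // m N'm.
  have [|_ /ltW//] := hd2 (P m (y u)).
  have := hN' (N + m)%N (leq_trans N'm (leq_addl _ _)).
  by rewrite -/(P m) => h; have := Ds (X t (y u)) (P m (y u)); lra.
Qed.

(** Equicontinuity of the nonexpansive products upgrades pointwise convergence to uniform
    convergence on [K], through the near-covering form of compactness. Index 0 is dropped by
    starting at [N.+1]. *)
Lemma product_compact_open (t : R) : 0 <= t ->
  {compact-open, iter m (f (t / m%:R)) @[m --> \oo] --> X t}.
Proof.
move=> t0; have [Dge _ Ds Dt] := hD.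
apply/compact_open_cvgP => K O cK oO KO.
suff : \forall m \near \oo, K `<=` (fun x => O (iter m.+1 (f (t / m.+1%:R)) x)).
  move=> [N _ hN]; exists N.+1 => // -[//|m] Nm _ [x Kx <-].
  exact: (hN m Nm).
apply: ((compact_near_coveringP K).1 cK nat \oo
  (fun m x => O (iter m.+1 (f (t / m.+1%:R)) x))) => x Kx.
have OX : nbhs (X t x) O by apply: open_nbhs_nbhs; split => //; apply: KO; exists x.
have [e e0 he] := nbhs_kobayashi hD OX.
have e20 : 0 < e / 2 by lra.
exists ([set y | D x y < e / 2],
  [set m | D (iter m.+1 (f (t / m.+1%:R)) x) (X t x) <= e / 2 /\
    holomorphic_map (iter m.+1 (f (t / m.+1%:R)))]).
  by split; [exact: kobayashi_ball_nbhs|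
    exact: filterI (product_cvg x t0 e20) (product_holomorphic t0)].
move=> [y m] [/= xy [h1 h2]]; apply: he.
have := Dt (X t x) (iter m.+1 (f (t / m.+1%:R)) x) (iter m.+1 (f (t / m.+1%:R)) y).
have := kobayashi_nonexp hD x y h2.
have := Ds (X t x) (iter m.+1 (f (t / m.+1%:R)) x); move=> /=; lra.
Qed.

End flow_holomorphic.

(** The middle clause keeps the last one, about every associated semigroup, from being vacuous. *)
Theorem proposition2p5 (R : realType) (q : nat) (M : complex_manifold R q)
    (M_hyperbolic : complete_hyperbolic M)
    (H : holomorphic_vector_field M)
    (lambda : R) (lambda_gt0 : 0 < lambda)
    (f : R -> M -> M)
    (f_holo : forall t : R, 0 <= t < lambda -> holomorphic_map (f t))
    (f_0 : f 0 =1 id)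
    (f_cvg : {compact-open, f t @[t --> 0^'+] --> f 0})
    (f_tangent : forall w : M, tangent_near H f w) :
  [/\ infinitesimal_generator H,
      exists phi, associated_semigroup H phi &
      forall phi, associated_semigroup H phi ->
        forall t : R, 0 <= t ->
          {compact-open, iter m (f (t / m%:R)) @[m --> \oo] --> phi t}].
Proof.
have hD : is_distance (@kobayashi R q M) by case: M_hyperbolic.
have [X [X_lim X0 X_add X_nonexp X_lip]] :=
  product_flow M_hyperbolic lambda_gt0 f_holo f_tangent.
have sol z := flow_solution M_hyperbolic f_tangent X_lim X0 X_add X_lip z.
split.
- by move=> z; exists (X^~ z); exact: sol.
- exists X; split => [t t0|]; last exact: sol.
  exact: (flow_holomorphic hD lambda_gt0 f_holo f_0 X_lim X0 X_nonexp t0).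
(* Uniqueness of solutions identifies an arbitrary associated semigroup with the flow built from the
   products. *)
- move=> phi [_ phi_sol] t t0.
  have -> : phi t = X t.
    apply: funext => z.
    exact: (solution_unique M_hyperbolic f_tangent X_lim X0 X_add X_nonexp X_lip (phi_sol z) t0).
  exact: (product_compact_open hD lambda_gt0 f_holo f_0 X_lim X0 t0).
Qed.
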